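(* Let $\Omega=\{z\in\mathbb C^n:\rho(z)<0\}$ be a bounded domain, where $\rho$ is a continuous real-valued function on $\mathbb C^n$ such that there is a neighborhood $\mathcal V$ of $\{\rho(z)=0\}=\partial\Omega$ with $\rho\in\mathcal C^{1,1}(\mathcal V)$ and $|\nabla\rho(z)|\ge c_0>0$ for all $z\in\mathcal V$, for some constant $c_0$. Suppose that there is a closed set $F\subset\partial\Omega$ such that: (i) $\partial\Omega\setminus F$ is $\mathcal C^2$-smooth; (ii) $\partial\Omega\setminus F$ is locally pseudoconvex, i.e. for any $\zeta\in\partial\Omega\setminus F$ there exists $r>0$ such that $B(\zeta,r)\cap\Omega$ is pseudoconvex; (iii) $\lambda_{2n-1}(F)=0$. Then $\Omega$ is pseudoconvex.
   Context: $B(\zeta,r)$ is the open Euclidean ball of center $\zeta$ and radius $r$ in $\mathbb C^n$. $\mathcal C^{1,1}$ means continuously differentiable with Lipschitz first-order partial derivatives. $\lambda_{m}$ denotes $m$-dimensional Lebesgue measure; $\lambda_{2n-1}(F)=0$ for a subset $F$ of the real hypersurface $\partial\Omega$ means that $F$ has zero $(2n-1)$-dimensional measure in $\partial\Omega$ (equivalently, zero Lebesgue measure in local graph coordinates of $\partial\Omega$). $\partial\Omega\setminus F$ being $\mathcal C^2$-smooth means that near each of its points $\partial\Omega$ is a $\mathcal C^2$-smooth real hypersurface. An open set in $\mathbb C^n$ is pseudoconvex in the usual sense (e.g. it admits a continuous plurisubharmonic exhaustion function; equivalently, minus the logarithm of the distance to its boundary is plurisubharmonic). *)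

(* Defs.v *)
From HB Require Import structures.
From mathcomp Require Import all_boot all_order all_algebra.
From mathcomp Require Import complex.
From mathcomp Require Import all_classical all_reals all_analysis.

Set Implicit Arguments.
Unset Strict Implicit.
Unset Printing Implicit Defensive.
Import Order.TTheory GRing.Theory Num.Theory.
Import numFieldNormedType.Exports.
Local Open Scope classical_set_scope.
Local Open Scope ring_scope.

(* The library norm on ['rV[R]_m] is the sup norm; it has the same open,
   bounded and compact sets and the same Lipschitz functions as the Euclidean
   one, but balls and gradient lengths below are Euclidean. *)
Definition euclid_norm (R : realType) (m : nat) (x : 'rV[R]_m) : R :=
  Num.sqrt (\sum_(i < m) x 0 i ^+ 2).

Definition euclid_ball (R : realType) (m : nat) (c : 'rV[R]_m) (r : R) :
    set 'rV[R]_m :=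
  [set x | euclid_norm (x - c) < r].

Definition boundary (T : topologicalType) (A : set T) : set T :=
  closure A `\` interior A.

Definition domain (T : topologicalType) (A : set T) : Prop :=
  [/\ open A, connected A & A !=set0].

Section Smoothness.
Variables (R : realType) (m : nat).
Implicit Types (f : 'rV[R]_m -> R) (U S : set 'rV[R]_m).

Definition partial (i : 'I_m) f : 'rV[R]_m -> R :=
  fun x => 'D_(delta_mx 0 i) f x.

Definition gradient f (x : 'rV[R]_m) : 'rV[R]_m := \row_i partial i f x.

(* These three are meant for open U. *)
Definition C1_on U f : Prop :=
  forall i : 'I_m,
    (forall x, U x -> derivable f x (delta_mx 0 i)) /\
    {in U, continuous (partial i f)}.

Definition C2_on U f : Prop :=
  C1_on U f /\ forall i : 'I_m, C1_on U (partial i f).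

Definition C11_on U f : Prop :=
  C1_on U f /\ forall i : 'I_m, [lipschitz partial i f x | x in U].

Definition C2_hypersurface_at S (p : 'rV[R]_m) : Prop :=
  exists (U : set 'rV[R]_m) (f : 'rV[R]_m -> R),
    [/\ open U, U p, C2_on U f,
        forall x, U x -> gradient f x != 0 &
        S `&` U = [set x | U x /\ f x = 0]].

End Smoothness.

Section NullSets.
Variable R : realType.

Definition box (m : nat) (a b : 'rV[R]_m) : set 'rV[R]_m :=
  [set x | forall i, a 0 i <= x 0 i <= b 0 i].

Definition lebesgue_outer (m : nat) (A : set 'rV[R]_m) : \bar R :=
  ereal_inf [set s | exists a b : nat -> 'rV[R]_m,
    [/\ forall k i, a k 0 i <= b k 0 i,
        A `<=` \bigcup_k box (a k) (b k) &
        s = (\sum_(0 <= k <oo) (\prod_(i < m) (b k 0 i - a k 0 i))%:E)%E]].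

Definition lebesgue_null (m : nat) (A : set 'rV[R]_m) : Prop :=
  lebesgue_outer A = 0%E.

(* S is, in U, the graph of a C^1 function g giving the k-th coordinate in
   terms of the m - 1 others. *)
Definition local_graph (m : nat) (S U : set 'rV[R]_m) (k : 'I_m)
    (W : set 'rV[R]_m.-1) (g : 'rV[R]_m.-1 -> R) : Prop :=
  [/\ open W, C1_on W g, (forall x, U x -> W (col' k x)) &
      S `&` U = [set x | U x /\ x 0 k = g (col' k x)]].

(* The (m-1)-dimensional measure of F in the hypersurface S is 0, read in local
   graph coordinates. Since C^1 changes of coordinates preserve Lebesgue-null
   sets, it does not matter which chart is taken around a point. *)
Definition hypersurface_null (m : nat) (S F : set 'rV[R]_m) : Prop :=
  forall p, F p ->
    exists (U : set 'rV[R]_m) (k : 'I_m)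
           (W : set 'rV[R]_m.-1) (g : 'rV[R]_m.-1 -> R),
      [/\ open U, U p, local_graph S U k W g &
          lebesgue_null [set col' k x | x in F `&` U]].

End NullSets.

(* C^n is R^(2n): the point x + i y is [row_mx x y], with x, y in R^n. *)
Section ComplexSpace.
Variables (R : realType) (n : nat).
Local Notation Cn := ('rV[R]_(n + n)).
Implicit Types (D : set Cn) (u : Cn -> R).

Definition complex_scale (a : R[i]) (w : Cn) : Cn :=
  let x := lsubmx w in
  let y := rsubmx w in
  row_mx (complex.Re a *: x - complex.Im a *: y)
         (complex.Re a *: y + complex.Im a *: x).

(* Real-valued u only: the value -oo does not occur below. *)
Definition plurisubharmonic D u : Prop :=
  (forall z, D z -> forall c, u z < c -> \forall x \near z, u x < c) /\
  (forall z w : Cn,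
     (forall a : R[i], `|a| <= 1 -> D (z + complex_scale a w)) ->
     ((u z)%:E <= ((2 * pi)^-1)%:E *
        \int[lebesgue_measure]_(t in `[0%R, (2 * pi)%R])
          (u (z + complex_scale (Complex (cos t) (sin t)) w)%R)%:E)%E).

Definition exhaustion D u : Prop :=
  forall c : R, let L := [set z | D z /\ u z < c] in
    precompact L /\ closure L `<=` D.

Definition pseudoconvex D : Prop :=
  open D /\
  exists u : Cn -> R,
    [/\ {in D, continuous u}, plurisubharmonic D u & exhaustion D u].

End ComplexSpace.

(* Main.v *)
Require Import Defs.
From mathcomp Require Import all_boot all_order all_algebra.
From mathcomp Require Import ring lra complex finmap.
From mathcomp Require Import all_classical all_reals all_analysis.

(* Let d be the distance to the complement of Omega; u = - ln d is an exhaustion function, and the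
   point is that it is plurisubharmonic. At a point of Omega whose nearest boundary point lies off
   F, the boundary has nonnegative Levi form there, and comparison with an osculating quadratic
   disc gives the sub-mean value inequality of u on small circles up to o(r^2). The other points of
   Omega lie on the inner normals to the boundary at points of F. The normal b - t grad rho(b) is
   Lipschitz in (b, t) because rho is C^{1,1}, so these points form a Lebesgue null set. As d^2 is
   an infimum of functions |x|^2 + affine, u is locally semiconvex, and Jensen's lemma finds, near
   any maximum of a semiconvex function, points outside of a given null set that are touched from
   above by a hyperplane. If u violated the sub-mean value inequality on some disc, the average of
   u over N rotations of that disc, slightly perturbed, would have such a maximum, and the
   infinitesimal inequality at the rotated copies of a contact point off the null set would fail. *)

Set Implicit Arguments.
Unset Strict Implicit.
Unset Printing Implicit Defensive.
Import Order.TTheory GRing.Theory Num.Theory.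
Import numFieldNormedType.Exports.
Local Open Scope classical_set_scope.
Local Open Scope ring_scope.

(** An inequality valid off a null set proves nothing by itself: minus the absolute value of one
    real coordinate is pluriharmonic off a hyperplane but not plurisubharmonic. Semiconvexity
    excludes such concave creases. A given disc may also lie wholly in the exceptional set, so the
    inequality cannot be integrated along it; contact points are sought in a full tube around the
    disc instead. On the edge of the disc only a mean of u is known to be small, whereas an interior
    maximum requires smallness at every edge point; summing over rotations turns means into values.
    Finitely many rotations suffice because u is locally Lipschitz, and they leave finitely many
    preimages of the null set to avoid. Second-order information is carried by sums over the four
    points z + c w with c^4 = 1, in which linear and harmonic quadratic terms cancel, so that u
    itself is never differentiated. On the side of the hypothesis, the definition of
    plurisubharmonicity controls means over affine discs only, while the Levi form is detected by
    quadratic ones; a maximum principle on quadratic discs fills this gap. *)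

Section SupTopology.
Context {R : realType} {m : nat}.
Implicit Types (A : set 'rV[R]_m) (x : 'rV[R]_m).

Lemma nbhs_supP x A : nbhs x A -> exists2 e : R, 0 < e & forall y, `|y - x| < e -> A y.
Proof.
move=> /nbhs_ballP[e /= e0 H]; exists e => // y yx; apply: H.
by rewrite -ball_normE /= distrC.
Qed.

Lemma nbhs_sup x A (e : R) : 0 < e -> (forall y, `|y - x| < e -> A y) -> nbhs x A.
Proof.
move=> e0 H; apply/nbhs_ballP; exists e => // y; rewrite -ball_normE /= distrC.
exact: H.
Qed.

Lemma continuous_supP (f : 'rV[R]_m -> R) x : {for x, continuous f} <->
  (forall e : R, 0 < e -> exists2 d : R, 0 < d & forall y, `|y - x| < d -> `|f y - f x| < e).
Proof.
split=> [/(@cvgrPdist_lt _ _ _ (nbhs x)) H e /H/nbhs_supP[d d0 {}H]|H].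
  by exists d => // y /H; rewrite distrC.
apply/(@cvgrPdist_lt _ _ _ (nbhs x)) => e /H[d d0 {}H].
by apply: (nbhs_sup d0) => y /H; rewrite distrC.
Qed.

Lemma lip_continuous (f : 'rV[R]_m -> R) (C : R) :
  (forall x y, `|f x - f y| <= C * `|x - y|) -> continuous f.
Proof.
move=> H x; apply/continuous_supP => e e0.
have C1 : 0 < `|C| + 1 by rewrite ltr_wpDl.
exists (e / (`|C| + 1)); first by rewrite divr_gt0.
move=> y; rewrite ltr_pdivlMr// mulrC => yx; apply: le_lt_trans (H _ _) _.
apply: le_lt_trans yx; by rewrite ler_wpM2r// (le_trans (ler_norm _))// lerDl.
Qed.

End SupTopology.

(** * Euclidean inner product and norm, compared with the sup norm *)

Section Euclid.
Context {R : realType} {m : nat}.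
Implicit Types (x y z : 'rV[R]_m) (a : R).

Definition dot x y : R := \sum_(i < m) x 0 i * y 0 i.

Lemma dotC x y : dot x y = dot y x.
Proof. by apply: eq_bigr => i _; rewrite mulrC. Qed.

Lemma dotDl x y z : dot (x + y) z = dot x z + dot y z.
Proof. by rewrite /dot -big_split; apply: eq_bigr => i _; rewrite mxE mulrDl. Qed.

Lemma dotDr x y z : dot z (x + y) = dot z x + dot z y.
Proof. by rewrite dotC dotDl !(dotC z). Qed.

Lemma dotZl a x y : dot (a *: x) y = a * dot x y.
Proof. by rewrite /dot mulr_sumr; apply: eq_bigr => i _; rewrite mxE mulrA. Qed.

Lemma dotZr a x y : dot x (a *: y) = a * dot x y.
Proof. by rewrite dotC dotZl dotC. Qed.

Lemma dotNl x y : dot (- x) y = - dot x y.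
Proof. by rewrite -scaleN1r dotZl mulN1r. Qed.

Lemma dotNr x y : dot x (- y) = - dot x y.
Proof. by rewrite dotC dotNl dotC. Qed.

Lemma dot0l y : dot 0 y = 0.
Proof. by rewrite -(scale0r y) dotZl mul0r. Qed.

Lemma dot0r y : dot y 0 = 0.
Proof. by rewrite dotC dot0l. Qed.

Definition dotE := (dotDl, dotDr, dotNl, dotNr, dotZl, dotZr, dot0l, dot0r).

Lemma dot_ge0 x : 0 <= dot x x.
Proof. by apply: sumr_ge0 => i _; rewrite -expr2 sqr_ge0. Qed.

Lemma en_ge0 x : 0 <= euclid_norm x.
Proof. exact: sqrtr_ge0. Qed.

Lemma en_sq x : euclid_norm x ^+ 2 = dot x x.
Proof.
rewrite /euclid_norm sqr_sqrtr; first by apply: eq_bigr => i _; rewrite expr2.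
by apply: sumr_ge0 => i _; rewrite sqr_ge0.
Qed.

Lemma en_le x a : 0 <= a -> (euclid_norm x <= a) = (dot x x <= a ^+ 2).
Proof. by move=> a0; rewrite -en_sq ler_pXn2r// nnegrE en_ge0. Qed.

Lemma en_lt x a : 0 <= a -> (euclid_norm x < a) = (dot x x < a ^+ 2).
Proof. by move=> a0; rewrite -en_sq ltr_pXn2r// nnegrE en_ge0. Qed.

Lemma en_sqrt x : euclid_norm x = Num.sqrt (dot x x).
Proof. by rewrite -en_sq sqrtr_sqr ger0_norm// en_ge0. Qed.

Lemma ler_coord_en x i : `|x 0 i| <= euclid_norm x.
Proof.
rewrite -ler_sqr ?nnegrE ?en_ge0// en_sq real_normK ?num_real// /dot (bigD1 i)//=.
by rewrite -expr2 lerDl; apply: sumr_ge0 => j _; rewrite -expr2 sqr_ge0.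
Qed.

Lemma sup_le_en x : `|x| <= euclid_norm x.
Proof.
rewrite [leLHS]mx_normrE; apply: bigmax_le => [|[i j] _ /=]; first exact: en_ge0.
by rewrite ord1; exact: ler_coord_en.
Qed.

Lemma ler_coord_sup x i : `|x 0 i| <= `|x|.
Proof.
rewrite [leRHS]mx_normrE.
exact: (le_bigmax _ (fun ij : 'I_1 * 'I_m => `|x ij.1 ij.2|) (0, i)).
Qed.

Lemma dot_eq0 x : dot x x = 0 -> x = 0.
Proof.
move=> x0; have e0 : euclid_norm x = 0 by rewrite en_sqrt x0 sqrtr0.
by apply/eqP; rewrite -normr_le0 -e0 sup_le_en.
Qed.

Lemma dot_gt0 x : x != 0 -> 0 < dot x x.
Proof.
by move=> x0; rewrite lt_def dot_ge0 andbT; apply: contra x0 => /eqP/dot_eq0->.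
Qed.

Lemma en_gt0 x : x != 0 -> 0 < euclid_norm x.
Proof. by move=> /dot_gt0 x0; rewrite en_sqrt sqrtr_gt0. Qed.

Lemma en0 : euclid_norm (0 : 'rV[R]_m) = 0.
Proof. by rewrite en_sqrt dot0l sqrtr0. Qed.

Lemma enZ a x : euclid_norm (a *: x) = `|a| * euclid_norm x.
Proof. by rewrite !en_sqrt !dotE mulrA -expr2 sqrtrM ?sqr_ge0// sqrtr_sqr. Qed.

Lemma enN x : euclid_norm (- x) = euclid_norm x.
Proof. by rewrite -scaleN1r enZ normrN1 mul1r. Qed.

Lemma enBC x y : euclid_norm (x - y) = euclid_norm (y - x).
Proof. by rewrite -enN opprB. Qed.

Lemma cauchy_schwarz x y : dot x y <= euclid_norm x * euclid_norm y.
Proof.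
have [->|x0] := eqVneq x 0; first by rewrite dot0l en0 mul0r.
have := dot_ge0 (dot x x *: y - dot x y *: x).
rewrite !dotE (dotC y x) => H.
have x1 := dot_gt0 x0.
have : (dot x y) ^+ 2 <= (euclid_norm x * euclid_norm y) ^+ 2.
  rewrite exprMn !en_sq -(ler_pM2l x1); lra.
move=> H1; apply: le_trans (ler_norm _) _.
by rewrite -ler_sqr ?nnegrE ?mulr_ge0 ?en_ge0// real_normK ?num_real.
Qed.

Lemma cauchy_schwarz_abs x y : `|dot x y| <= euclid_norm x * euclid_norm y.
Proof.
rewrite ler_norml cauchy_schwarz andbT lerNl -dotNl -(enN x).
exact: cauchy_schwarz.
Qed.

Lemma enD x y : euclid_norm (x + y) <= euclid_norm x + euclid_norm y.
Proof.
rewrite en_le ?addr_ge0 ?en_ge0// sqrrD !en_sq !dotE (dotC y x).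
have := cauchy_schwarz x y; lra.
Qed.

Lemma en_sqD x y :
  euclid_norm (x + y) ^+ 2 = euclid_norm x ^+ 2 + 2 * dot x y + euclid_norm y ^+ 2.
Proof. rewrite !en_sq dotDl !dotDr (dotC y); ring. Qed.

Lemma en_triangle z x y : euclid_norm (x - y) <= euclid_norm (x - z) + euclid_norm (z - y).
Proof. by apply: le_trans (enD _ _); rewrite addrA subrK. Qed.

Lemma en_le_sup x : euclid_norm x <= m%:R * `|x|.
Proof.
rewrite en_le ?mulr_ge0// exprMn.
apply: (@le_trans _ _ (\sum_(i < m) `|x| ^+ 2)).
  apply: ler_sum => i _; rewrite -expr2 -(real_normK (num_real (x 0 i))).
  by rewrite ler_pXn2r// ?nnegrE// ler_coord_sup.
rewrite sumr_const card_ord -[leLHS]mulr_natl ler_wpM2r ?sqr_ge0//.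
by rewrite -natrX ler_nat; case: (m) => // k; rewrite leq_pmull.
Qed.

Lemma sup_lt_coord x a : 0 < a -> (forall i, `|x 0 i| < a) -> `|x| < a.
Proof.
move=> a0 H; rewrite [ltLHS]mx_normrE; apply: bigmax_lt => // -[i j] _ /=.
by rewrite ord1 H.
Qed.

Lemma sup_le_coord x a : 0 <= a -> (forall i, `|x 0 i| <= a) -> `|x| <= a.
Proof.
move=> a0 H; rewrite [leLHS]mx_normrE; apply: bigmax_le => // -[i j] _ /=.
by rewrite ord1 H.
Qed.

Lemma en_lip x y : `|euclid_norm x - euclid_norm y| <= euclid_norm (x - y).
Proof.
have h x1 y1 : euclid_norm x1 - euclid_norm y1 <= euclid_norm (x1 - y1).
  by rewrite lerBlDr; apply: le_trans (enD _ _); rewrite subrK.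
by rewrite ler_norml h lerNl opprB enBC h.
Qed.

Lemma continuous_en : continuous (@euclid_norm R m).
Proof.
apply: (@lip_continuous _ _ _ m%:R) => x y; apply: le_trans (en_lip _ _) _.
exact: en_le_sup.
Qed.

Lemma continuous_dotl y : continuous (fun x => dot x y).
Proof.
apply: (@lip_continuous _ _ _ (euclid_norm y * m%:R)) => a b.
rewrite -dotNl -dotDl (le_trans (cauchy_schwarz_abs _ _))// mulrC -mulrA.
by rewrite ler_wpM2l ?en_ge0// en_le_sup.
Qed.

Lemma continuous_dot_self : continuous (fun x : 'rV[R]_m => dot x x).
Proof.
have -> : (fun x => dot x x) = (fun t : R => t ^+ 2) \o @euclid_norm R m.
  by apply/funext => y; rewrite /= en_sq.
move=> x; apply: continuous_comp; first exact: continuous_en.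
exact: exprn_continuous.
Qed.

Lemma dot_delta x i : dot x (delta_mx 0 i) = x 0 i.
Proof.
rewrite /dot (bigD1 i)//= mxE !eqxx mulr1 big1 ?addr0// => j ji.
by rewrite mxE eqxx/= (negbTE ji) mulr0.
Qed.

Lemma en_delta i : euclid_norm (delta_mx 0 i : 'rV[R]_m) = 1.
Proof. by rewrite en_sqrt dot_delta mxE !eqxx sqrtr1. Qed.

End Euclid.

Lemma nbhs_enP {R : realType} {m : nat} (x : 'rV[R]_m) (A : set 'rV[R]_m) : nbhs x A ->
  exists2 e : R, 0 < e & forall y, euclid_norm (y - x) < e -> A y.
Proof.
move=> /nbhs_supP[e e0 H]; exists e => // y yx; apply: H.
exact: le_lt_trans (sup_le_en _) yx.
Qed.

(** * Bilinear forms *)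

Section Quadratic.
Context {R : realType} {m : nat}.
Implicit Types (M : 'M[R]_m) (x y z : 'rV[R]_m) (a : R).

Definition bilin M x y : R := dot (x *m M) y.

Lemma bilinDl M x y z : bilin M (x + y) z = bilin M x z + bilin M y z.
Proof. by rewrite /bilin mulmxDl dotDl. Qed.

Lemma bilinDr M x y z : bilin M z (x + y) = bilin M z x + bilin M z y.
Proof. by rewrite /bilin dotDr. Qed.

Lemma bilinZl M a x y : bilin M (a *: x) y = a * bilin M x y.
Proof. by rewrite /bilin -scalemxAl dotZl. Qed.

Lemma bilinZr M a x y : bilin M x (a *: y) = a * bilin M x y.
Proof. by rewrite /bilin dotZr. Qed.

Lemma bilin_bound M : exists2 C : R, 0 < C & forall x y, `|bilin M x y| <= C * `|x| * `|y|.
Proof.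
exists (1 + \sum_(i < m) \sum_(j < m) `|M j i|).
  by rewrite ltr_wpDr//; apply: sumr_ge0 => i _; apply: sumr_ge0.
move=> x y; rewrite /bilin /dot.
apply: le_trans (ler_norm_sum _ _ _) _.
rewrite -mulrA mulrDl mul1r ler_wpDl ?mulr_ge0// mulr_suml; apply: ler_sum => i _.
rewrite normrM mxE mulrA ler_pM// ?ler_coord_sup//.
apply: le_trans (ler_norm_sum _ _ _) _.
rewrite mulr_suml; apply: ler_sum => j _.
by rewrite normrM mulrC ler_wpM2l// ler_coord_sup.
Qed.

End Quadratic.

(** * First- and second-order expansions from partial derivatives *)

Section Increments.
Context {R : realType} {m : nat}.
Implicit Types (f : 'rV[R]_m -> R) (x y z v : 'rV[R]_m).

Lemma is_derive_line f x v (s : R) : derivable f (x + s *: v) v ->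
  is_derive s 1 (fun s => f (x + s *: v)) ('D_v f (x + s *: v)).
Proof.
move=> dfv.
have E : (fun h : R => h^-1 *: (((fun s => f (x + s *: v)) \o shift s) (h *: (1 : R)) - f (x + s *: v)))
       = (fun h : R => h^-1 *: ((f \o shift (x + s *: v)) (h *: v) - f (x + s *: v))).
  apply/funext => h /=; congr (_ *: (f _ - _)).
  by rewrite scalerDl [h *: 1]mulr1 addrCA.
by split; rewrite /derivable /derive E.
Qed.

(** The mean value theorem for [f (x + s *: v) - A * s - B / 2 * s ^+ 2]. With [B = 0] it serves the
    first-order expansion, with [B] a pure second derivative the Taylor expansion. *)
Lemma line_increment f x v (t A B e : R) :
  (forall s, `|s| <= `|t| -> derivable f (x + s *: v) v /\
     `|'D_v f (x + s *: v) - A - B * s| <= e) ->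
  `|f (x + t *: v) - f x - A * t - B * t ^+ 2 / 2| <= e * `|t|.
Proof.
move=> H.
pose g s := f (x + s *: v) - A * s - B / 2 * s ^+ 2.
pose dg (s : R) : R := 'D_v f (x + s *: v) - A - B * s.
have gd (s : R) : `|s| <= `|t| -> is_derive s 1 g (dg s).
  move=> /H[dfs _]; have := is_derive_line dfs => ds.
  rewrite /g /dg; apply: is_derive_eq; rewrite /GRing.scale/= !mulr1; lra.
have -> : f (x + t *: v) - f x - A * t - B * t ^+ 2 / 2 = g t - g 0.
  by rewrite /g scale0r addr0; ring.
have gc (s : R) : `|s| <= `|t| -> {for s, continuous g}.
  move=> /gd gs; apply: differentiable_continuous; apply/derivable1_diffP.
  by have [] := gs.
have [t0|t0] := leP 0 t.
  have [c|s|c] := @MVT_segment _ g dg 0 t t0.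
  - rewrite in_itv/= => /andP[c0 ct]; apply: gd; rewrite !ger0_norm ?(ltW c0) ?(ltW ct)//.
  - apply: continuous_in_subspaceT => c; rewrite inE/= in_itv/= => /andP[c0 ct].
    by apply: gc; rewrite !ger0_norm.
  rewrite in_itv/= => /andP[c0 ct]; rewrite subr0 => ->; rewrite normrM ler_wpM2r//.
  have cc : `|c| <= `|t| by rewrite !ger0_norm.
  by have [_] := H c cc.
have [c|s|c] := @MVT_segment _ g dg t 0 (ltW t0).
- rewrite in_itv/= => /andP[c0 ct]; apply: gd; rewrite !ltr0_norm// lerN2 ltW//.
- apply: continuous_in_subspaceT => c; rewrite inE/= in_itv/= => /andP[c0 ct].
  by apply: gc; rewrite (ltr0_norm t0) ler0_norm// lerN2.
rewrite in_itv/= => /andP[c0 ct]; rewrite distrC => ->; rewrite sub0r normrM normrN ler_wpM2r//.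
have cc : `|c| <= `|t| by rewrite (ltr0_norm t0) ler0_norm// lerN2.
by have [_] := H c cc.
Qed.

(** Leads from [x] to [x + v] one coordinate at a time, so that increments are controlled by partial
    derivatives, the only derivatives that [C1_on] provides. *)
Definition coord_path x v (k : nat) : 'rV[R]_m :=
  \row_i (if (i < k)%N then x 0 i + v 0 i else x 0 i).

Lemma coord_pathS x v (k : 'I_m) :
  coord_path x v k.+1 = coord_path x v k + v 0 k *: delta_mx 0 k.
Proof.
apply/rowP => i; rewrite !mxE eqxx/= ltnS leq_eqVlt.
have [->|ik] := eqVneq i k; first by rewrite eqxx ltnn mulr1.
by rewrite (negbTE (_ : nat_of_ord i != k))//= mulr0 addr0.
Qed.

Lemma coord_path_near x v (k : 'I_m) (s : R) : `|s| <= `|v 0 k| ->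
  `|coord_path x v k + s *: delta_mx 0 k - x| <= `|v|.
Proof.
move=> sv; apply: sup_le_coord => // i; rewrite !mxE eqxx/=.
have [->|ik] := eqVneq i k.
  by rewrite ltnn mulr1 addrC addKr (le_trans sv)// ler_coord_sup.
rewrite mulr0 addr0; case: ifP => _; last by rewrite subrr normr0.
by rewrite addrC addKr ler_coord_sup.
Qed.

Lemma coord_path_increment f x v (A B : 'I_m -> R) (e : R) :
  (forall (k : 'I_m) s, `|s| <= `|v 0 k| ->
     let p := coord_path x v k + s *: delta_mx 0 k in
     derivable f p (delta_mx 0 k) /\ `|partial k f p - A k - B k * s| <= e) ->
  0 <= e ->
  `|f (x + v) - f x - \sum_(k < m) (A k * v 0 k + B k * v 0 k ^+ 2 / 2)| <= e * m%:R * `|v|.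
Proof.
move=> H e0.
have -> : f (x + v) = f (coord_path x v m).
  by congr f; apply/rowP => i; rewrite !mxE ltn_ord.
have {2}-> : x = coord_path x v 0 by apply/rowP => i; rewrite mxE.
rewrite -(telescope_sumr (fun k => f (coord_path x v k)))// big_mkord -sumrB.
apply: le_trans (ler_norm_sum _ _ _) _.
apply: (@le_trans _ _ (\sum_(i < m) e * `|v|)); last first.
  by rewrite sumr_const card_ord -[leLHS]mulr_natr mulrAC.
apply: ler_sum => k _.
have := @line_increment f (coord_path x v k) (delta_mx 0 k) (v 0 k) (A k) (B k) e (H k).
rewrite coord_pathS opprD addrA => /le_trans; apply.
by rewrite ler_wpM2l// ler_coord_sup.
Qed.

(** Both points move: this strict form of differentiability yields uniform growth along a direction
    near [x] and Lipschitz bounds for graphs. *)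
Lemma C1_strict_diff (U : set 'rV[R]_m) f x (e : R) : open U -> C1_on U f -> U x -> 0 < e ->
  exists2 d : R, 0 < d & forall y z, `|y - x| < d -> `|z - x| < d ->
    `|f z - f y - dot (gradient f x) (z - y)| <= e * `|z - y|.
Proof.
move=> Uo Uf Ux e0.
(* The [m] coordinates share the error; the successor keeps the divisor nonzero in dimension 0. *)
pose e' := e / m.+1%:R.
have e'0 : 0 < e' by rewrite divr_gt0.
have : \forall y \near x, U y /\ forall k : 'I_m, `|partial k f y - partial k f x| < e'.
  apply: filterI; first exact: open_nbhs_nbhs.
  apply: (@filter_forall _ _ _ (nbhs x)) => k.
  have [_ /(_ x)] := Uf k; rewrite inE => /(_ Ux)/continuous_supP/(_ _ e'0)[d d0].
  exact: nbhs_sup.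
(* Two points within [d / 3] of [x] are less than [2 * d / 3] apart, so the coordinate path between
   them stays within [d] of [x]. *)
move=> /nbhs_supP[d d0 H]; exists (d / 3); first by rewrite divr_gt0.
move=> y z yd zd.
have zyd : `|z - y| < d / 3 + d / 3.
  by rewrite (le_lt_trans (ler_distD x _ _))// (distrC x) ltrD.
have := @coord_path_increment f y (z - y) (fun k => partial k f x) (fun=> 0) e'.
have -> : y + (z - y) = z by rewrite addrC subrK.
move=> HH; apply: le_trans; last apply: (le_trans (HH _ (ltW e'0))).
- rewrite le_eqVlt; apply/orP; left; apply/eqP; congr `|_ - _|; apply: eq_bigr => k _.
  by rewrite !mxE; ring.
- move=> k s /coord_path_near - /(_ y) ps.
  have /H[Up Hp] : `|coord_path y (z - y) k + s *: delta_mx 0 k - x| < d.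
    apply: le_lt_trans (ler_distD y _ _) _.
    have -> : d = d / 3 + d / 3 + d / 3 by lra.
    by apply: ltrD => //; apply: le_lt_trans zyd.
  split; first exact: (Uf k).1.
  by rewrite mul0r subr0 ltW.
- rewrite ler_wpM2r// -mulrA ger_pMr//.
  by rewrite mulrC ler_pdivrMr// mul1r ler_nat.
Qed.

Lemma C2_taylor (U : set 'rV[R]_m) f x : open U -> C2_on U f -> U x ->
  exists M : 'M[R]_m, forall e : R, 0 < e -> exists2 d : R, 0 < d & forall v, `|v| < d ->
    `|f (x + v) - f x - dot (gradient f x) v - bilin M v v| <= e * `|v| ^+ 2.
Proof.
move=> Uo [U1 U2] Ux.
pose H k j : R := partial j (partial k f) x.
(* Triangular because of the coordinate path: when coordinate [k] moves, only the coordinates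
   [j < k] have moved already. Each mixed derivative thus occurs once with full weight, and
   integration halves the diagonal. *)
exists (\matrix_(j, k) (if (j < k)%N then H k j else if j == k then H k k / 2 else 0)).
move=> e e0.
pose e' := e / m.+1%:R.
have e'0 : 0 < e' by rewrite divr_gt0.
have : \forall y \near x, U y /\ forall k : 'I_m,
   `|partial k f y - partial k f x - dot (gradient (partial k f) x) (y - x)| <= e' * `|y - x|.
  apply: filterI; first exact: open_nbhs_nbhs.
  apply: (@filter_forall _ _ _ (nbhs x)) => k.
  have [d d0 {}H] := C1_strict_diff Uo (U2 k) Ux e'0.
  by apply: (nbhs_sup d0) => y yx; apply: H => //; rewrite subrr normr0.
move=> /nbhs_supP[d d0 HU]; exists d => // v vd.
have := @coord_path_increment f x v
   (fun k => partial k f x + \sum_(j < m | (j < k)%N) H k j * v 0 j) (fun k => H k k) (e' * `|v|).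
move=> HH; apply: le_trans; last apply: (le_trans (HH _ _)).
- rewrite le_eqVlt; apply/orP; left; apply/eqP; congr `|_|; rewrite -addrA -opprD; congr (_ - _).
  rewrite /dot /bilin /dot -big_split; apply: eq_bigr => k _ /=.
  rewrite (_ : (v *m _) 0 k = \sum_(j < m | (j < k)%N) H k j * v 0 j + H k k / 2 * v 0 k).
    by rewrite mxE; ring.
  rewrite mxE (bigID (fun j : 'I_m => (j < k)%N))/=; congr (_ + _).
    by apply: eq_bigr => j jk; rewrite mxE jk mulrC.
  rewrite (bigD1 k) ?ltnn//= mxE ltnn eqxx big1 ?addr0 => [|j /andP[jk jk']]; first by rewrite mulrC.
  by rewrite mxE (negbTE jk) (negbTE jk') mulr0.
- move=> k s sv; have ps := coord_path_near x sv.
  set p := coord_path x v k + _ in ps *.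
  have /HU[Up Hp] : `|p - x| < d by apply: le_lt_trans vd.
  split; first exact: (U1 k).1.
  apply: le_trans (le_trans (Hp k) _); last by rewrite ler_wpM2l// ltW.
  rewrite le_eqVlt; apply/orP; left; apply/eqP; congr `|_|.
  suff -> : dot (gradient (partial k f) x) (p - x) =
     \sum_(j < m | (j < k)%N) H k j * v 0 j + H k k * s by ring.
  rewrite /dot (bigID (fun j : 'I_m => (j < k)%N))/=; congr (_ + _).
    apply: eq_bigr => j jk; have jk' : (j == k) = false by apply: contraTF jk => /eqP->; rewrite ltnn.
    by rewrite !mxE jk eqxx/= jk' mulr0 addr0 [_ + v 0 j]addrC addrK.
  rewrite (bigD1 k) ?ltnn//= !mxE !eqxx ltnn mulr1 [x 0 k + s]addrC addrK big1 ?addr0// => j /andP[jk jk'].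
  by rewrite !mxE (negbTE jk) (negbTE jk') mulr0 addr0 subrr mulr0.
- by rewrite mulr_ge0// ltW.
- rewrite [leLHS](_ : _ = e' * m%:R * `|v| ^+ 2); last by ring.
  rewrite ler_wpM2r ?sqr_ge0// -mulrA ger_pMr//.
  by rewrite mulrC ler_pdivrMr// mul1r ler_nat.
Qed.

End Increments.

(** * Multiplication by complex numbers and means over circles *)

Section ComplexStructure.
Context {R : realType} {n : nat}.
Local Notation Cn := ('rV[R]_(n + n)).
Implicit Types (x y z w : Cn) (a s t : R).

Definition mulI w : Cn := row_mx (- rsubmx w) (lsubmx w).

Lemma mulID x y : mulI (x + y) = mulI x + mulI y.
Proof. by rewrite /mulI !raddfD/= add_row_mx -opprD raddfD. Qed.

Lemma mulIZ a x : mulI (a *: x) = a *: mulI x.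
Proof. by rewrite /mulI !linearZ/= scale_row_mx scalerN. Qed.

Lemma mulIN x : mulI (- x) = - mulI x.
Proof. by rewrite -scaleN1r mulIZ scaleN1r. Qed.

Lemma mulI0 : mulI 0 = 0.
Proof. by have := mulIZ 0 0; rewrite !scale0r. Qed.

Lemma mulII x : mulI (mulI x) = - x.
Proof.
rewrite /mulI row_mxKr row_mxKl -[in RHS](hsubmxK x) opp_row_mx.
by [].
Qed.

Lemma dot_row_mx (a b c d : 'rV[R]_n) : dot (row_mx a b) (row_mx c d) = dot a c + dot b d.
Proof.
rewrite /dot big_split_ord /=; congr (_ + _); apply: eq_bigr => i _.
  by rewrite !row_mxEl.
by rewrite !row_mxEr.
Qed.

Lemma dot_mulI x y : dot (mulI x) (mulI y) = dot x y.
Proof.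
rewrite /mulI dot_row_mx dotNl dotNr opprK addrC -dot_row_mx.
by rewrite !hsubmxK.
Qed.

Lemma dot_mulIl x y : dot (mulI x) y = - dot x (mulI y).
Proof. by rewrite -dot_mulI mulII dotNl. Qed.

Lemma dot_mulI_self x : dot x (mulI x) = 0.
Proof. have := dot_mulIl x x; rewrite dotC => h; lra. Qed.

Lemma en_mulI x : euclid_norm (mulI x) = euclid_norm x.
Proof. by rewrite !en_sqrt dot_mulI. Qed.

(** Multiplication by s + i t, with real and imaginary parts kept apart so that identities reduce to
    real polynomial ones. *)
Definition cscl s t w : Cn := s *: w + t *: mulI w.

Lemma complex_scaleE (c : R[i]) w :
  complex_scale c w = cscl (complex.Re c) (complex.Im c) w.
Proof.
rewrite /complex_scale /cscl /mulI scale_row_mx -[in RHS](hsubmxK w) scale_row_mx.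
by rewrite row_mxKl row_mxKr add_row_mx scalerN.
Qed.

Lemma csclD s t x y : cscl s t (x + y) = cscl s t x + cscl s t y.
Proof. by rewrite /cscl mulID !scalerDr addrACA. Qed.

Lemma csclZ s t a x : cscl s t (a *: x) = a *: cscl s t x.
Proof. by rewrite /cscl mulIZ scalerDr !scalerA mulrC [t * a]mulrC. Qed.

Lemma csclN s t x : cscl s t (- x) = - cscl s t x.
Proof. by rewrite -scaleN1r csclZ scaleN1r. Qed.

Lemma cscl_mulI s t x : cscl s t (mulI x) = mulI (cscl s t x).
Proof. by rewrite /cscl mulID !mulIZ. Qed.

Lemma csclM s t s' t' x :
  cscl s t (cscl s' t' x) = cscl (s * s' - t * t') (s * t' + t * s') x.
Proof.
rewrite /cscl mulID !mulIZ mulII scalerBl scalerDl !scalerDr !scalerA !scalerN.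
by rewrite [X in _ + X = _]addrC addrACA.
Qed.

Lemma cscl1 x : cscl 1 0 x = x.
Proof. by rewrite /cscl scale1r scale0r addr0. Qed.

Lemma dot_cscl s t x : dot (cscl s t x) (cscl s t x) = (s ^+ 2 + t ^+ 2) * dot x x.
Proof.
rewrite /cscl !dotE dot_mulI dot_mulIl dot_mulI_self; ring.
Qed.

Lemma en_cscl s t x : euclid_norm (cscl s t x) = Num.sqrt (s ^+ 2 + t ^+ 2) * euclid_norm x.
Proof. by rewrite !en_sqrt dot_cscl sqrtrM// addr_ge0 ?sqr_ge0. Qed.

(** A substitute for circle means. For a quadratic polynomial [u] the excess over [4 * u z] is twice
    the sum of the quadratic part at [w] and at [mulI w]: up to a constant, the Levi form in the
    direction [w]. *)
Definition sum4 (u : Cn -> R) z w := u (z + w) + u (z + mulI w) + u (z - w) + u (z - mulI w).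

Lemma normc_le1 s t : (`|Complex s t : R[i]| <= 1) = (s ^+ 2 + t ^+ 2 <= 1).
Proof.
rewrite normc_def lecE/= eqxx/= -{1}(sqrtr1 R) ler_sqrt//.
Qed.

Definition circle z w t : Cn := z + cscl (cos t) (sin t) w.

Lemma circle_continuous z w : continuous (circle z w).
Proof.
move=> t; apply: cvgD; first exact: cvg_cst.
by apply: cvgD; apply: cvgZr_tmp; [exact: continuous_cos|exact: continuous_sin].
Qed.

Lemma circle_comp_continuous (D : set Cn) (u : Cn -> R) z w : {in D, continuous u} ->
  (forall t, D (circle z w t)) -> continuous (u \o circle z w).
Proof.
move=> uc Dw t; apply: continuous_comp; first exact: circle_continuous.
by apply: uc; rewrite inE.
Qed.

Lemma psh_circle (D : set Cn) (u : Cn -> R) z w : {in D, continuous u} -> plurisubharmonic D u ->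
  (forall s t, s ^+ 2 + t ^+ 2 <= 1 -> D (z + cscl s t w)) ->
  u z * (2 * pi) <= \int[lebesgue_measure]_(t in `[0, 2 * pi]) (u \o circle z w) t.
Proof.
move=> uc [_ usub] Dw.
have pi20 : 0 < 2 * pi :> R by rewrite mulr_gt0// pi_gt0.
have Dc t : D (circle z w t) by apply: Dw; rewrite cos2Dsin2.
have ug := circle_comp_continuous uc Dc.
have ui : lebesgue_measure.-integrable `[0, 2 * pi] (EFin \o (u \o circle z w)).
  apply: continuous_compact_integrable; first exact: segment_compact.
  exact: continuous_subspaceT.
have /usub : forall a : R[i], `|a| <= 1 -> D (z + complex_scale a w).
  by move=> [s t]; rewrite normc_le1 complex_scaleE/=; exact: Dw.
under eq_integral do rewrite complex_scaleE/=.
rewrite -[X in (_ * X)%E](@fineK _ _ _); last exact: (integrable_fin_num _ ui).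
rewrite -EFinM lee_fin -ler_pdivrMl ?invr_gt0// invrK mulrC.
by [].
Qed.

(* Averaging over multiplication by the fourth roots of unity leaves only integrals of constants. *)
Lemma psh_sum4 (D : set Cn) (u : Cn -> R) z w (k : R) :
  {in D, continuous u} -> plurisubharmonic D u ->
  (forall s t, s ^+ 2 + t ^+ 2 <= 1 -> D (z + cscl s t w)) ->
  (forall s t, s ^+ 2 + t ^+ 2 = 1 -> sum4 u z (cscl s t w) <= k) -> 4 * u z <= k.
Proof.
move=> uc up Dw Hk.
have pi20 : 0 < 2 * pi :> R by rewrite mulr_gt0// pi_gt0.
have Dw1 : forall s t, s ^+ 2 + t ^+ 2 <= 1 -> D (z + cscl s t (mulI w)).
  move=> s t st; have := Dw (- t) s; rewrite sqrrN addrC => /(_ st).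
  by rewrite /cscl mulII scalerN scaleNr [- _ + _]addrC.
have Dw2 : forall s t, s ^+ 2 + t ^+ 2 <= 1 -> D (z + cscl s t (- w)).
  move=> s t st; have := Dw (- s) (- t); rewrite !sqrrN => /(_ st).
  by rewrite /cscl mulIN !scaleNr !scalerN.
have Dw3 : forall s t, s ^+ 2 + t ^+ 2 <= 1 -> D (z + cscl s t (- mulI w)).
  move=> s t st; have := Dw1 (- s) (- t); rewrite !sqrrN => /(_ st).
  by rewrite /cscl [mulI (- _)]mulIN !scaleNr !scalerN.
have H0 := psh_circle uc up Dw; have H1 := psh_circle uc up Dw1.
have H2 := psh_circle uc up Dw2; have H3 := psh_circle uc up Dw3.
have I w' : (forall s t, s ^+ 2 + t ^+ 2 <= 1 -> D (z + cscl s t w')) ->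
    lebesgue_measure.-integrable `[0, 2 * pi] (EFin \o (u \o circle z w')).
  move=> Dw'; apply: continuous_compact_integrable; first exact: segment_compact.
  apply: continuous_subspaceT; apply: (circle_comp_continuous uc) => t.
  by apply: Dw'; rewrite cos2Dsin2.
have mI : measurable (`[0, 2 * pi]%classic : set R) by exact: measurable_itv.
have I0 := I _ Dw; have I1 := I _ Dw1; have I2 := I _ Dw2; have I3 := I _ Dw3.
have ID (f g : R -> R) : lebesgue_measure.-integrable `[0, 2 * pi] (EFin \o f) ->
    lebesgue_measure.-integrable `[0, 2 * pi] (EFin \o g) ->
    lebesgue_measure.-integrable `[0, 2 * pi] (EFin \o (fun t => f t + g t)).
  move=> fi gi; rewrite (_ : EFin \o _ = (EFin \o f) \+ (EFin \o g)); last by apply/funext.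
  exact: integrableD.
have S : (\int[lebesgue_measure]_(t in `[0%R, 2 * pi]) (((u \o circle z w) t +
     (u \o circle z (mulI w)) t) + ((u \o circle z (- w)) t + (u \o circle z (- mulI w)) t)) <= k * (2 * pi))%R.
  apply: (@le_trans _ _ (\int[lebesgue_measure]_(t in `[0%R, 2 * pi]) k)%R).
    apply: le_Rintegral => //.
    - exact: ID (ID _ _ I0 I1) (ID _ _ I2 I3).
    - apply: continuous_compact_integrable; first exact: segment_compact.
      by apply: continuous_subspaceT => ?; exact: cvg_cst.
    - move=> t _ /=; rewrite /circle !csclN cscl_mulI.
      by rewrite addrA; exact: Hk (cos2Dsin2 t).
  rewrite Rintegral_cst// le_eqVlt; apply/orP; left; apply/eqP; congr (_ * _).
  have := lebesgue_measure_itv `[0%R, 2 * pi : R].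
  by rewrite /= lte_fin pi20 oppr0 adde0 => /(congr1 fine).
have {}S := S; rewrite RintegralD// in S; [|exact: (ID _ _ I0 I1)|exact: (ID _ _ I2 I3)].
rewrite !RintegralD// in S.
rewrite -(ler_pM2r pi20) (_ : 4 * u z * _ =
  (u z * (2 * pi) + u z * (2 * pi)) + (u z * (2 * pi) + u z * (2 * pi))); last by ring.
exact: le_trans (lerD (lerD H0 H1) (lerD H2 H3)) S.
Qed.

End ComplexStructure.

(** * Tubes around compact sets *)

Section Tube.
Context {R : realType} {m : nat}.

(** Near-covering form of compactness: around each point of [K] all small radii work, hence one
    radius works along all of [K]. *)
Lemma compact_tube (T : topologicalType) (K : set T) (g : T -> 'rV[R]_m) (O : set 'rV[R]_m) :
  compact K -> continuous g -> (forall c, K c -> nbhs (g c) O) ->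
  exists2 e : R, 0 < e & forall c v, K c -> `|v| < e -> O (g c + v).
Proof.
move=> /compact_near_coveringP Kc gc KO.
have := Kc R (0 : R)^'+ (fun e c => forall v, `|v| < e -> O (g c + v)) _.
case.
  move=> c /KO/nbhs_supP[e e0 He].
  exists ([set c' | `|g c' - g c| < e / 2], [set e' : R | e' < e / 2]) => /=.
    split; last by apply: nbhs_right_lt; rewrite divr_gt0.
    apply: (gc c [set y | `|y - g c| < e / 2]).
    by apply: (@nbhs_sup _ _ _ _ (e / 2)) => //; rewrite divr_gt0.
  move=> [c' e'] [/= h1 h2] v ve; apply: He.
  rewrite addrAC (le_lt_trans (ler_normD _ _))// (splitr e) ltrD//.
  exact: lt_trans ve h2.
move=> e0 /= e1 H.
have [e [e2 {}H]] : exists e : R, 0 < e /\ (forall c v, K c -> `|v| < e -> O (g c + v)).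
  exists (e0 / 2); split; first by rewrite divr_gt0.
  move=> c v Kx ve; apply: (H (e0 / 2)) => //=; last by rewrite divr_gt0.
  by rewrite sub0r normrN gtr0_norm ?divr_gt0// ltr_pdivrMr// ltr_pMr// ltr1n.
by exists e.
Qed.

Lemma compact_en_ball (r : R) : compact [set v : 'rV[R]_m | euclid_norm v <= r].
Proof.
apply: bounded_closed_compact.
  exists r; split; first exact: num_real.
  move=> M rM v /= vr; apply: le_trans (ltW rM); exact: le_trans (sup_le_en _) vr.
have -> : [set v : 'rV[R]_m | euclid_norm v <= r] = (@euclid_norm R m) @^-1` [set t | t <= r] by [].
apply: closed_comp; last exact: closed_le.
by move=> x _; exact: continuous_en.
Qed.

Lemma compact_disc (r : R) : compact [set c : R * R | c.1 ^+ 2 + c.2 ^+ 2 <= r ^+ 2].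
Proof.
apply: (@subclosed_compact _ _ (`[- `|r|, `|r|]%classic `*` `[- `|r|, `|r|]%classic)).
- have -> : [set c : R * R | c.1 ^+ 2 + c.2 ^+ 2 <= r ^+ 2] =
     (fun c : R * R => c.1 ^+ 2 + c.2 ^+ 2) @^-1` [set t | t <= r ^+ 2] by [].
  apply: closed_comp; last exact: closed_le.
  by move=> x _; apply: cvgD; rewrite expr2; apply: cvgM; [exact: cvg_fst..|exact: cvg_snd|exact: cvg_snd].
- by apply: compact_setX; exact: segment_compact.
- move=> [s t] /= st; rewrite !in_itv/= -!ler_norml.
  split; rewrite -ler_sqr ?nnegrE// !real_normK ?num_real//; apply: le_trans st.
    by rewrite lerDl sqr_ge0.
  by rewrite lerDr sqr_ge0.
Qed.

End Tube.

(** * Maximum principle on quadratic discs *)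

Section QuadraticDisc.
Context {R : realType} {n : nat}.
Local Notation Cn := ('rV[R]_(n + n)).
Implicit Types (D : set Cn) (u : Cn -> R).

(** The holomorphic disc c -> p + c X + c^2 Y at c = s + i t. *)
Definition qdisc (p X Y : Cn) (s t : R) : Cn :=
  p + cscl s t X + cscl (s ^+ 2 - t ^+ 2) (2 * s * t) Y.

Lemma qdiscD p X Y s t a b :
  qdisc p X Y (s + a) (t + b) =
  qdisc p X Y s t + cscl a b (X + cscl (2 * s) (2 * t) Y)
    + cscl (a ^+ 2 - b ^+ 2) (2 * a * b) Y.
Proof.
rewrite /qdisc csclD csclM.
by apply/rowP => i; rewrite !mxE; case: splitP => j _; rewrite !mxE; ring.
Qed.

Lemma qdisc_continuous p X Y : continuous (fun c : R * R => qdisc p X Y c.1 c.2).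
Proof.
have c1 : continuous (fun c : R * R => c.1) by move=> c; exact: cvg_fst.
have c2 : continuous (fun c : R * R => c.2) by move=> c; exact: cvg_snd.
move=> c; apply: cvgD; first (apply: cvgD; first exact: cvg_cst).
  by apply: cvgD; apply: cvgZr_tmp; [exact: c1|exact: c2].
apply: cvgD; apply: cvgZr_tmp.
  by apply: cvgB; rewrite expr2; apply: cvgM; [exact: c1|exact: c1|exact: c2|exact: c2].
by apply: cvgM; [apply: cvgM; [exact: cvg_cst|exact: c1]|exact: c2].
Qed.

(* The sub-mean value property only speaks about affine discs.  Maximising
   [u (g c + v) + e |c|^2 - k |v|^2] over a tube around the quadratic disc [g] and then moving
   the parameter by d and the offset by - d^2 Y makes the point move along an affine disc. *)
Lemma qdisc_max_principle D u (p X Y : Cn) (r1 M : R) :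
  open D -> {in D, continuous u} -> plurisubharmonic D u -> 0 < r1 ->
  (forall s t, s ^+ 2 + t ^+ 2 <= r1 ^+ 2 -> D (qdisc p X Y s t)) ->
  (forall s t, s ^+ 2 + t ^+ 2 = r1 ^+ 2 -> u (qdisc p X Y s t) <= M) ->
  u p <= M.
Proof.
move=> Do uc up r10 gD gM; rewrite leNgt; apply/negP => uM.
pose g (c : R * R) := qdisc p X Y c.1 c.2.
have gc : continuous g by exact: qdisc_continuous.
(* One third of the gap is the variation of [u] allowed in the tube around the boundary circle, one
   third is the value of [ep * |c|^2] on that circle, and the last third keeps the inequality
   strict. *)
pose e1 := (u p - M) / 3; have e10 : 0 < e1 by rewrite divr_gt0// subr_gt0.
pose K2 := [set c : R * R | c.1 ^+ 2 + c.2 ^+ 2 <= r1 ^+ 2].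
have K2c : compact K2 by exact: compact_disc.
have [s1 s10 H1] := compact_tube K2c gc (fun c Kc => open_nbhs_nbhs (conj Do (gD _ _ Kc))).
pose K1 := [set c : R * R | c.1 ^+ 2 + c.2 ^+ 2 = r1 ^+ 2].
have K1c : compact K1.
  apply: (subclosed_compact _ K2c); last by move=> c; rewrite /K1 /K2 /= => ->.
  have -> : K1 = (fun c : R * R => c.1 ^+ 2 + c.2 ^+ 2) @^-1` [set t | t = r1 ^+ 2] by [].
  apply: closed_comp; last exact: closed_eq.
  by move=> x _; apply: cvgD; rewrite expr2; apply: cvgM; [exact: cvg_fst..|exact: cvg_snd|exact: cvg_snd].
have [s2 s20 H2] : exists2 e : R, 0 < e & forall c v, K1 c -> `|v| < e -> u (g c + v) < M + e1.
  apply: (@compact_tube _ _ _ K1 g (fun x => u x < M + e1) K1c gc) => c Kc.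
  have gcD : D (g c) by apply: gD; rewrite Kc.
  have /uc/continuous_supP/(_ _ e10)[d d0 Hd] : g c \in D by rewrite inE.
  apply: (nbhs_sup d0) => y /Hd; rewrite ltr_norml => /andP[_].
  by rewrite ltrBlDr addrC => /lt_le_trans; apply; rewrite lerD2r gM.
pose sg := Num.min s1 s2 / 2.
have sg0 : 0 < sg by rewrite divr_gt0// lt_min s10.
have sg1 : sg < s1 by rewrite /sg ltr_pdivrMr// gt_min ltr_pMr// ltr1n.
have sg2 : sg < s2 by rewrite /sg ltr_pdivrMr// gt_min orbC ltr_pMr// ltr1n.
pose T := K2 `*` [set v : Cn | euclid_norm v <= sg].
have Tc : compact T by apply: compact_setX => //; exact: compact_en_ball.
have T0 : T ((0, 0), 0).
  split; rewrite /K2 /=; last by rewrite en0 ltW.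
  by rewrite !expr0n/= addr0 sqr_ge0.
have TD x : T x -> D (g x.1 + x.2).
  by move=> [xK xs]; apply: H1 => //; apply: le_lt_trans sg1; exact: le_trans (sup_le_en _) xs.
have puc : {in T, continuous (fun x : (R * R) * Cn => u (g x.1 + x.2))}.
  move=> x xT; apply: (@continuous_comp _ _ _ (fun x : (R * R) * Cn => g x.1 + x.2) u).
    apply: cvgD; last exact: cvg_snd.
    by apply: (@continuous_comp _ _ _ (fun x : (R * R) * Cn => x.1) g); [exact: cvg_fst|exact: gc].
  by apply: uc; rewrite inE; apply: TD; rewrite inE in xT.
have [xB xBT HB] := compact_EVT_max (ex_intro _ _ T0) Tc (continuous_in_subspaceT puc).
pose B := u (g xB.1 + xB.2).
pose ep := e1 / r1 ^+ 2; have ep0 : 0 < ep by rewrite divr_gt0// exprn_gt0.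
have epr : ep * r1 ^+ 2 = e1 by rewrite /ep divfK// gt_eqF// exprn_gt0.
(* Makes the penalty on the side [euclid_norm v = sg] outweigh both the maximum [B] of [u] and the
   bonus [e1], so that the maximum of [H] is not attained there. *)
pose K := (B - u p + e1 + 1) / sg ^+ 2.
have up0 : u p <= B.
  have := HB ((0, 0), 0); rewrite inE => /(_ T0) /=.
  rewrite /g/= /qdisc /cscl !expr0n/= !mulr0 subr0 !scale0r !addr0; exact.
have K0 : 0 < K by rewrite divr_gt0 ?exprn_gt0//; lra.
have Ks : K * sg ^+ 2 = B - u p + e1 + 1 by rewrite /K divfK// gt_eqF// exprn_gt0.
pose H (x : (R * R) * Cn) := u (g x.1 + x.2) + ep * (x.1.1 ^+ 2 + x.1.2 ^+ 2) - K * dot x.2 x.2.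
have Hc : {in T, continuous H}.
  move=> x xT; apply: cvgB; first apply: cvgD; first exact: puc.
    apply: cvgM; first exact: cvg_cst.
    apply: cvgD; rewrite expr2; apply: cvgM.
    1,2: by apply: (@continuous_comp _ _ _ (fun x : (R * R) * Cn => x.1) (fun c : R * R => c.1)); exact: cvg_fst.
    1,2: by apply: (@continuous_comp _ _ _ (fun x : (R * R) * Cn => x.1) (fun c : R * R => c.2));
       [exact: cvg_fst|exact: cvg_snd].
  apply: cvgM; first exact: cvg_cst.
  apply: (@continuous_comp _ _ _ (fun x : (R * R) * Cn => x.2) (fun v : Cn => dot v v)).
    exact: cvg_snd.
  exact: continuous_dot_self.
have [[[s0 t0] v0]] := compact_EVT_max (ex_intro _ _ T0) Tc (continuous_in_subspaceT Hc).
rewrite inE => T00 Hmax.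
have {}Hmax s t v : s ^+ 2 + t ^+ 2 <= r1 ^+ 2 -> euclid_norm v <= sg ->
    H ((s, t), v) <= H ((s0, t0), v0).
  by move=> st vs; apply: Hmax; rewrite inE.
have [/= st0 vs0] := T00.
have Hup : u p <= H ((s0, t0), v0).
  have := Hmax 0 0 0; rewrite /H/= /g/= /qdisc /cscl !expr0n/= !mulr0 subr0 !scale0r !addr0 dot0l !mulr0 addr0 subr0.
  by rewrite en0; apply; rewrite ?sqr_ge0// ltW.
have d1 : 0 < r1 ^+ 2 - (s0 ^+ 2 + t0 ^+ 2).
  rewrite subr_gt0 lt_neqAle st0 andbT; apply/eqP => E.
  have := @H2 (s0, t0) v0 E (le_lt_trans (le_trans (sup_le_en _) vs0) sg2).
  move: Hup; rewrite /H/= E epr; have := mulr_ge0 (ltW K0) (dot_ge0 v0).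
  rewrite -/e1 /e1; lra.
have d2 : 0 < sg - euclid_norm v0.
  rewrite subr_gt0 lt_neqAle vs0 andbT; apply/eqP => E.
  have := HB ((s0, t0), v0); rewrite inE => /(_ T00) /= hB.
  move: Hup; rewrite /H/= -en_sq E Ks; have /= := ler_wpM2l (ltW ep0) st0; rewrite epr.
  rewrite -/B in hB *; lra.
(* In turn: r^2 <= r, the moved parameter stays in the disc, the moved offset stays in the ball of
   radius [sg], and the loss of order r^4 from the penalty is below the gain [ep * r ^+ 2]. *)
pose r := Num.min 1 (Num.min ((r1 ^+ 2 - (s0 ^+ 2 + t0 ^+ 2)) / (4 * r1 + 1))
   (Num.min ((sg - euclid_norm v0) / (euclid_norm Y + 1)) (ep / (K * dot Y Y + 1) / 2))).
have Y1 : 0 < euclid_norm Y + 1 by rewrite ltr_wpDl// en_ge0.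
have Y2 : 0 < K * dot Y Y + 1 by rewrite ltr_wpDl// mulr_ge0 ?dot_ge0// ltW.
have r1p : 0 < 4 * r1 + 1 by lra.
have r0 : 0 < r by rewrite /r !lt_min ltr01/= (divr_gt0 d1 r1p) (divr_gt0 d2 Y1) divr_gt0// divr_gt0.
have r_1 : r <= 1 by rewrite /r ge_min lexx.
have rr : r ^+ 2 <= r by rewrite expr2 ger_pMr.
have r_2 : r * (4 * r1 + 1) <= r1 ^+ 2 - (s0 ^+ 2 + t0 ^+ 2).
  by rewrite -ler_pdivlMr ?addr_gt0 ?mulr_gt0// !ge_min lexx !orbT.
have r_3 : r * (euclid_norm Y + 1) <= sg - euclid_norm v0.
  by rewrite -ler_pdivlMr// !ge_min lexx !orbT.
have r_4 : r * (K * dot Y Y + 1) < ep.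
  rewrite -ltr_pdivlMr//; apply: (@le_lt_trans _ _ (ep / (K * dot Y Y + 1) / 2)).
    by rewrite !ge_min lexx !orbT.
  by have := divr_gt0 ep0 Y2; lra.
pose x0 := g (s0, t0) + v0; pose wt := X + cscl (2 * s0) (2 * t0) Y.
pose q a b := cscl (a ^+ 2 - b ^+ 2) (2 * a * b) Y : Cn.
have mv a b : x0 + cscl a b wt = g (s0 + a, t0 + b) + (v0 - q a b).
  by rewrite /g/= qdiscD /x0 -/wt -/(q a b) [RHS]addrACA subrr addr0 addrAC.
have in1 a b : a ^+ 2 + b ^+ 2 <= r ^+ 2 -> (s0 + a) ^+ 2 + (t0 + b) ^+ 2 <= r1 ^+ 2.
  move=> ab.
  have bnd (x y c : R) : 0 < c -> x ^+ 2 + y ^+ 2 <= c ^+ 2 -> - c <= x <= c.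
    move=> c0 xy; rewrite -ler_norml -ler_sqr ?nnegrE ?normr_ge0 ?(ltW c0)// real_normK ?num_real//.
    by apply: le_trans xy; rewrite lerDl sqr_ge0.
  have sa : s0 * a + t0 * b <= 2 * r1 * r.
    have /= hs := bnd _ _ _ r10 st0; have ha := bnd _ _ _ r0 ab.
    have ht : - r1 <= t0 <= r1 by apply: (bnd t0 s0) => //; rewrite addrC.
    have hb : - r <= b <= r by apply: (bnd b a) => //; rewrite addrC.
    have prod (x y : R) : - r1 <= x <= r1 -> - r <= y <= r -> x * y <= r1 * r.
      by rewrite -!ler_norml => hx hy; rewrite (le_trans (ler_norm _))// normrM ler_pM.
    have := prod _ _ hs ha; have := prod _ _ ht hb; lra.
  rewrite (_ : _ + _ = s0 ^+ 2 + t0 ^+ 2 + 2 * (s0 * a + t0 * b) + (a ^+ 2 + b ^+ 2)); last by ring.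
  move: r_2; rewrite mulrDr mulr1; lra.
have enq a b : euclid_norm (q a b) = (a ^+ 2 + b ^+ 2) * euclid_norm Y.
  rewrite /q en_cscl (_ : (a ^+ 2 - b ^+ 2) ^+ 2 + (2 * a * b) ^+ 2 = (a ^+ 2 + b ^+ 2) ^+ 2); last by ring.
  by rewrite sqrtr_sqr ger0_norm// addr_ge0 ?sqr_ge0.
have in2 a b : a ^+ 2 + b ^+ 2 <= r ^+ 2 -> euclid_norm (v0 - q a b) <= sg.
  move=> ab; apply: le_trans (enD _ _) _; rewrite enN enq.
  have : (a ^+ 2 + b ^+ 2) * euclid_norm Y <= r * euclid_norm Y.
    by rewrite ler_wpM2r ?en_ge0// (le_trans ab).
  move: r_3; rewrite mulrDr mulr1; lra.
have ub a b : a ^+ 2 + b ^+ 2 <= r ^+ 2 -> u (x0 + cscl a b wt) <=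
    H ((s0, t0), v0) - ep * ((s0 + a) ^+ 2 + (t0 + b) ^+ 2)
      + K * dot (v0 - q a b) (v0 - q a b).
  move=> ab; have := Hmax _ _ _ (in1 _ _ ab) (in2 _ _ ab).
  by rewrite {1}/H /= -mv; lra.
have sc s t : cscl s t (r *: wt) = cscl (r * s) (r * t) wt.
  by rewrite /cscl mulIZ !scalerA mulrC [t * _]mulrC.
have hsum s t : s ^+ 2 + t ^+ 2 = 1 -> sum4 u x0 (cscl s t (r *: wt)) <=
    4 * u x0 - 4 * ep * r ^+ 2 + 4 * K * (r ^+ 4 * dot Y Y).
  move=> st.
  have ab : (r * s) ^+ 2 + (r * t) ^+ 2 = r ^+ 2 by rewrite !exprMn -mulrDr st mulr1.
  have iE a b : mulI (cscl a b wt) = cscl (- b) a wt.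
    by rewrite /cscl mulID !mulIZ mulII scalerN addrC scaleNr.
  have nE a b : - cscl a b wt = cscl (- a) (- b) wt.
    by rewrite /cscl !scaleNr opprD.
  rewrite /sum4 sc iE !nE opprK.
  have := ub (r * s) (r * t); rewrite ab lexx => /(_ isT).
  have := ub (- (r * t)) (r * s); rewrite sqrrN addrC ab lexx => /(_ isT).
  have := ub (- (r * s)) (- (r * t)); rewrite !sqrrN ab lexx => /(_ isT).
  have := ub (r * t) (- (r * s)); rewrite sqrrN addrC ab lexx => /(_ isT).
  (* The square d^2 changes sign when d is multiplied by i, so the terms linear in [q] cancel over
     the four points. *)
  have q1 : q (- (r * t)) (r * s) = - q (r * s) (r * t).
    rewrite /q /cscl; move: (mulI Y) => Y'; apply/rowP => i; rewrite !mxE; ring.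
  have q2 : q (- (r * s)) (- (r * t)) = q (r * s) (r * t).
    rewrite /q /cscl; move: (mulI Y) => Y'; apply/rowP => i; rewrite !mxE; ring.
  have q3 : q (r * t) (- (r * s)) = - q (r * s) (r * t).
    rewrite /q /cscl; move: (mulI Y) => Y'; apply/rowP => i; rewrite !mxE; ring.
  rewrite q1 q2 q3 opprK /H /= -/x0.
  have : dot (q (r * s) (r * t)) (q (r * s) (r * t)) = r ^+ 4 * dot Y Y.
    by rewrite -!en_sq enq ab exprMn -exprM.
  move: (q _ _) => Q QQ; rewrite !dotDl !dotDr !dotNl !dotNr QQ (dotC Q v0).
  have : r ^+ 2 = (r * s) ^+ 2 + (r * t) ^+ 2 by rewrite ab.
  set A := r * s; set C := r * t; move: (dot _ _) (dot _ _) (dot _ _) => a1 a2 a3.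
  move: (u _) (u _) (u _) (u _) (u _) => u0 u1 u2 u3 u4 -> h1 h2 h3 h4.
  lra.
have : 4 * u x0 <= 4 * u x0 - 4 * ep * r ^+ 2 + 4 * K * (r ^+ 4 * dot Y Y).
  apply: (@psh_sum4 _ _ D u x0 (r *: wt) _ uc up) => s t st; last exact: hsum.
  rewrite sc mv; apply: (TD ((s0 + r * s, t0 + r * t), _)).
  have ab : (r * s) ^+ 2 + (r * t) ^+ 2 <= r ^+ 2 by rewrite !exprMn -mulrDr ler_piMr// sqr_ge0.
  by split => /=; [exact: in1|exact: in2].
rewrite -subr_ge0 => h.
  have : r ^+ 2 * ep <= r ^+ 2 * (r ^+ 2 * (K * dot Y Y)).
    rewrite (_ : r ^+ 2 * (_ * _) = K * (r ^+ 4 * dot Y Y)); first by lra.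
    by ring.
  rewrite ler_pM2l ?exprn_gt0// leNgt => /negP; apply.
  apply: le_lt_trans r_4; apply: (@le_trans _ _ (r * (K * dot Y Y))).
    by rewrite ler_wpM2r// mulr_ge0 ?dot_ge0// ltW.
  by rewrite ler_wpM2l ?(ltW r0)// lerDl.
Qed.

End QuadraticDisc.

(** * Distance to the complement of an open set *)

Section DistanceToComplement.
Context {R : realType} {m : nat}.
Implicit Types (A : set 'rV[R]_m) (x y b : 'rV[R]_m).

Definition cdist A x : R := inf [set euclid_norm (x - b) | b in ~` A].

Lemma cdist_le A x b : ~ A b -> cdist A x <= euclid_norm (x - b).
Proof.
move=> Ab; apply: ge_inf; last by exists b.
by exists 0 => _ [c _ <-]; exact: en_ge0.
Qed.

Lemma le_cdist A x (r : R) : ~` A !=set0 ->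
  (forall b, ~ A b -> r <= euclid_norm (x - b)) -> r <= cdist A x.
Proof.
move=> [b0 Ab0] H; apply: lb_le_inf; first by exists (euclid_norm (x - b0)); exists b0.
by move=> _ [c Ac <-]; exact: H.
Qed.

Lemma cdist_attained A x : open A -> ~` A !=set0 ->
  exists2 b, ~ A b & cdist A x = euclid_norm (x - b).
Proof.
move=> Ao [b0 Ab0].
pose K := ~` A `&` [set b | euclid_norm (b - x) <= euclid_norm (b0 - x)].
have cx : continuous (fun b => euclid_norm (b - x)).
  apply: (@lip_continuous _ _ _ m%:R) => a b; apply: le_trans (en_lip _ _) _.
  by rewrite opprB addrA subrK; exact: en_le_sup.
have Kc : compact K.
  apply: bounded_closed_compact.
    exists (euclid_norm (b0 - x) + `|x|); split; first exact: num_real.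
    move=> M rM v [_ /= vr]; apply: le_trans (ltW rM).
    rewrite -(subrK x v); apply: le_trans (ler_normD _ _) _; rewrite lerD2r.
    exact: le_trans (sup_le_en _) vr.
  apply: closedI; first exact: open_closedC.
  have -> : [set b | euclid_norm (b - x) <= euclid_norm (b0 - x)] =
     (fun b => euclid_norm (b - x)) @^-1` [set t | t <= euclid_norm (b0 - x)] by [].
  by apply: closed_comp; [move=> b _; exact: cx|exact: closed_le].
have K0 : K !=set0 by exists b0; split => //=.
have [b /set_mem[Ab bb0] bmin] := EVT_min_rV K0 Kc (continuous_subspaceT cx).
exists b => //; apply/le_anti; rewrite cdist_le//=; apply: le_cdist; first by exists b0.
move=> c Ac; rewrite enBC (enBC x).
have [cb0|/ltW cb0] := leP (euclid_norm (c - x)) (euclid_norm (b0 - x)).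
  by apply: bmin; rewrite inE.
exact: le_trans bb0 cb0.
Qed.

Lemma cdist_lip A x y : open A -> ~` A !=set0 ->
  `|cdist A x - cdist A y| <= euclid_norm (x - y).
Proof.
move=> Ao A0; have H a b : cdist A a - cdist A b <= euclid_norm (a - b).
  have [c Ac ->] := cdist_attained b Ao A0.
  rewrite lerBlDr; apply: le_trans (cdist_le a Ac) _; exact: en_triangle.
by rewrite ler_norml H lerNl opprB enBC H.
Qed.

Lemma cdist_gt0 A x : open A -> ~` A !=set0 -> A x -> 0 < cdist A x.
Proof.
move=> Ao A0 Ax; have [c Ac ->] := cdist_attained x Ao A0.
by apply: en_gt0; rewrite subr_eq0; apply: contra_notN Ac => /eqP <-.
Qed.

Lemma cdist_ball A x y : euclid_norm (y - x) < cdist A x -> A y.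
Proof.
move=> yx; apply: contrapT => Ay; have := cdist_le x Ay.
by rewrite enBC leNgt yx.
Qed.

Lemma continuous_cdist A : open A -> ~` A !=set0 -> continuous (cdist A).
Proof.
move=> Ao A0; apply: (@lip_continuous _ _ _ m%:R) => x y.
exact: le_trans (cdist_lip _ _ Ao A0) (en_le_sup _).
Qed.

(* The squared distance is an infimum of functions |x|^2 + affine, so [- ln (cdist A)] lies above a
   paraboloid at each of its points, whatever the open set [A]. *)
Lemma ln_cdist_paraboloid A x y : open A -> ~` A !=set0 -> A x -> A y ->
  forall b, ~ A b -> cdist A x = euclid_norm (x - b) ->
  - ln (cdist A x) - dot ((cdist A x) ^- 2 *: (x - b)) (y - x)
    - euclid_norm (y - x) ^+ 2 / (2 * cdist A x ^+ 2) <= - ln (cdist A y).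
Proof.
move=> Ao A0 Ax Ay b Ab xb.
have dx := cdist_gt0 Ao A0 Ax; have dy := cdist_gt0 Ao A0 Ay.
set d := cdist A x in xb dx *.
have d2 : 0 < d ^+ 2 by rewrite exprn_gt0.
have e1 : d ^+ 2 * d ^- 2 = 1 by rewrite mulfV// gt_eqF.
(* [1 + t] is the ratio of the squared distances of [y] and [x] to [b]; the bound [1 + t <= expR t]
   then removes the logarithm. *)
pose t := 2 * d ^- 2 * dot (x - b) (y - x) + d ^- 2 * euclid_norm (y - x) ^+ 2.
have hb : euclid_norm (y - b) ^+ 2 = d ^+ 2 * (1 + t).
  rewrite /t mulrDr mulr1 mulrDr !mulrA [d ^+ 2 * 2]mulrC -[2 * d ^+ 2 / _]mulrA e1 mulr1 mul1r.
  rewrite (_ : y - b = (x - b) + (y - x)); last by rewrite [RHS]addrC addrA subrK.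
  rewrite en_sqD -xb; ring.
have yb : 0 < euclid_norm (y - b).
  exact: lt_le_trans dy (cdist_le _ Ab).
have t1 : 0 < 1 + t by rewrite -(pmulr_rgt0 _ d2) -hb exprn_gt0.
have h1 : ln (cdist A y) <= ln (euclid_norm (y - b)).
  by rewrite ler_ln ?posrE// cdist_le.
have h2 : 2 * ln (euclid_norm (y - b)) <= 2 * ln d + t.
  rewrite !mulr_natl -!lnXn// hb lnM ?posrE// lerD2l.
  by rewrite -[leRHS]expRK ler_ln ?posrE ?expR_gt0// expR_ge1Dx.
rewrite dotZl.
have e2 : euclid_norm (y - x) ^+ 2 / (2 * d ^+ 2) = d ^- 2 * euclid_norm (y - x) ^+ 2 / 2.
  by rewrite invfM; ring.
rewrite e2; move: h2; rewrite /t; lra.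
Qed.

End DistanceToComplement.

(** * Second-order local defining functions *)

Section BoundaryPoint.
Context {R : realType} {m : nat}.
Implicit Types (rho f : 'rV[R]_m -> R) (b nu g : 'rV[R]_m) (M : 'M[R]_m).

(* [f] is a second-order local defining function at [b] of the domain [rho < 0]: gradient [g],
   second-order part [M], and a direction [nu] along which [f] grows at rate [k]. *)
Definition local_defining rho b f g M nu (k d : R) : Prop :=
  [/\ g != 0, 0 < k /\ 0 < d,
      forall e : R, 0 < e -> exists2 d' : R, 0 < d' &
        forall v, `|v| < d' -> `|f (b + v) - dot g v - bilin M v v| <= e * `|v| ^+ 2,
      forall x s, `|x - b| < d -> `|x + s *: nu - b| < d -> 0 <= s -> f x + k * s <= f (x + s *: nu) &
      forall x, `|x - b| < d -> (rho x < 0) = (f x < 0)].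

(** The function supplied by the hypersurface shares with [rho] only its zero set. Once its sign
    makes the inner product of the two gradients nonnegative, both functions strictly increase near
    [b] along the sum [nu] of the gradients. The line through [x] along [nu] meets the zero set by
    the intermediate value theorem, and the side of the crossing determines both signs at [x]. *)
Lemma C2_hypersurface_local_defining rho (V S : set 'rV[R]_m) b :
  continuous rho -> open V -> C1_on V rho -> V b -> rho b = 0 -> gradient rho b != 0 ->
  [set z | rho z = 0] = S -> C2_hypersurface_at S b ->
  exists f g M nu k d, local_defining rho b f g M nu k d.
Proof.
move=> rc Vo rC1 Vb rb0 rg Srho [U [f0 [Uo Ub fC2 fg SU]]].
have Sf x : U x -> (rho x = 0) <-> (f0 x = 0).
  move=> Ux; split=> [rx|fx].
    have : (S `&` U) x by split => //; rewrite -Srho.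
    by rewrite SU => -[].
  have : (S `&` U) x by rewrite SU.
  by rewrite -Srho => -[].
have f0b : f0 b = 0 by apply/(Sf b Ub).
pose sg : R := if 0 <= dot (gradient f0 b) (gradient rho b) then 1 else - 1.
have sg2 : sg * sg = 1 by rewrite /sg; case: ifP => _; rewrite ?mulr1// mulrNN mulr1.
have sg1 : `|sg| = 1 by rewrite /sg; case: ifP => _; rewrite ?normr1// normrN1.
have nrm t : `|t| = `|sg * t| by rewrite normrM sg1 mul1r.
have sg0 : sg != 0 by rewrite -normr_gt0 sg1.
pose g := sg *: gradient f0 b.
have g0 : g != 0 by rewrite scaler_eq0 negb_or sg0 fg.
have gr : 0 <= dot g (gradient rho b).
  rewrite /g dotZl /sg; case: (lerP 0 (dot (gradient f0 b) (gradient rho b))) => h; first by rewrite mul1r.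
  by rewrite mulN1r oppr_ge0 ltW.
pose f x := sg * f0 x.
pose nu := g + gradient rho b.
have nug : 0 < dot g nu by rewrite /nu dotDr ltr_wpDr// dot_gt0.
have nur : 0 < dot (gradient rho b) nu.
  by rewrite /nu dotDr (dotC _ g) ltr_wpDl// dot_gt0.
have n1 : 0 < `|nu| + 1 by rewrite ltr_wpDl.
pose eg := dot g nu / 2 / (`|nu| + 1); pose er := dot (gradient rho b) nu / 2 / (`|nu| + 1).
have eg0 : 0 < eg by rewrite !divr_gt0.
have er0 : 0 < er by rewrite !divr_gt0.
have [df df0 Hf] := C1_strict_diff Uo fC2.1 Ub eg0.
have [dr dr0 Hr] := C1_strict_diff Vo rC1 Vb er0.
have [dU dU0 HU] : exists2 e : R, 0 < e & forall y, `|y - b| < e -> U y.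
  by apply: nbhs_supP; exact: open_nbhs_nbhs.
pose d1 := Num.min df (Num.min dr dU).
have d10 : 0 < d1 by rewrite /d1 !lt_min df0 dr0.
have d1f : d1 <= df by rewrite /d1 ge_min lexx.
have d1r : d1 <= dr by rewrite /d1 !ge_min lexx orbT.
have d1U : d1 <= dU by rewrite /d1 !ge_min lexx !orbT.
have half a s : 0 <= s -> 0 < a -> a / 2 / (`|nu| + 1) * `|s *: nu| <= a / 2 * s.
  move=> s0 a0; rewrite normrZ ger0_norm// [s * _]mulrC mulrA ler_wpM2r//.
  by rewrite -mulrA ger_pMr ?divr_gt0// mulrC ler_pdivrMr// mul1r lerDl.
have incf x s : `|x - b| < d1 -> `|x + s *: nu - b| < d1 -> 0 <= s ->
    f x + dot g nu / 2 * s <= f (x + s *: nu).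
  move=> xb xsb s0.
  have := Hf x (x + s *: nu) (lt_le_trans xb d1f) (lt_le_trans xsb d1f).
  rewrite [x + _]addrC addrK => /le_trans/(_ (half _ _ s0 nug)).
  rewrite [X in X <= _]nrm ler_norml => /andP[+ _].
  rewrite mulrBr mulrBr -/(f _) -/(f x) -dotZl -/g dotZr; lra.
have incr x s : `|x - b| < d1 -> `|x + s *: nu - b| < d1 -> 0 <= s ->
    rho x + dot (gradient rho b) nu / 2 * s <= rho (x + s *: nu).
  move=> xb xsb s0.
  have := Hr x (x + s *: nu) (lt_le_trans xb d1r) (lt_le_trans xsb d1r).
  rewrite [x + _]addrC addrK => /le_trans/(_ (half _ _ s0 nur)).
  rewrite ler_norml dotZr => /andP[+ _]; lra.
pose tau := d1 / 2 / (`|nu| + 1).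
have tau0 : 0 < tau by rewrite !divr_gt0.
have taun s : `|s| <= tau -> `|s *: nu| < d1 / 2.
  move=> st; rewrite normrZ; apply: (@le_lt_trans _ _ (tau * `|nu|)); first by rewrite ler_wpM2r.
  by rewrite /tau mulrAC ltr_pdivrMr// ltr_pM2l ?divr_gt0// ltrDl.
have at0 : 0 < dot (gradient rho b) nu / 2 * tau by rewrite mulr_gt0// divr_gt0.
have [d2 d20 Hd2] := (continuous_supP rho b).1 (rc b) _ at0.
pose d0 := Num.min (d1 / 2) d2.
have d00 : 0 < d0 by rewrite lt_min d20 divr_gt0.
have d01 : d0 <= d1 / 2 by rewrite ge_min lexx.
have d02 : d0 <= d2 by rewrite ge_min lexx orbT.
have d01' : d0 <= d1 by lra.
have [M HM] := C2_taylor Uo fC2 Ub.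
exists f, g, (sg *: M), nu, (dot g nu / 2), d0; split => //.
- by rewrite divr_gt0.
- move=> e e0; have [d' d'0 Hd'] := HM e e0; exists d' => // v /Hd'.
  rewrite f0b subr0 [X in X <= _]nrm !mulrBr -/(f _) -dotZl -/g.
  by rewrite /bilin -dotZl scalemxAr.
- by move=> x s xb xsb s0; apply: incf => //; exact: lt_le_trans d01'.
- move=> x xb.
  have xs s : `|s| <= tau -> `|x + s *: nu - b| < d1.
    move=> /taun st; rewrite addrAC (le_lt_trans (ler_normD _ _))//.
    by rewrite (splitr d1) ltrD// (lt_le_trans xb).
  have xb1 : `|x - b| < d1 by exact: lt_le_trans d01'.
  have : `|rho x - rho b| < dot (gradient rho b) nu / 2 * tau.
    by apply: Hd2; exact: lt_le_trans d02.
  rewrite rb0 subr0 ltr_norml => /andP[rx1 rx2].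
  have rp : 0 < rho (x + tau *: nu).
    have := incr x tau xb1 (xs _ _) (ltW tau0); rewrite gtr0_norm// lexx => /(_ isT); lra.
  have rn : rho (x + (- tau) *: nu) < 0.
    have h1 := xs (- tau); rewrite normrN gtr0_norm// lexx in h1.
    have := incr (x + (- tau) *: nu) tau (h1 isT).
    by rewrite scaleNr subrK => /(_ xb1 (ltW tau0)); lra.
  have [s] : exists2 s, s \in `[- tau, tau] & rho (x + s *: nu) = 0.
    apply: (@IVT _ (fun s => rho (x + s *: nu))).
    - by rewrite ge0_cp// ltW.
    - apply: continuous_subspaceT => s; apply: continuous_comp; last exact: rc.
      by apply: cvgD; [exact: cvg_cst|apply: cvgZr_tmp; exact: cvg_id].
    - by rewrite ge_min (ltW rn)/= le_max (ltW rp) orbT.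
  rewrite in_itv/= -ler_norml => st rs.
  have xsU : U (x + s *: nu) by apply: HU; apply: lt_le_trans d1U; exact: xs.
  have fs : f (x + s *: nu) = 0 by rewrite /f ((Sf _ xsU).1 rs) mulr0.
  have [s0|s0] := ltP 0 s.
    have h1 := incf x s xb1 (xs _ st) (ltW s0); have h2 := incr x s xb1 (xs _ st) (ltW s0).
    rewrite fs in h1; rewrite rs in h2.
    have p1 : 0 < dot g nu / 2 * s by rewrite mulr_gt0// divr_gt0.
    have p2 : 0 < dot (gradient rho b) nu / 2 * s by rewrite mulr_gt0// divr_gt0.
    have -> : rho x < 0 by lra.
    by have -> : f x < 0 by lra.
  have ns0 : 0 <= - s by rewrite oppr_ge0.
  have back : x + s *: nu + (- s) *: nu = x by rewrite scaleNr addrK.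
  have := incf (x + s *: nu) (- s) (xs _ st); rewrite back fs => /(_ xb1 ns0) h1.
  have := incr (x + s *: nu) (- s) (xs _ st); rewrite back rs => /(_ xb1 ns0) h2.
  have p1 : 0 <= dot g nu / 2 * (- s) by rewrite mulr_ge0// divr_ge0// ltW.
  have p2 : 0 <= dot (gradient rho b) nu / 2 * (- s) by rewrite mulr_ge0// divr_ge0// ltW.
  rewrite add0r in h1; rewrite add0r in h2.
  by rewrite !ltNge (le_trans p1 h1) (le_trans p2 h2).
Qed.

End BoundaryPoint.

(** * Nonnegativity of the Levi form at pseudoconvex boundary points *)

Section LeviForm.
Context {R : realType} {n : nat}.
Local Notation Cn := ('rV[R]_(n + n)).
Implicit Types (rho f : Cn -> R) (b nu g X Y w : Cn) (M : 'M[R]_(n + n)).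

Lemma sup_cscl s t (r : R) X : 0 <= r -> s ^+ 2 + t ^+ 2 <= r ^+ 2 ->
  `|cscl s t X| <= r * euclid_norm X.
Proof.
move=> r0 st; apply: le_trans (sup_le_en _) _.
rewrite en_cscl ler_wpM2r ?en_ge0// -(ger0_norm r0) -sqrtr_sqr ler_sqrt ?sqr_ge0//.
Qed.

(** Products that involve c^2 Y in the quadratic part are O(|c|^3), so c^2 Y contributes only
    through the gradient. Taylor remainder and cross terms take half of [e] each, by means of [A]
    and [B]. *)
Lemma qdisc_taylor rho b f g M nu (k d : R) X Y (e : R) :
  local_defining rho b f g M nu k d -> 0 < e ->
  exists2 r : R, 0 < r & forall s t, s ^+ 2 + t ^+ 2 <= r ^+ 2 ->
    `|qdisc 0 X Y s t| < d /\
    `|f (b + qdisc 0 X Y s t) - (dot g (cscl s t X) + dot g (cscl (s ^+ 2 - t ^+ 2) (2 * s * t) Y)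
       + bilin M (cscl s t X) (cscl s t X))| <= e * (s ^+ 2 + t ^+ 2).
Proof.
move=> [g0 [k0 d0] HT _ _] e0.
have [C C0 HC] := bilin_bound M.
pose x := euclid_norm X; pose y := euclid_norm Y.
have x0 : 0 <= x by exact: en_ge0.
have y0 : 0 <= y by exact: en_ge0.
pose A := (x + y) ^+ 2 + 1.
have A0 : 0 < A by rewrite ltr_wpDl// sqr_ge0.
have e10 : 0 < e / 2 / A by rewrite !divr_gt0.
have [d' d'0 Hd'] := HT _ e10.
pose B := C * (2 * x * y + y ^+ 2) + 1.
have B0 : 0 < B by rewrite ltr_wpDl// mulr_ge0 ?(ltW C0)// addr_ge0 ?sqr_ge0// !mulr_ge0.
have xy1 : 0 < x + y + 1 by rewrite ltr_wpDl// addr_ge0.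
pose r := Num.min 1 (Num.min (Num.min d d' / (x + y + 1)) (e / 2 / B)).
have dd : 0 < Num.min d d' by rewrite lt_min d0.
have r0 : 0 < r by rewrite /r !lt_min ltr01 (divr_gt0 dd xy1) !divr_gt0.
have r1 : r <= 1 by rewrite ge_min lexx.
have r2 : r * (x + y + 1) <= Num.min d d' by rewrite -ler_pdivlMr// !ge_min lexx !orbT.
have r3 : r * B <= e / 2 by rewrite -ler_pdivlMr// !ge_min lexx !orbT.
exists r => // s t st.
pose p := Num.sqrt (s ^+ 2 + t ^+ 2).
have pp : s ^+ 2 + t ^+ 2 = p ^+ 2 by rewrite sqr_sqrtr// addr_ge0 ?sqr_ge0.
have p0 : 0 <= p by exact: sqrtr_ge0.
have pr : p <= r by rewrite -ler_sqr ?nnegrE ?(ltW r0)// -pp.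
have p1 : p <= 1 by exact: le_trans r1.
have p2 : p ^+ 2 <= p by rewrite expr2 ler_piMr.
rewrite pp.
set cX := cscl s t X; set cY := cscl (s ^+ 2 - t ^+ 2) (2 * s * t) Y.
have hX : `|cX| <= p * x by apply: sup_cscl => //; rewrite pp.
have hY : `|cY| <= p ^+ 2 * y.
  apply: sup_cscl; first exact: sqr_ge0.
  by rewrite -pp le_eqVlt; apply/orP; left; apply/eqP; ring.
have -> : qdisc 0 X Y s t = cX + cY by rewrite /qdisc add0r.
clearbody cX cY.
have hv : `|cX + cY| <= p * (x + y).
  apply: le_trans (ler_normD _ _) _; rewrite mulrDr lerD//.
  by apply: le_trans hY _; rewrite ler_wpM2r.
have hvd : `|cX + cY| < Num.min d d'.
  apply: le_lt_trans hv _; apply: lt_le_trans r2.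
  apply: (@le_lt_trans _ _ (r * (x + y))); first by rewrite ler_wpM2r// addr_ge0.
  by rewrite ltr_pM2l// ltrDl.
move: hvd; rewrite lt_min => /andP[hd hd']; split => //.
have h1 := Hd' _ hd'.
have h2 : e / 2 / A * `|cX + cY| ^+ 2 <= e / 2 * p ^+ 2.
  apply: (@le_trans _ _ (e / 2 / A * (p * (x + y)) ^+ 2)).
    by rewrite ler_wpM2l ?(ltW e10)// ler_pXn2r// nnegrE// mulr_ge0// addr_ge0.
  rewrite (_ : _ * _ = e / 2 * p ^+ 2 * ((x + y) ^+ 2 / A)); last by ring.
  rewrite ler_piMr ?mulr_ge0 ?sqr_ge0 ?invr_ge0 ?(ltW e0)//.
  by rewrite ler_pdivrMr// mul1r /A lerDl.
have h3 : `|bilin M (cX + cY) (cX + cY) - bilin M cX cX| <= e / 2 * p ^+ 2.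
  rewrite !bilinDl !bilinDr (_ : _ - _ = bilin M cX cY + bilin M cY cX + bilin M cY cY); last by ring.
  apply: (@le_trans _ _ (C * (2 * x * y + y ^+ 2) * p ^+ 3)); last first.
    rewrite exprS mulrA ler_wpM2r ?sqr_ge0//; apply: le_trans r3.
    rewrite mulrC ler_pM//; first by rewrite mulr_ge0 ?(ltW C0)// addr_ge0 ?sqr_ge0// !mulr_ge0.
    by rewrite /B lerDl.
  have q1 : `|bilin M cX cY| <= C * (p * x) * (p ^+ 2 * y).
    by apply: le_trans (HC _ _) _; rewrite -mulrA -[leRHS]mulrA ler_wpM2l ?(ltW C0)// ler_pM.
  have q2 : `|bilin M cY cX| <= C * (p * x) * (p ^+ 2 * y).
    by apply: le_trans (HC _ _) _; rewrite -mulrA -[leRHS]mulrA ler_wpM2l ?(ltW C0)// mulrC ler_pM.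
  have q3 : `|bilin M cY cY| <= C * (p * y) * (p ^+ 2 * y).
    apply: le_trans (HC _ _) _; rewrite -mulrA -[leRHS]mulrA ler_wpM2l ?(ltW C0)// ler_pM//.
    by apply: le_trans hY _; rewrite ler_wpM2r.
  apply: le_trans (ler_normD _ _) _; apply: le_trans (lerD (ler_normD _ _) (lexx _)) _.
  apply: le_trans (lerD (lerD q1 q2) q3) _.
  by rewrite le_eqVlt; apply/orP; left; apply/eqP; ring.
rewrite dotDr in h1.
rewrite (_ : f _ - _ = (f (b + (cX + cY)) - (dot g cX + dot g cY) - bilin M (cX + cY) (cX + cY)) +
  (bilin M (cX + cY) (cX + cY) - bilin M cX cX)); last by ring.
apply: le_trans (ler_normD _ _) _.
rewrite (_ : e * p ^+ 2 = e / 2 * p ^+ 2 + e / 2 * p ^+ 2); last by field.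
by apply: lerD => //; exact: le_trans h1 h2.
Qed.

(* If the Levi form were negative along X, a quadratic disc through b tangent to X, pushed inside
   along - nu, would violate the maximum principle for the exhaustion function. *)
Lemma levi_form_ge0 rho b f g M nu (k d r : R) X : continuous rho ->
  local_defining rho b f g M nu k d -> rho b = 0 -> 0 < r ->
  pseudoconvex (euclid_ball b r `&` [set z | rho z < 0]) ->
  dot g X = 0 -> dot g (mulI X) = 0 ->
  0 <= bilin M X X + bilin M (mulI X) (mulI X).
Proof.
move=> rc LD rb r0 [Do [u [uc up ue]]] gX gIX.
set D := euclid_ball b r `&` _ in Do uc up ue.
have [g0 [k0 d0] _ inc sgn] := LD.
rewrite leNgt; apply/negP => neg.
pose L := - (bilin M X X + bilin M (mulI X) (mulI X)) / 2.
have L0 : 0 < L by rewrite divr_gt0// oppr_gt0.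
have gg := dot_gt0 g0.
(* Y = (b1 + i b2) g is chosen so that the gradient term of c^2 Y cancels the harmonic part of
   [bilin M] on c X; what remains is the mean - L |c|^2. *)
pose b1 := (bilin M (mulI X) (mulI X) - bilin M X X) / 2 / dot g g.
pose b2 := (bilin M X (mulI X) + bilin M (mulI X) X) / 2 / dot g g.
pose Y := cscl b1 b2 g.
have L20 : 0 < L / 2 by rewrite divr_gt0.
have [r1 r10 HT] := qdisc_taylor X Y LD L20.
have val s t : dot g (cscl s t X) + dot g (cscl (s ^+ 2 - t ^+ 2) (2 * s * t) Y)
       + bilin M (cscl s t X) (cscl s t X) = - L * (s ^+ 2 + t ^+ 2).
  rewrite /Y csclM /cscl !dotDr !dotZr gX gIX dot_mulI_self.
  rewrite !bilinDl !bilinDr !bilinZl !bilinZr /L /b1 /b2.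
  by field; rewrite gt_eqF.
have neg1 s t : s ^+ 2 + t ^+ 2 <= r1 ^+ 2 ->
    f (b + qdisc 0 X Y s t) <= - (L / 2) * (s ^+ 2 + t ^+ 2).
  move=> /HT[_]; rewrite val ler_norml => /andP[_]; lra.
(* The Euclidean norm is at most [n + n] times the sup norm; the successor avoids a division by
   0. *)
pose ball_r := Num.min d (r / (n + n).+1%:R).
have br0 : 0 < ball_r by rewrite lt_min d0 divr_gt0.
have [r2 r20 Hr2] : exists2 r2 : R, 0 < r2 & forall s t, s ^+ 2 + t ^+ 2 <= r2 ^+ 2 ->
    `|qdisc 0 X Y s t| < ball_r / 2.
  have cq := @qdisc_continuous R n 0 X Y.
  have [e e0 He] : exists2 e : R, 0 < e & e * euclid_norm X + e * euclid_norm Y < ball_r / 2 /\ e <= 1.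
    pose N := euclid_norm X + euclid_norm Y + 1.
    have N0 : 0 < N by rewrite ltr_wpDl// addr_ge0 ?en_ge0.
    exists (Num.min 1 (ball_r / 2 / N)); first by rewrite lt_min ltr01 !divr_gt0.
    split; last by rewrite ge_min lexx.
    rewrite -mulrDr; apply: (@le_lt_trans _ _ (ball_r / 2 / N * (euclid_norm X + euclid_norm Y))).
      by rewrite ler_wpM2r ?addr_ge0 ?en_ge0// ge_min lexx orbT.
    by rewrite mulrAC ltr_pdivrMr// ltr_pM2l ?divr_gt0// /N ltrDl.
  exists e => // s t st; rewrite /qdisc add0r; apply: le_lt_trans (ler_normD _ _) _.
  apply: le_lt_trans He.1; apply: lerD; first by apply: sup_cscl => //; exact: ltW.
  apply: sup_cscl; first exact: ltW.
  rewrite (_ : _ + _ = (s ^+ 2 + t ^+ 2) ^+ 2); last by ring.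
  rewrite ler_pXn2r ?nnegrE ?addr_ge0 ?sqr_ge0 ?(ltW e0)//.
  by apply: le_trans st _; rewrite expr2 ger_pMr// He.2.
pose r3 := Num.min r1 r2.
have r30 : 0 < r3 by rewrite lt_min r10.
have r31 s t : s ^+ 2 + t ^+ 2 <= r3 ^+ 2 -> s ^+ 2 + t ^+ 2 <= r1 ^+ 2.
  by move=> /le_trans; apply; rewrite ler_pXn2r ?nnegrE ?(ltW r30) ?(ltW r10)// ge_min lexx.
have r32 s t : s ^+ 2 + t ^+ 2 <= r3 ^+ 2 -> s ^+ 2 + t ^+ 2 <= r2 ^+ 2.
  by move=> /le_trans; apply; rewrite ler_pXn2r ?nnegrE ?(ltW r30) ?(ltW r20)// ge_min lexx orbT.
pose sg0 := ball_r / 2 / (`|nu| + 1).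
have n1 : 0 < `|nu| + 1 by rewrite ltr_wpDl.
have sg00 : 0 < sg0 by rewrite !divr_gt0.
have nus sg : 0 <= sg -> sg <= sg0 -> `|sg *: nu| < ball_r / 2.
  move=> s0 ss; rewrite normrZ ger0_norm//; apply: (@le_lt_trans _ _ (sg0 * `|nu|)).
    by rewrite ler_wpM2r.
  by rewrite /sg0 mulrAC ltr_pdivrMr// ltr_pM2l ?divr_gt0// ltrDl.
have inD s t sg : s ^+ 2 + t ^+ 2 <= r3 ^+ 2 -> 0 <= sg -> sg <= sg0 ->
    0 < s ^+ 2 + t ^+ 2 \/ 0 < sg -> D (b + qdisc 0 X Y s t - sg *: nu).
  move=> st s0 ss pos.
  have hq := Hr2 _ _ (r32 _ _ st).
  have hn := nus _ s0 ss.
  set x := b + qdisc 0 X Y s t - sg *: nu.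
  have xb : x - b = qdisc 0 X Y s t - sg *: nu.
    have aux (p q v : Cn) : p + q - v - p = q - v by apply/rowP => i; rewrite !mxE; ring.
    exact: aux.
  have xbr : `|x - b| < ball_r.
    by rewrite xb (le_lt_trans (ler_normB _ _))// [ball_r]splitr ltrD.
  have bd : ball_r <= d by rewrite ge_min lexx.
  split.
    rewrite /euclid_ball /=; apply: le_lt_trans (en_le_sup _) _.
    apply: (@le_lt_trans _ _ ((n + n).+1%:R * `|x - b|)); first by rewrite ler_wpM2r// ler_nat.
    rewrite -ltr_pdivlMl// mulrC; apply: lt_le_trans xbr _.
    by rewrite ge_min lexx orbT.
  rewrite /= sgn; last exact: lt_le_trans bd.
  have xs : x + sg *: nu = b + qdisc 0 X Y s t by rewrite /x subrK.
  have := inc x sg (lt_le_trans xbr bd); rewrite xs => /(_ _ s0).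
  rewrite [b + _]addrC addrK => /(_ _)/le_lt_trans.
  have hqd : `|qdisc 0 X Y s t| < d by have [] := HT _ _ (r31 _ _ st).
  have := neg1 _ _ (r31 _ _ st); rewrite [b + _]addrC => h1 h2.
  have h3 := inc x sg (lt_le_trans xbr bd).
  rewrite xs [b + _]addrC addrK in h3; have {}h3 := h3 hqd s0.
  have p1 : 0 <= k * sg by rewrite mulr_ge0// ltW.
  have p2 : 0 <= L / 2 * (s ^+ 2 + t ^+ 2) by rewrite mulr_ge0 ?(ltW L20)// addr_ge0 ?sqr_ge0.
  case: pos => pos.
    have : 0 < L / 2 * (s ^+ 2 + t ^+ 2) by rewrite mulr_gt0.
    lra.
  have : 0 < k * sg by rewrite mulr_gt0.
  lra.
pose K1 := [set c : R * R | c.1 ^+ 2 + c.2 ^+ 2 = r3 ^+ 2].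
have K1c : compact K1.
  apply: (subclosed_compact _ (@compact_disc R r3)); last by move=> c; rewrite /K1 /= => ->.
  have -> : K1 = (fun c : R * R => c.1 ^+ 2 + c.2 ^+ 2) @^-1` [set t | t = r3 ^+ 2] by [].
  apply: closed_comp; last exact: closed_eq.
  by move=> x _; apply: cvgD; rewrite expr2; apply: cvgM; [exact: cvg_fst..|exact: cvg_snd|exact: cvg_snd].
have gc : continuous (fun c : R * R => qdisc b X Y c.1 c.2) by exact: qdisc_continuous.
have qE s t : qdisc b X Y s t = b + qdisc 0 X Y s t by rewrite /qdisc add0r -addrA.
have K1D c : K1 c -> D (qdisc b X Y c.1 c.2).
  rewrite /K1 /= => cE.
  have -> : qdisc b X Y c.1 c.2 = b + qdisc 0 X Y c.1 c.2 - 0 *: nu by rewrite qE scale0r subr0.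
  apply: inD => //.
  - by rewrite cE.
  - exact: ltW.
  - by left; rewrite cE exprn_gt0.
have K10 : K1 (r3, 0) by rewrite /K1 /= expr0n /= addr0.
have ugc : {in K1, continuous (fun c : R * R => u (qdisc b X Y c.1 c.2))}.
  move=> c /set_mem cK; apply: (@continuous_comp _ _ _ (fun c : R * R => qdisc b X Y c.1 c.2) u).
    exact: gc.
  by apply: uc; rewrite inE; exact: K1D.
have [cm cmK Hm] := compact_EVT_max (ex_intro _ _ K10) K1c (continuous_in_subspaceT ugc).
set M0 := u _ in Hm.
have [e e0 He] : exists2 e : R, 0 < e & forall c v, K1 c -> `|v| < e -> u (qdisc b X Y c.1 c.2 + v) < M0 + 1.
  apply: (@compact_tube _ _ _ K1 _ (fun x => u x < M0 + 1) K1c gc) => c Kc.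
  have /uc/continuous_supP/(_ _ ltr01)[e e0 He] : qdisc b X Y c.1 c.2 \in D by rewrite inE; exact: K1D.
  apply: (nbhs_sup e0) => y /He; rewrite ltr_norml => /andP[_].
  rewrite ltrBlDr addrC => /lt_le_trans; apply; rewrite lerD2r; apply: Hm; by rewrite inE.
pose sg1 := Num.min sg0 (e / (`|nu| + 1)).
have sg10 : 0 < sg1 by rewrite lt_min sg00 divr_gt0.
(* The bound does not depend on [sg]: the shifted boundary circles stay close to the compact circle
   in [D] on which [u <= M0]. *)
have main sg : 0 < sg -> sg <= sg1 -> u (b - sg *: nu) <= M0 + 1.
  move=> s0; rewrite le_min => /andP[ss1 ss2].
  have qs s t : qdisc (b - sg *: nu) X Y s t = b + qdisc 0 X Y s t - sg *: nu.
    have aux (p q v v' : Cn) : p - v + q + v' = p + (q + v') - v by apply/rowP => i; rewrite !mxE; ring.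
    by rewrite /qdisc add0r; exact: aux.
  apply: (@qdisc_max_principle _ _ D u _ X Y r3) => // s t st.
    by rewrite qs; apply: inD => //; [exact: ltW|right].
  rewrite qs -qE; apply/ltW/(He (s, t)) => //.
  rewrite normrN normrZ gtr0_norm//; apply: (@le_lt_trans _ _ (e / (`|nu| + 1) * `|nu|)).
    by rewrite ler_wpM2r.
  by rewrite mulrAC ltr_pdivrMr// ltr_pM2l// ltrDl.
(* The points [b - sg *: nu] lie in one sublevel set and tend to [b], so the exhaustion property
   would place [b] in [D], although [rho b = 0]. *)
have [_ clD] := ue (M0 + 2).
have : D b.
  apply: clD => B /nbhs_supP[e1 e10 HB].
  pose sg := Num.min sg1 (e1 / (`|nu| + 1)).
  have s0 : 0 < sg by rewrite lt_min sg10 divr_gt0.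
  have ss1 : sg <= sg1 by rewrite ge_min lexx.
  have ss0 : sg <= sg0 by apply: le_trans ss1 _; rewrite ge_min lexx.
  exists (b - sg *: nu); split; last first.
    apply: HB; rewrite addrC addKr normrN normrZ gtr0_norm//.
    apply: (@le_lt_trans _ _ (e1 / (`|nu| + 1) * `|nu|)).
      by rewrite ler_wpM2r// ge_min lexx orbT.
    by rewrite mulrAC ltr_pdivrMr// ltr_pM2l// ltrDl.
  split; last by apply: le_lt_trans (main _ s0 ss1) _; rewrite ltrD2l ltr1n.
  have := inD 0 0 sg; rewrite !expr0n/= addr0 sqr_ge0 => /(_ isT (ltW s0) ss0 (or_intror s0)).
  by rewrite /qdisc /cscl !expr0n/= !mulr0 subr0 !scale0r !addr0.
by case=> _ /=; rewrite rb ltxx.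
Qed.

End LeviForm.

(** * Gradient at a boundary point touched by an interior ball *)

Section InteriorBall.
Context {R : realType} {m : nat}.

(** Every direction [v] with [0 < dot v (y - b)] enters the ball, so [g] is nonpositive on an open
    half-space and must be a multiple of its normal. *)
Lemma interior_ball_normal (F : 'rV[R]_m -> R) (y b g : 'rV[R]_m) (d0 : R) : 0 < d0 -> y != b ->
  (forall e : R, 0 < e -> exists2 d : R, 0 < d &
     forall v, `|v| < d -> `|F (b + v) - dot g v| <= e * `|v|) ->
  (forall x, euclid_norm (x - y) < euclid_norm (y - b) -> `|x - b| < d0 -> F x < 0) ->
  g != 0 -> exists2 a : R, a < 0 & g = a *: (y - b).
Proof.
move=> d00 yb HF Hneg g0.
set n := y - b; have n0 : n != 0 by rewrite subr_eq0.
have nn := dot_gt0 n0.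
have nE : y - b = n by [].
rewrite nE in Hneg; clearbody n.
have key v : 0 < dot v n -> dot g v <= 0.
  move=> vn; rewrite leNgt; apply/negP => gv.
  have v1 : 0 < `|v| + 1 by rewrite ltr_wpDl.
  have v2 : 0 < dot v v + 1 by rewrite ltr_wpDl// dot_ge0.
  pose e := dot g v / 2 / (`|v| + 1).
  have e0 : 0 < e by rewrite !divr_gt0.
  have [d dd0 Hd] := HF e e0.
  pose s := Num.min (Num.min d d0 / (`|v| + 1)) (dot v n / (dot v v + 1)).
  have dd : 0 < Num.min d d0 by rewrite lt_min dd0.
  have s0 : 0 < s by rewrite /s lt_min (divr_gt0 dd v1) (divr_gt0 vn v2).
  have s1 : s * (`|v| + 1) <= Num.min d d0 by rewrite -ler_pdivlMr// ge_min lexx.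
  have s2 : s * (dot v v + 1) <= dot v n by rewrite -ler_pdivlMr// ge_min lexx orbT.
  have sv : `|s *: v| < Num.min d d0.
    by rewrite normrZ gtr0_norm//; apply: lt_le_trans s1; rewrite ltr_pM2l// ltrDl.
  move: sv; rewrite lt_min => /andP[sv1 sv2].
  have Fneg : F (b + s *: v) < 0.
    apply: Hneg; last by rewrite addrC addKr.
    rewrite en_lt ?en_ge0// en_sq.
    have -> : b + s *: v - y = s *: v - n by rewrite -nE opprB addrA [b + _]addrC.
    rewrite !dotDl !dotDr !dotNl !dotNr !dotZl !dotZr (dotC n v).
    have : s * (s * dot v v) < 2 * (s * dot v n).
      rewrite [ltRHS]mulrCA ltr_pM2l//; move: s2; rewrite mulrDr mulr1; lra.
    lra.
  have := Hd _ sv1; rewrite ler_norml => /andP[+ _].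
  rewrite dotZr normrZ gtr0_norm// => h.
  have : e * (s * `|v|) <= s * dot g v / 2.
    rewrite /e [leLHS](_ : _ = s * dot g v / 2 * (`|v| / (`|v| + 1))); last by ring.
    rewrite ler_piMr//; first by rewrite divr_ge0// mulr_ge0// ltW.
    by rewrite ler_pdivrMr// mul1r lerDl.
  have : 0 < s * dot g v by rewrite mulr_gt0.
  lra.
pose a := dot g n / dot n n.
pose h := g - a *: n.
have hn : dot h n = 0 by rewrite /h dotDl dotNl dotZl /a divfK ?subrr// gt_eqF.
have gh : dot g h = dot h h.
  apply/esym; rewrite {1}/h dotDl dotNl dotZl (dotC n h) hn mulr0 subr0.
  by [].
have h0 : dot h h = 0.
  apply/eqP; rewrite -[_ == _]negbK; apply/negP => hh0.
  have hh : 0 < dot h h by rewrite lt_def hh0 dot_ge0.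
  (* The coefficient gives this direction inner product 1 with [g] and [dot n n] with [n], against
     [key]. *)
  have := key (n + (1 - dot g n) / dot h h *: h).
  rewrite dotDl dotZl hn mulr0 addr0 => /(_ nn).
  by rewrite dotDr dotZr gh divfK// addrC subrK ler10.
have gE : g = a *: n.
  by apply/eqP; rewrite -subr_eq0; apply/eqP; exact: dot_eq0.
exists a => //.
have : dot g n <= 0 by apply: key.
rewrite {1}gE dotZl pmulr_lle0// le_eqVlt => /orP[/eqP a0|//].
by move: g0; rewrite gE a0 scale0r eqxx.
Qed.

End InteriorBall.

(** * Logarithmic estimates over the fourth roots of unity *)

Section FourthRoots.
Context {R : realType}.

(* |1 + a c + b c^2|^2 for c = s + i t, a = a1 + i a2, b = b1 *)
Definition sq_mod (a1 a2 b1 s t : R) : R :=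
  (1 + (s * a1 - t * a2) + (s ^+ 2 - t ^+ 2) * b1) ^+ 2 + (s * a2 + t * a1 + 2 * s * t * b1) ^+ 2.

(* The product over the fourth roots of unity of 1 + a c + b c^2 is 1 + O(r^4). *)
Lemma prod_sq_mod (a1 a2 b1 : R) : exists2 C : R, 0 < C & forall r, 0 <= r -> r <= 1 ->
  sq_mod a1 a2 b1 r 0 * sq_mod a1 a2 b1 0 r * sq_mod a1 a2 b1 (- r) 0 * sq_mod a1 a2 b1 0 (- r)
    <= 1 + C * r ^+ 4.
Proof.
(* With a^2 = p + i q, the product of the complex factors is ((1 + b r^2)^2 - a^2 r^2) ((1 - b
   r^2)^2 + a^2 r^2) = 1 + r^4 (P r + i Q). *)
pose p := a1 ^+ 2 - a2 ^+ 2; pose q := 2 * a1 * a2.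
pose P r := - 2 * b1 ^+ 2 + b1 ^+ 4 * r ^+ 4 + 4 * p * b1 - p ^+ 2 + q ^+ 2.
pose Q := q * (4 * b1 - 2 * p).
pose P0 := 2 * b1 ^+ 2 + b1 ^+ 4 + 4 * `|p * b1| + p ^+ 2 + q ^+ 2.
have b40 : 0 <= b1 ^+ 4 by rewrite -[4%N]/(2 * 2)%N exprM sqr_ge0.
have P00 : 0 <= P0.
  have := sqr_ge0 p; have := sqr_ge0 q; have := sqr_ge0 b1; have := normr_ge0 (p * b1).
  rewrite /P0; lra.
exists (2 * P0 + P0 ^+ 2 + Q ^+ 2 + 1).
  by have := sqr_ge0 P0; have := sqr_ge0 Q; lra.
move=> r r0 r1.
rewrite [leLHS](_ : _ = 1 + (2 * P r + r ^+ 4 * P r ^+ 2 + r ^+ 4 * Q ^+ 2) * r ^+ 4); last first.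
  by rewrite /sq_mod /P /Q /p /q; ring.
have r4 : 0 <= r ^+ 4 by rewrite exprn_ge0.
have r41 : r ^+ 4 <= 1 by rewrite exprn_ile1.
rewrite lerD2l ler_wpM2r//.
have hP : `|P r| <= P0.
  have : b1 ^+ 4 * r ^+ 4 <= b1 ^+ 4 by rewrite ler_piMr.
  have : 0 <= b1 ^+ 4 * r ^+ 4 by rewrite mulr_ge0.
  have := ler_norm (p * b1); have := ler_norm (- (p * b1)); rewrite normrN.
  have := sqr_ge0 p; have := sqr_ge0 q; have := sqr_ge0 b1.
  by rewrite ler_norml /P /P0; lra.
have hP2 : P r ^+ 2 <= P0 ^+ 2 by rewrite -real_normK ?num_real// ler_pXn2r ?nnegrE.
have h1 : r ^+ 4 * P r ^+ 2 <= P0 ^+ 2 by apply: le_trans hP2; rewrite ler_piMl// sqr_ge0.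
have h2 : r ^+ 4 * Q ^+ 2 <= Q ^+ 2 by rewrite ler_piMl// sqr_ge0.
have := le_trans (ler_norm _) hP; lra.
Qed.

(** The lower bound on [S] turns the additive error [t] into the relative error [2 * t]. *)
Lemma ln_perturb (x d S t : R) : 0 < x -> 0 < d -> 1 / 2 <= S -> 0 <= t -> x <= d * (S + t) ->
  ln x <= ln d + ln S + 2 * t.
Proof.
move=> x0 d0 S2 t0 xd.
have S0 : 0 < S by apply: lt_le_trans S2; rewrite divr_gt0.
have t1 : 0 < 1 + 2 * t by lra.
have : x <= d * (S * (1 + 2 * t)).
  apply: le_trans xd _; rewrite ler_pM2l// mulrDr mulr1 lerD2l.
  by have := ler_wpM2r t0 S2; lra.
rewrite -ler_ln ?posrE ?mulr_gt0// => /le_trans; apply.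
rewrite !lnM ?posrE ?mulr_gt0// addrA lerD2l.
by rewrite -[leRHS]expRK ler_ln ?posrE ?expR_gt0// expR_ge1Dx.
Qed.

Lemma sum_ln_sqrt (a b c e C : R) : 0 < a -> 0 < b -> 0 < c -> 0 < e -> 0 <= C ->
  a * b * c * e <= 1 + C ->
  ln (Num.sqrt a) + ln (Num.sqrt b) + ln (Num.sqrt c) + ln (Num.sqrt e) <= C.
Proof.
move=> a0 b0 c0 e0 C0 H.
rewrite -!lnM ?posrE ?mulr_gt0 ?sqrtr_gt0// -!sqrtrM ?mulr_ge0 ?(ltW a0) ?(ltW b0) ?(ltW c0)//.
set N := a * b * c * e in H *.
have N0 : 0 < N by rewrite !mulr_gt0.
have : Num.sqrt N <= 1 + C.
  rewrite -ler_sqr ?nnegrE ?sqrtr_ge0 ?addr_ge0// sqr_sqrtr ?(ltW N0)//.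
  by apply: le_trans H _; rewrite expr2 ler_peMl ?lerDl// addr_ge0.
rewrite -ler_ln ?posrE ?sqrtr_gt0 ?ltr_wpDr// => /le_trans; apply.
by rewrite -[leRHS]expRK ler_ln ?posrE ?expR_gt0 ?ltr_wpDr// expR_ge1Dx.
Qed.

Lemma add4_bound (l a b c d a' b' c' d' t e : R) :
  - l - a - t <= a' -> - l - b - t <= b' -> - l - c - t <= c' -> - l - d - t <= d' ->
  a + b + c + d <= e -> - (4 * l) - (e + 4 * t) <= a' + b' + c' + d'.
Proof. lra. Qed.

End FourthRoots.

(** * Four-point means where the nearest boundary point is regular *)

Section GoodPoint.
Context {R : realType} {n : nat}.
Local Notation Cn := ('rV[R]_(n + n)).
Implicit Types (rho f : Cn -> R) (b nu g X Y w : Cn) (M : 'M[R]_(n + n)).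

(* The quadratic disc osculating the boundary at the nearest point b of y stays, up to o(r^2),
   outside of the domain, so it bounds the distance function at y + c w from above. *)
Lemma ln_cdist_sum4 rho b f g M nu (k d : R) (y w : Cn) (eta : R) :
  continuous rho -> local_defining rho b f g M nu k d ->
  let Om := [set z | rho z < 0] in
  rho b = 0 -> Om y -> cdist Om y = euclid_norm (y - b) ->
  (forall X, dot g X = 0 -> dot g (mulI X) = 0 -> 0 <= bilin M X X + bilin M (mulI X) (mulI X)) ->
  0 < eta ->
  exists2 r0 : R, 0 < r0 & forall r : R, 0 < r -> r < r0 ->
    - (4 * ln (cdist Om y)) - eta * r ^+ 2 <= sum4 (fun x => - ln (cdist Om x)) y (r *: w).
Proof.
move=> rc LD Om rb Oy yb Lev eta0.
have [g0 [k0 d0] HT inc sgn] := LD.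
have Omo : open Om.
  have -> : Om = rho @^-1` [set t | t < 0] by [].
  by apply: open_comp; [move=> x _; exact: rc|exact: open_lt].
have nOb : ~ Om b by rewrite /Om /= rb ltxx.
have Om0 : ~` Om !=set0 by exists b.
have ynb : y != b by apply/eqP => E; apply: nOb; rewrite -E.
set D := cdist Om y in yb *.
have D0 : 0 < D by exact: cdist_gt0.
have [a a0 gE] : exists2 a : R, a < 0 & g = a *: (y - b).
  apply: (@interior_ball_normal _ _ f y b g d) => //.
  - move=> e e0; have [C C0 HC] := bilin_bound M.
    have [d' d'0 Hd'] := HT _ ltr01.
    have C1 : 0 < C + 1 by rewrite addr_gt0.
    exists (Num.min d' (e / (C + 1))); first by rewrite lt_min d'0 divr_gt0.
    move=> v; rewrite lt_min => /andP[v1 v2].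
    rewrite -(subrK (bilin M v v) (_ - _)); apply: le_trans (ler_normD _ _) _.
    apply: le_trans (lerD (Hd' _ v1) (HC _ _)) _.
    rewrite mul1r expr2 -mulrDl ler_wpM2r// addrC -{2}(mul1r `|v|) -mulrDl mulrC.
    by rewrite -ler_pdivlMr// ltW.
  - by move=> x xy xd; rewrite -sgn//; apply: (@cdist_ball _ _ Om y); rewrite -/D yb.
pose m := b - y.
have m0 : m != 0 by rewrite subr_eq0 eq_sym.
have mm := dot_gt0 m0.
have enm : euclid_norm m = D by rewrite /m enBC -yb.
have gE' : g = (- a) *: m by rewrite gE /m -[y - b]opprB scalerN scaleNr.
have mE : b - y = m by [].
clearbody m.
pose k1 := dot g m.
have k10 : 0 < k1 by rewrite /k1 gE' dotZl mulr_gt0// oppr_gt0.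
have k1n : k1 != 0 by rewrite gt_eqF.
have gIm : dot g (mulI m) = 0 by rewrite gE' dotZl dot_mulI_self mulr0.
(* [X] is [w] moved along the complex line of [m] into the complex tangent space at [b], where the
   Levi form is known to be nonnegative. *)
pose a1 := - dot g w / k1; pose a2 := dot g (mulI w) / k1.
pose X := w + cscl a1 a2 m.
have gX : dot g X = 0.
  by rewrite /X /cscl !dotDr !dotZr gIm mulr0 addr0 -/k1 /a1 divfK// subrr.
have gIX : dot g (mulI X) = 0.
  rewrite /X /cscl !mulID !mulIZ mulII !dotDr !dotZr gIm mulr0 add0r dotNr -/k1 mulrN /a2 divfK//.
  by rewrite subrr.
have L0 := Lev X gX gIX.
(* Only parameters with s t = 0 are visited, where c^2 is real. A real coefficient therefore
   suffices to turn the second-order part of [f] on the disc into |c|^2 times half the Levi form. *)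
pose b1 := (bilin M (mulI X) (mulI X) - bilin M X X) / 2 / k1.
pose Y := b1 *: m.
pose N := sq_mod a1 a2 b1.
(* The vector from y + c w to the disc point is (1 + a c + b1 c^2) m, a complex multiple of [m]. *)
have dist s t : euclid_norm (m + qdisc 0 X Y s t - cscl s t w) = Num.sqrt (N s t) * D.
  rewrite (_ : _ - _ = cscl (1 + (s * a1 - t * a2) + (s ^+ 2 - t ^+ 2) * b1)
     (s * a2 + t * a1 + 2 * s * t * b1) m); first by rewrite en_cscl enm.
  rewrite /qdisc /X /Y csclD csclM csclZ /cscl; move: (mulI w) (mulI m) => w' m'.
  by apply/rowP => i; rewrite !mxE; ring.
clearbody X.
pose en := euclid_norm nu + 1.
have en0 : 0 < en by rewrite ltr_wpDl// en_ge0.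
(* Half of [eta] pays for the r^4 term of the product; the other half is shared by four points that
   cost [2 * (e' * r ^+ 2)] each. *)
pose e' := eta / 16; have e'0 : 0 < e' by rewrite divr_gt0.
pose e := e' * k * D / en; have e0 : 0 < e by rewrite divr_gt0// !mulr_gt0.
have [r1 r10 HQ] := qdisc_taylor X Y LD e0.
have d'0 : 0 < d / 2 by rewrite divr_gt0.
(* The halved radius leaves room for the push along [nu]. *)
have LD' : local_defining rho b f g M nu k (d / 2).
  have d2d : d / 2 <= d by move: d0; clear; lra.
  split=> //; first by move=> x s xb xsb; apply: inc; exact: lt_le_trans d2d.
  by move=> x xb; apply: sgn; exact: lt_le_trans d2d.
have [r2 r20 HQ2] := qdisc_taylor X Y LD' e0.
have [C C0 HC] := prod_sq_mod a1 a2 b1.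
pose A := `|a1| + `|a2| + `|b1| + 1.
have A0 : 0 < A by rewrite ltr_wpDl// !addr_ge0.
pose W := euclid_norm w + 1.
have W0 : 0 < W by rewrite ltr_wpDl// en_ge0.
pose nn := `|nu| + 1; have nn0 : 0 < nn by rewrite ltr_wpDl.
pose r0 := Num.min 1 (Num.min (Num.min r1 r2) (Num.min (1 / 2 / A) (Num.min (D / W)
   (Num.min (eta / 2 / C) (d / 2 / (e / k * nn)))))).
have ek0 : 0 < e / k by rewrite divr_gt0.
have ekn : 0 < e / k * nn by rewrite mulr_gt0.
have r00 : 0 < r0.
  have u1 : 0 < 1 / 2 / A by rewrite !divr_gt0.
  have u2 : 0 < eta / 2 / C by rewrite !divr_gt0.
  by rewrite /r0 !lt_min ltr01 r10 r20 u1 u2 (divr_gt0 D0 W0) (divr_gt0 d'0 ekn).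
exists r0 => // r rp; rewrite /r0 !lt_min.
move=> /and5P[ltr1 /andP[rr1 rr2] rA rW /andP[rC rd]].
rewrite (ltr_pdivlMr _ _ A0) in rA; rewrite (ltr_pdivlMr _ _ W0) in rW.
rewrite (ltr_pdivlMr _ _ C0) in rC; rewrite (ltr_pdivlMr _ _ ekn) in rd.
have rsq : r ^+ 2 < r by rewrite expr2 gtr_pMr.
have pt s t : s * t = 0 -> s ^+ 2 + t ^+ 2 = r ^+ 2 ->
    0 < N s t /\ - ln D - ln (Num.sqrt (N s t)) - 2 * (e' * r ^+ 2) <= - ln (cdist Om (y + cscl s t w)).
  move=> st0 st.
  have bnd (x z : R) : x ^+ 2 + z ^+ 2 = r ^+ 2 -> `|x| <= r.
    move=> xz; rewrite -ler_sqr ?nnegrE ?(ltW rp)// real_normK ?num_real// -xz lerDl sqr_ge0 //.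
  have sr := bnd _ _ st; have tr : `|t| <= r by apply: (bnd t s); rewrite addrC.
  have re : 1 / 2 <= 1 + (s * a1 - t * a2) + (s ^+ 2 - t ^+ 2) * b1.
    have q1 : `|s * a1| <= r * `|a1| by rewrite normrM ler_wpM2r.
    have q2 : `|t * a2| <= r * `|a2| by rewrite normrM ler_wpM2r.
    have q3 : `|(s ^+ 2 - t ^+ 2) * b1| <= r * `|b1|.
      rewrite normrM ler_wpM2r//; apply: (@le_trans _ _ (r ^+ 2)); last exact: ltW.
      move: (sqr_ge0 s) (sqr_ge0 t); rewrite ler_norml -st; clear; lra.
    move: q1 q2 q3 rA; rewrite !ler_norml /A !mulrDr => /andP[q1 _] /andP[_ q2] /andP[q3 _] rA'.
    move: q1 q2 q3 rA' rp; clear; lra.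
  have N1 : 1 / 4 <= N s t.
    rewrite /N /sq_mod; have := sqr_ge0 (s * a2 + t * a1 + 2 * s * t * b1).
    have : (1 / 2) ^+ 2 <= (1 + (s * a1 - t * a2) + (s ^+ 2 - t ^+ 2) * b1) ^+ 2.
      by rewrite ler_pXn2r ?nnegrE// (le_trans _ re).
    clear; lra.
  have N0 : 0 < N s t by apply: lt_le_trans N1; rewrite divr_gt0.
  split => //.
  have S1 : 1 / 2 <= Num.sqrt (N s t).
    rewrite -ler_sqr ?nnegrE ?sqrtr_ge0// sqr_sqrtr ?(ltW N0)//; move: N1; clear; lra.
  have st1 : s ^+ 2 + t ^+ 2 <= r1 ^+ 2.
    by rewrite st ler_pXn2r ?nnegrE ?(ltW rp) ?(ltW r10) ?(ltW rr1).
  have st2 : s ^+ 2 + t ^+ 2 <= r2 ^+ 2.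
    by rewrite st ler_pXn2r ?nnegrE ?(ltW rp) ?(ltW r20) ?(ltW rr2).
  have [_ /ler_normlP[fq _]] := HQ s t st1.
  have [qd _] := HQ2 s t st2.
  have val : dot g (cscl s t X) + dot g (cscl (s ^+ 2 - t ^+ 2) (2 * s * t) Y)
       + bilin M (cscl s t X) (cscl s t X) =
       r ^+ 2 * ((bilin M X X + bilin M (mulI X) (mulI X)) / 2).
    rewrite /Y /cscl mulIZ !dotDr !dotZr gX gIX gIm -/k1 !bilinDl !bilinDr !bilinZl !bilinZr.
    rewrite -st /b1.
    have e1 (z : R) : t * (s * z) = 0 by rewrite mulrA [t * s]mulrC st0 mul0r.
    have e2 (z : R) : s * (t * z) = 0 by rewrite mulrA st0 mul0r.
    rewrite e1 e2; field; exact: k1n.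
  have fq' : - (e * r ^+ 2) <= f (b + qdisc 0 X Y s t).
    move: fq; rewrite val st.
    have : 0 <= r ^+ 2 * ((bilin M X X + bilin M (mulI X) (mulI X)) / 2).
      by rewrite mulr_ge0 ?sqr_ge0// divr_ge0.
    clear; lra.
  (* A push by [s'] along [nu] raises [f] by at least [e * r ^+ 2], which makes up for the Taylor
     error and brings the disc point out of the domain. *)
  pose s' := e / k * r ^+ 2.
  have s'0 : 0 <= s' by rewrite mulr_ge0 ?(ltW ek0)// sqr_ge0.
  pose b' := b + qdisc 0 X Y s t + s' *: nu.
  have s'n : `|s' *: nu| < d / 2.
    rewrite normrZ ger0_norm// /s'; apply: le_lt_trans rd.
    rewrite (_ : e / k * r ^+ 2 * `|nu| = r ^+ 2 * (e / k * `|nu|)); last by ring.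
    have h1 : 0 <= e / k * `|nu| by rewrite mulr_ge0// ltW.
    have h2 : e / k * `|nu| <= e / k * nn by rewrite ler_wpM2l ?(ltW ek0)// /nn lerDl.
    exact: ler_pM (sqr_ge0 _) h1 (ltW rsq) h2.
  have nOb' : ~ Om b'.
    have h0 : `|b + qdisc 0 X Y s t - b| < d by rewrite addrC addKr; move: qd d0; clear; lra.
    have h1 : `|b' - b| < d.
      have aux (p q v : Cn) : p + q + v - p = q + v by apply/rowP => i; rewrite !mxE; ring.
      have -> : b' - b = qdisc 0 X Y s t + s' *: nu by exact: aux.
      by rewrite (le_lt_trans (ler_normD _ _))// [ltRHS]splitr ltrD.
    have := inc _ _ h0 h1 s'0; rewrite /Om /= -/b' sgn//.
    have -> : k * s' = e * r ^+ 2 by rewrite /s' mulrA [k * _]mulrC divfK// gt_eqF.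
    move=> h2; apply/negP; rewrite -leNgt; move: h2 fq'; clear; lra.
  have Oyc : Om (y + cscl s t w).
    apply: (@cdist_ball _ _ Om y); rewrite addrC addKr -/D en_cscl st sqrtr_sqr gtr0_norm//.
    by apply: le_lt_trans rW; rewrite ler_wpM2l ?(ltW rp)// /W lerDl.
  have := cdist_le (y + cscl s t w) nOb'.
  have -> : y + cscl s t w - b' = - ((m + qdisc 0 X Y s t - cscl s t w) + s' *: nu).
    rewrite -mE.
    have aux (p1 p2 p3 p4 p5 : Cn) : p1 + p2 - (p3 + p4 + p5) = - ((p3 - p1 + p4 - p2) + p5).
      by apply/rowP => i; rewrite !mxE; ring.
    exact: aux.
  rewrite enN => h; have {}h := le_trans h (enD _ _).
  rewrite dist enZ ger0_norm// in h.
  have h3 : s' * euclid_norm nu <= D * (e' * r ^+ 2).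
    rewrite /s' /e (_ : _ * _ = D * (e' * r ^+ 2) * (euclid_norm nu / en)); last first.
      by field; rewrite !gt_eqF.
    rewrite ler_piMr ?(mulr_ge0 (ltW D0) (mulr_ge0 (ltW e'0) (sqr_ge0 r)))//.
    by rewrite ler_pdivrMr// mul1r /en lerDl.
  have h4 : cdist Om (y + cscl s t w) <= D * (Num.sqrt (N s t) + e' * r ^+ 2).
    by apply: le_trans h _; rewrite mulrDr mulrC lerD2l.
  have h5 := ln_perturb (cdist_gt0 Omo Om0 Oyc) D0 S1 (mulr_ge0 (ltW e'0) (sqr_ge0 r)) h4.
  by move: h5; clear; lra.
have [n1 p1] : 0 < N r 0 /\ - ln D - ln (Num.sqrt (N r 0)) - 2 * (e' * r ^+ 2) <= - ln (cdist Om (y + cscl r 0 w)).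
  by apply: pt; rewrite ?mulr0// expr0n/= addr0.
have [n2 p2] : 0 < N 0 r /\ - ln D - ln (Num.sqrt (N 0 r)) - 2 * (e' * r ^+ 2) <= - ln (cdist Om (y + cscl 0 r w)).
  by apply: pt; rewrite ?mul0r// expr0n/= add0r.
have [n3 p3] : 0 < N (- r) 0 /\ - ln D - ln (Num.sqrt (N (- r) 0)) - 2 * (e' * r ^+ 2) <= - ln (cdist Om (y + cscl (- r) 0 w)).
  by apply: pt; rewrite ?mulr0// expr0n/= addr0 sqrrN.
have [n4 p4] : 0 < N 0 (- r) /\ - ln D - ln (Num.sqrt (N 0 (- r))) - 2 * (e' * r ^+ 2) <= - ln (cdist Om (y + cscl 0 (- r) w)).
  by apply: pt; rewrite ?mul0r// expr0n/= add0r sqrrN.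
have Cr : 0 <= C * r ^+ 4 by rewrite mulr_ge0 ?(ltW C0)// exprn_ge0// ltW.
have hs := sum_ln_sqrt n1 n2 n3 n4 Cr (HC r (ltW rp) (ltW ltr1)).
have Cr2 : C * r ^+ 4 <= eta / 2 * r ^+ 2.
  rewrite (_ : C * r ^+ 4 = r ^+ 2 * C * r ^+ 2); last by ring.
  rewrite ler_wpM2r ?sqr_ge0//; apply: le_trans (ltW rC).
  by rewrite ler_wpM2r ?(ltW C0)// ltW.
have c1 : r *: w = cscl r 0 w by rewrite /cscl scale0r addr0.
have c2 : mulI (r *: w) = cscl 0 r w by rewrite /cscl scale0r add0r mulIZ.
have c3 : - (r *: w) = cscl (- r) 0 w by rewrite /cscl scale0r addr0 scaleNr.
have c4 : - mulI (r *: w) = cscl 0 (- r) w by rewrite /cscl scale0r add0r mulIZ scaleNr.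
rewrite /sum4 c4 c3 c2 c1.
have -> : eta * r ^+ 2 = eta / 2 * r ^+ 2 + 4 * (2 * (e' * r ^+ 2)).
  by rewrite /e'; clear; field.
exact: add4_bound p1 p2 p3 p4 (le_trans hs Cr2).
Qed.

End GoodPoint.

(** * Null sets in terms of covers by cubes *)

Section NullSets.
Context {R : realType}.

(* Covers by balls of the sup norm indexed by an arbitrary choiceType: countability of the cover
   plays no role below, since cubes are compact. *)
Definition cube_null (m : nat) (A : set 'rV[R]_m) : Prop :=
  forall e : R, 0 < e -> exists (I : choiceType) (c : I -> 'rV[R]_m) (r : I -> R),
    [/\ forall i, 0 < r i,
        forall x, A x -> exists i, `|x - c i| < r i &
        forall s : seq I, uniq s -> \sum_(i <- s) r i ^+ m <= e].

Lemma cube_null_sub (m : nat) (A B : set 'rV[R]_m) : A `<=` B -> cube_null B -> cube_null A.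
Proof.
move=> AB HB e /HB[I [c [r [r0 rc rs]]]]; exists I, c, r; split => // x /AB; exact: rc.
Qed.

Lemma cube_null0 (m : nat) : cube_null (set0 : set 'rV[R]_m).
Proof.
move=> e e0; exists void, (fun i : void => match i with end), (fun=> 1); split => // s _.
by case: s => [|[]]; rewrite big_nil ltW.
Qed.

Lemma cube_nullU (m : nat) (A B : set 'rV[R]_m) : cube_null A -> cube_null B -> cube_null (A `|` B).
Proof.
move=> HA HB e e0; have e20 : 0 < e / 2 by rewrite divr_gt0.
have [I [c [r [r0 rc rs]]]] := HA _ e20; have [J [c' [r' [r'0 rc' rs']]]] := HB _ e20.
exists (I + J)%type, (fun k => match k with inl i => c i | inr j => c' j end),
  (fun k => match k with inl i => r i | inr j => r' j end); split.
- by case.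
- by move=> x [/rc[i xi]|/rc'[j xj]]; [exists (inl i)|exists (inr j)].
- move=> s us; pose s1 := pmap (fun k : I + J => if k is inl i then Some i else None) s.
  pose s2 := pmap (fun k : I + J => if k is inr i then Some i else None) s.
  have u1 : uniq s1.
    apply: (@pmap_uniq _ _ _ inl) => //.
    by case=> //= ? ? [].
  have u2 : uniq s2.
    apply: (@pmap_uniq _ _ _ inr) => //.
    by case=> //= ? ? [].
  rewrite (splitr e); apply: le_trans (lerD (rs _ u1) (rs' _ u2)).
  rewrite le_eqVlt; apply/orP; left; apply/eqP; rewrite /s1 /s2.
  elim: (s) => [|[i|j] t IH] /=; first by rewrite !big_nil addr0.
    by rewrite !big_cons IH addrA.
  by rewrite !big_cons IH addrCA.
Qed.

Lemma cube_null_bigcup_seq (m : nat) (T : Type) (s : seq T) (A : T -> set 'rV[R]_m) :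
  (forall t, cube_null (A t)) -> cube_null (\big[setU/set0]_(t <- s) A t).
Proof.
by move=> HA; apply: big_ind => //; [exact: cube_null0|exact: cube_nullU].
Qed.

(* The image of a null set under a Lipschitz multivalued map; only nearby points need to satisfy
   the Lipschitz bound. *)
Lemma cube_null_lipschitz (m : nat) (A B : set 'rV[R]_m) (L r0 : R)
    (rel : 'rV[R]_m -> 'rV[R]_m -> Prop) : (0 < m)%N -> 0 < L -> 0 < r0 -> cube_null A ->
  (forall y, B y -> exists2 x, A x & rel x y) ->
  (forall x x' y y', A x -> A x' -> rel x y -> rel x' y' -> `|x - x'| < r0 ->
     `|y - y'| <= L * `|x - x'|) ->
  cube_null B.
Proof.
move=> m0 L0 r00 HA Hrel Hlip e e0.
(* The first entry pays for the dilation of the cubes by [3 * L]; the second forces radii at most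
   [r0 / 2], so that the Lipschitz bound applies within each cube. Points of one cube are less than
   two radii apart, whence a factor above 2. *)
pose e1 := Num.min (e / (3 * L) ^+ m) ((r0 / 2) ^+ m).
have L30 : 0 < (3 * L) ^+ m by rewrite exprn_gt0// mulr_gt0.
have e10 : 0 < e1 by rewrite lt_min divr_gt0//= exprn_gt0// divr_gt0.
have [I [c [r [rp rc rs]]]] := HA _ e10.
have rle i : r i <= r0 / 2.
  have := rs [:: i] isT; rewrite big_seq1 => h.
  rewrite -(@ler_pXn2r _ m) ?nnegrE ?(ltW (rp i)) ?divr_ge0 ?(ltW r00)//.
  by apply: le_trans h _; rewrite ge_min lexx orbT.
pose P i y := exists2 x, A x & rel x y /\ `|x - c i| < r i.
(* A point related to the i-th cube serves as center; 0 stands in when there is none. *)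
pose c' i : 'rV[R]_m := if pselect (exists y, P i y) is left h then projT1 (cid h) else 0.
exists I, c', (fun i => 3 * L * r i); split.
- by move=> i; rewrite !mulr_gt0.
- move=> y /Hrel[x Ax xy]; have [i xi] := rc _ Ax; exists i.
  rewrite /c'; case: pselect => [h|]; last by case; exists y, x.
  case: cid => y' /= [x' Ax' [xy' xi']].
  have xx : `|x - x'| < r i + r i.
    by rewrite (le_lt_trans (ler_distD (c i) _ _))// ltrD// distrC.
  have xr : `|x - x'| < r0.
    by apply: lt_le_trans xx _; rewrite [leRHS]splitr lerD.
  apply: le_lt_trans (Hlip _ _ _ _ Ax Ax' xy xy' xr) _.
  rewrite [3 * L]mulrC -mulrA ltr_pM2l//; apply: lt_trans xx _.
  by have := rp i; lra.
- move=> s us; under eq_bigr do rewrite exprMn.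
  rewrite -mulr_sumr mulrC -ler_pdivlMr//; apply: le_trans (rs _ us) _.
  by rewrite ge_min lexx.
Qed.

End NullSets.

(** * A cube is not null *)

Section CubeNotNull.
Context {R : realType}.

Lemma card_grid_in (M : nat) (c r : R) : (0 < M)%N -> 0 < r ->
  (#|[pred k : 'I_M | `|(nat_of_ord k)%:R / M%:R - c| < r]|%:R : R) <= 2 * r * M%:R + 1.
Proof.
move=> M0 r0; have M0' : 0 < M%:R :> R by rewrite ltr0n.
set P := [pred k : 'I_M | _].
have [/eqP->|] := boolP (#|P| == 0)%N; first by rewrite addr_ge0// !mulr_ge0// ltW.
rewrite -lt0n => /card_gt0P[k0 k0P].
have [k kP kmin] := arg_minnP (fun k : 'I_M => nat_of_ord k) k0P.
pose N := Num.truncn (2 * r * M%:R).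
have sub : forall j : 'I_M, P j -> (j - k < N.+1)%N.
  move=> j jP; have kj := kmin j jP.
  have : (j%:R - k%:R : R) < 2 * r * M%:R.
    have : `|(nat_of_ord j)%:R / M%:R - (nat_of_ord k)%:R / M%:R| < r + r :> R.
      by rewrite (le_lt_trans (ler_distD c _ _))// ltrD// distrC.
    rewrite -mulrBl normrM (gtr0_norm (x := M%:R^-1)) ?invr_gt0// ltr_pdivrMr//.
    by move=> /(le_lt_trans (ler_norm _)) h; apply: lt_le_trans h _; rewrite -mulr2n mulr_natl.
  rewrite -natrB// => h; rewrite ltnS truncn_ge_nat; first exact: ltW.
  by rewrite !mulr_ge0// ltW.
have cardP : (#|P| <= N.+1)%N.
  have inj : {in P &, injective (fun j : 'I_M => inord (j - k) : 'I_N.+1)}.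
    move=> i j iP jP /(congr1 val); rewrite /= !inordK ?sub// => h.
    by apply/val_inj; rewrite /= -[LHS](subnK (kmin i iP)) -[RHS](subnK (kmin j jP)) h.
  rewrite -(card_in_image inj) -[leqRHS]card_ord; exact: max_card.
apply: (@le_trans _ _ (N.+1)%:R); first by rewrite ler_nat.
by rewrite -natr1 lerD2r truncn_le !mulr_ge0// ltW.
Qed.

Lemma sup_norm_continuous (m : nat) : continuous (fun x : 'rV[R]_m => `|x|).
Proof. by apply: (@lip_continuous _ _ _ 1) => x y; rewrite mul1r ler_dist_dist. Qed.

Lemma large_nat_seq (T : eqType) (s : seq T) (f : T -> R) :
  exists2 M : nat, (0 < M)%N & forall i, i \in s -> f i <= M%:R.
Proof.
elim: s => [|x s [M M0 HM]]; first by exists 1%N.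
exists (M + (Num.trunc (f x)).+1)%N; first by rewrite addn_gt0 M0.
move=> i; rewrite inE natrD => /orP[/eqP->|/HM h].
  by rewrite ler_wpDl// ltW// truncnS_gt.
by rewrite ler_wpDr.
Qed.

(** Counting replaces measure: for a finite subcover and a fine grid of M^m points, a cube of radius
    r contains at most (4 M r / eta)^m of them. The choice of [e] then bounds the number of covered
    grid points by M^m / 2. *)
Lemma cube_not_null (m : nat) (eta : R) : (0 < m)%N -> 0 < eta ->
  ~ cube_null [set p : 'rV[R]_m | `|p| <= eta].
Proof.
move=> m0 eta0 Hnull.
pose e := (eta / 4) ^+ m / 2.
have e40 : 0 < (eta / 4) ^+ m by rewrite exprn_gt0// divr_gt0.
have e0 : 0 < e by rewrite divr_gt0.
have [I [c [r [r0 rc rs]]]] := Hnull e e0.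
have Kc : compact [set p : 'rV[R]_m | `|p| <= eta].
  apply: bounded_closed_compact.
    exists eta; split; first exact: num_real.
    by move=> M etaM v /= vr; apply: le_trans (ltW etaM).
  have -> : [set p : 'rV[R]_m | `|p| <= eta] = (fun x : 'rV[R]_m => `|x|) @^-1` [set t | t <= eta] by [].
  by apply: closed_comp; [move=> x _; exact: sup_norm_continuous|exact: closed_le].
have := Kc; rewrite compact_cover => /(_ I setT (fun i => [set x | `|x - c i| < r i])).
case.
- move=> i _.
  have -> : [set x | `|x - c i| < r i] = (fun x => `|x - c i|) @^-1` [set t | t < r i] by [].
  apply: open_comp; last exact: open_lt.
  move=> x _; apply: (@lip_continuous _ _ _ 1) => a b; rewrite mul1r.
  by apply: le_trans (ler_dist_dist _ _) _; rewrite opprB addrA subrK.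
- by move=> x /rc[i xi]; exists i.
move=> D _ Dcov.
pose s := enum_fset D.
have us : uniq s by exact: fset_uniq.
(* A mesh this fine lets the [+ 1] of the grid count be absorbed by doubling the main term. *)
have [M M0 HM] := large_nat_seq s (fun i => eta / (2 * r i)).
have M0' : 0 < M%:R :> R by rewrite ltr0n.
pose p (k : {ffun 'I_m -> 'I_M}) : 'rV[R]_m := \row_j (eta * ((nat_of_ord (k j))%:R / M%:R)).
have pK k : `|p k| <= eta.
  apply: sup_le_coord; first exact: ltW.
  move=> j; rewrite mxE ger0_norm ?mulr_ge0 ?divr_ge0 ?(ltW eta0)//.
  by rewrite ger_pMr// ler_pdivrMr// mul1r ler_nat ltnW.
pose Q i j (x : 'I_M) := `|(nat_of_ord x)%:R / M%:R - c i 0 j / eta| < r i / eta.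
have pQ k i : `|p k - c i| < r i -> forall j, Q i j (k j).
  move=> h j; rewrite /Q ltr_pdivlMr// -[X in _ * X](gtr0_norm eta0) -normrM mulrBl divfK ?gt_eqF// mulrC.
  by apply: le_lt_trans h; have := ler_coord_sup (p k - c i) j; rewrite !mxE.
have S1 : ((M ^ m)%:R : R) <= \sum_(i <- s) \prod_(j < m) (#|[pred x | Q i j x]|%:R : R).
  have -> : ((M ^ m)%:R : R) = \sum_(k : {ffun 'I_m -> 'I_M}) 1.
    by rewrite sumr_const card_ffun !card_ord.
  apply: (@le_trans _ _ (\sum_(k : {ffun 'I_m -> 'I_M}) \sum_(i <- s) \prod_(j < m) ((Q i j (k j))%:R : R))).
    apply: ler_sum => k _; have [i iD ki] := Dcov _ (pK k).
    have is_ : i \in s by [].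
    rewrite (big_rem _ is_)/= big1 => [|j _]; last by rewrite pQ.
    by rewrite lerDl; apply: sumr_ge0 => i' _; apply: prodr_ge0 => j _.
  rewrite exchange_big/= le_eqVlt; apply/orP; left; apply/eqP; apply: eq_bigr => i _.
  rewrite -(bigA_distr_bigA (fun j x => (Q i j x)%:R)); apply: eq_bigr => j _.
  rewrite -sum1_card natr_sum [RHS]big_mkcond/=; apply: eq_bigr => x _.
  by rewrite inE; case: (Q i j x).
have S2 : \sum_(i <- s) \prod_(j < m) (#|[pred x | Q i j x]|%:R : R) <=
    \sum_(i <- s) (4 * M%:R / eta) ^+ m * r i ^+ m.
  rewrite !big_seq; apply: ler_sum => i is_.
  rewrite -exprMn -[X in _ ^+ X]card_ord -prodr_const.
  apply: ler_prod => j _; rewrite ler0n/=.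
  apply: le_trans (card_grid_in _ M0 (divr_gt0 (r0 i) eta0)) _.
  have h := HM i is_.
  rewrite ler_pdivrMr ?mulr_gt0// in h.
  rewrite (_ : 4 * M%:R / eta * r i = 2 * (r i / eta) * M%:R + M%:R * (2 * r i) / eta); last by ring.
  by rewrite lerD2l ler_pdivlMr// mul1r.
have := le_trans S1 S2; rewrite -mulr_sumr => S3.
have Mm : 0 < M%:R ^+ m :> R by rewrite exprn_gt0.
have c0 : 0 <= (4 * M%:R / eta) ^+ m by rewrite exprn_ge0// divr_ge0 ?mulr_ge0// ltW.
have {S3} := le_trans S3 (ler_wpM2l c0 (rs _ us)).
have -> : (4 * M%:R / eta) ^+ m * e = M%:R ^+ m / 2.
  rewrite /e mulrA -exprMn; congr (_ ^+ _ / 2); field; rewrite gt_eqF//.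
rewrite natrX; lra.
Qed.

End CubeNotNull.

(** * From Lebesgue outer measure to covers by cubes *)

Section BoxCovers.
Context {R : realType}.

Lemma prod_add_close (I : finType) (l : I -> R) (d : R) : 0 < d ->
  exists2 h : R, 0 < h & \prod_i (l i + h) <= \prod_i l i + d.
Proof.
move=> d0.
have pc : continuous (fun h : R => \prod_i (l i + h)).
  elim: (index_enum I) => [|i s IH].
    by move=> h; under eq_fun do rewrite big_nil; exact: cvg_cst.
  move=> h; under eq_fun do rewrite big_cons.
  by apply: cvgM; [apply: cvgD; [exact: cvg_cst|exact: cvg_id]|exact: IH].
have /(@cvgrPdist_lt _ _ _ (nbhs (0 : R)))/(_ d d0) := pc 0.
move=> /nbhs_ballP[e /= e0 He]; exists (e / 2); first by rewrite divr_gt0.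
have : ball (0 : R) e (e / 2).
  by rewrite /ball /= sub0r normrN gtr0_norm ?divr_gt0// ltr_pdivrMr// ltr_pMr// ltr1n.
move=> /He; under eq_bigr do rewrite addr0.
rewrite ltr_norml => /andP[+ _]; move: (\prod_i _) (\prod_i _) => x y; lra.
Qed.

(** Take the lattice of mesh [h] anchored at [a]. Each point of the box is within [h] of the lattice
    point below it, and rounding lengthens each side by at most [h], which costs [d] in volume. This
    also handles flat boxes, as radii must be positive. *)
Lemma box_finite_cover (m : nat) (a b : 'rV[R]_m) (d : R) : (forall i, a 0 i <= b 0 i) -> 0 < d ->
  exists L : seq ('rV[R]_m * R), [/\ forall p, p \in L -> 0 < p.2,
    forall x, box a b x -> exists2 p, p \in L & `|x - p.1| < p.2 &
    \sum_(p <- L) p.2 ^+ m <= \prod_(i < m) (b 0 i - a 0 i) + d].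
Proof.
move=> ab d0; have [h h0 hP] := prod_add_close (fun i : 'I_m => b 0 i - a 0 i) d0.
pose N i := (Num.trunc ((b 0 i - a 0 i) / h)).+1.
pose B := (\sum_(i < m) N i)%N.
have NB i : (N i <= B)%N by rewrite /B (bigD1 i)//= leq_addr.
(* The sides have different numbers of steps; a common index type makes the lattice a [family], over
   which products of sums expand. *)
pose Fm (i : 'I_m) := [pred k : 'I_B.+1 | (k < N i)%N].
pose ctr (f : {ffun 'I_m -> 'I_B.+1}) : 'rV[R]_m := \row_i (a 0 i + (nat_of_ord (f i))%:R * h).
exists [seq (ctr f, h) | f <- enum (family Fm)]; split.
- by move=> p /mapP[f _ ->].
- move=> x abx.
  pose q i := Num.trunc ((x 0 i - a 0 i) / h).
  have q0 i : 0 <= (x 0 i - a 0 i) / h.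
    by rewrite divr_ge0 ?(ltW h0)// subr_ge0; have /andP[] := abx i.
  have qN i : (q i < N i)%N.
    rewrite /q /N ltnS le_truncn// ler_wpM2r ?invr_ge0 ?(ltW h0)// lerD2r.
    by have /andP[] := abx i.
  have qB i : (q i < B.+1)%N by rewrite ltnS; apply: leq_trans (NB i); rewrite ltnW.
  pose f : {ffun 'I_m -> 'I_B.+1} := [ffun i => inord (q i)].
  exists (ctr f, h).
    apply/mapP; exists f => //; rewrite mem_enum; apply/familyP => i.
    by rewrite inE ffunE inordK.
  apply: sup_lt_coord => // i; rewrite !mxE ffunE inordK//.
  have /andP[] := truncn_itv (q0 i); rewrite -/(q i).
  rewrite ler_pdivlMr// ltr_pdivrMr// -natr1 mulrDl mul1r => h1 h2.
  rewrite /= ger0_norm; first by move: h2; clear; lra.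
  by move: h1; clear; lra.
- rewrite big_map big_enum/=.
  have -> : \sum_(f in family Fm) h ^+ m = \sum_(f in family Fm) \prod_(i < m) h.
    by apply: eq_bigr => f _; rewrite prodr_const card_ord.
  have <- : \prod_(i < m) \sum_(j | Fm i j) h = \sum_(f in family Fm) \prod_(i < m) h.
    exact: bigA_distr_big_dep.
  apply: le_trans hP; apply: ler_prod => i _; apply/andP; split.
    by apply: sumr_ge0 => j _; exact: ltW.
  rewrite -(big_ord_widen B.+1 (fun _ => h)); last by rewrite ltnW// ltnS.
  rewrite sumr_const card_ord -mulr_natl -natr1 mulrDl mul1r lerD2r -ler_pdivlMr// truncn_le.
  by rewrite divr_ge0 ?(ltW h0)// subr_ge0.
Qed.

Lemma sum_half_pow (K : nat) : \sum_(k < K) (2^-1 : R) ^+ k.+1 <= 1.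
Proof.
have -> : \sum_(k < K) (2^-1 : R) ^+ k.+1 = 1 - 2^-1 ^+ K.
  elim: K => [|K IH]; first by rewrite big_ord0 expr0 subrr.
  by rewrite big_ord_recr/= IH [2^-1 ^+ K.+1]exprS; field.
by rewrite gerBl exprn_ge0// invr_ge0.
Qed.

(** Each box is split into finitely many cubes, the k-th one with excess [e / 2 * 2^-1 ^+ k.+1];
    these excesses sum to at most [e / 2]. *)
Lemma cube_null_boxes (m : nat) (A : set 'rV[R]_m) :
  (forall e : R, 0 < e -> exists a b : nat -> 'rV[R]_m,
     [/\ forall k i, a k 0 i <= b k 0 i, A `<=` \bigcup_k box (a k) (b k) &
         forall K, \sum_(k < K) \prod_(i < m) (b k 0 i - a k 0 i) <= e]) ->
  cube_null A.
Proof.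
move=> H e e0; have e20 : 0 < e / 2 by rewrite divr_gt0.
have [a [b [ab Acov abs]]] := H _ e20.
have dk0 k : 0 < e / 2 * 2^-1 ^+ k.+1 by rewrite mulr_gt0// exprn_gt0// invr_gt0.
have [L HL] := choice (fun k => box_finite_cover (ab k) (dk0 k)).
pose I := {x : nat * nat | (x.2 < size (L x.1))%N}.
pose pr (x : nat * nat) := nth (0, 1) (L x.1) x.2.
have prL (x : I) : pr (val x) \in L (val x).1 by rewrite mem_nth// (valP x).
exists I, (fun x => (pr (val x)).1), (fun x => (pr (val x)).2); split.
- by move=> x; have [L0 _ _] := HL (val x).1; apply: L0.
- move=> x /Acov[k _ xk]; have [_ Lc _] := HL k; have [p pL xp] := Lc _ xk.
  have pk : (index p (L k) < size (L k))%N by rewrite index_mem.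
  by exists (exist _ (k, index p (L k)) pk : I); rewrite /pr /= nth_index.
- move=> s us.
  pose g (x : nat * nat) := (pr x).2 ^+ m.
  have -> : \sum_(x <- s) (pr (val x)).2 ^+ m = \sum_(x <- map val s) g x by rewrite big_map.
  set t := map val s.
  have ut : uniq t by rewrite map_inj_uniq//; exact: val_inj.
  pose K := (\max_(x <- t) x.1).+1.
  pose T := [seq (k, j) | k <- iota 0 K, j <- iota 0 (size (L k))].
  have tT : {subset t <= T}.
    move=> x xt; apply/allpairsPdep; exists x.1, x.2; split; last by case: (x).
      by rewrite mem_iota /= add0n ltnS (big_rem x xt) /= leq_maxl.
    by move: xt => /mapP[y _ ->]; rewrite mem_iota /= add0n; exact: valP y.
  have uT : uniq T.
    by apply: allpairs_uniq_dep; [exact: iota_uniq|move=> k _; exact: iota_uniq|move=> [? ?] [? ?] _ _ /= [-> ->]].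
  have g0 x : x \in T -> 0 <= g x.
    move=> /allpairsPdep[k [j [_ + ->]]]; rewrite mem_iota /= add0n => jk.
    by rewrite /g exprn_ge0//; have [L0 _ _] := HL k; apply/ltW/L0; rewrite mem_nth.
  apply: (@le_trans _ _ (\sum_(x <- T) g x)).
    rewrite [leRHS](bigID (mem t))/= -[X in _ <= X + _]big_filter.
    have -> : \sum_(x <- [seq x <- T | x \in t]) g x = \sum_(x <- t) g x.
      apply: perm_big; apply: uniq_perm => //; first by rewrite filter_uniq.
      by move=> x; rewrite mem_filter; case: (boolP (x \in t)) => //= /tT.
    by rewrite lerDl big_seq_cond; apply: sumr_ge0 => x /andP[/g0].
  have iotaE k (G : nat -> R) : \sum_(i <- iota 0 k) G i = \sum_(i < k) G i.
    by rewrite -{1}[k]subn0 -/(index_iota 0 k) big_mkord.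
  rewrite big_allpairs_dep iotaE.
  apply: (@le_trans _ _ (\sum_(k < K) (\prod_(i < m) (b k 0 i - a k 0 i) + e / 2 * 2^-1 ^+ k.+1))).
    apply: ler_sum => k _; have [_ _] := HL k; apply: le_trans.
    by rewrite iotaE (big_nth (0, 1)) big_mkord.
  rewrite big_split/= -mulr_sumr; apply: le_trans (lerD (abs K) _) _.
    by apply: (ler_wpM2l (ltW e20) (sum_half_pow K)).
  by rewrite mulr1 -splitr.
Qed.

Lemma lebesgue_null_boxes (m : nat) (A : set 'rV[R]_m) : lebesgue_null A ->
  forall e : R, 0 < e -> exists a b : nat -> 'rV[R]_m,
     [/\ forall k i, a k 0 i <= b k 0 i, A `<=` \bigcup_k box (a k) (b k) &
         forall K, \sum_(k < K) \prod_(i < m) (b k 0 i - a k 0 i) <= e].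
Proof.
move=> A0 e e0.
have : (lebesgue_outer A < e%:E)%E by rewrite A0 lte_fin.
move=> /ereal_inf_lt[s [a [b [ab Acov ->]]] se]; exists a, b; split => // K.
rewrite -lee_fin; apply: le_trans (ltW se); rewrite -sumEFin -(big_mkord xpredT (fun k => (\prod_(i < m) (b k 0 i - a k 0 i))%:E)).
apply: nneseries_lim_ge => k _ _; rewrite lee_fin; apply: prodr_ge0 => i _.
by rewrite subr_ge0.
Qed.

Lemma prod_unlift (m : nat) (k : 'I_m) (G : 'I_m -> R) :
  \prod_(i < m) G i = G k * \prod_(j < m.-1) G (lift k j).
Proof.
rewrite (bigD1 k)//=; congr (_ * _).
rewrite (reindex_omap (lift k) (unlift k)) /=.
  by apply: eq_bigl => j; rewrite eq_sym neq_lift liftK eqxx.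
by move=> i ik; case: unliftP => [j ->|E]//=; rewrite E eqxx in ik.
Qed.

(** The k-th coordinate, which a graph determines from the others, is freed here to carry the time
    of the normal flow. *)
Lemma cube_null_cylinder (m : nat) (k : 'I_m) (A : set 'rV[R]_m.-1) (T : R) : 0 < T ->
  lebesgue_null A -> cube_null [set th : 'rV[R]_m | A (col' k th) /\ 0 <= th 0 k <= T].
Proof.
move=> T0 A0; apply: cube_null_boxes => e e0.
have [a [b [ab Acov abs]]] := lebesgue_null_boxes A0 (divr_gt0 e0 T0).
pose ext (c : 'rV[R]_m.-1) (t : R) : 'rV[R]_m := \row_i (if unlift k i is Some j then c 0 j else t).
have extk c t : ext c t 0 k = t by rewrite mxE unlift_none.
have extl c t j : ext c t 0 (lift k j) = c 0 j by rewrite mxE liftK.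
exists (fun j => ext (a j) 0), (fun j => ext (b j) T); split.
- move=> j i; have [i' ->|->] := unliftP k i; first by rewrite !extl.
  by rewrite !extk ltW.
- move=> th [/Acov[j _ thj] thT]; exists j => // i.
  have [i' ->|->] := unliftP k i; last by rewrite !extk.
  by rewrite !extl; have := thj i'; rewrite mxE.
- move=> K; under eq_bigr do rewrite (prod_unlift k) !extk subr0.
  rewrite -mulr_sumr -ler_pdivlMl// mulrC; apply: le_trans (abs K).
  by apply: ler_sum => j _; apply: ler_prod => i _; rewrite !extl subr_ge0 ab lexx.
Qed.

End BoxCovers.

(** * The points on the normals over a null set of the boundary *)

Section NormalFlow.
Context {R : realType}.

Lemma lipschitz_gradient (m : nat) (V : set 'rV[R]_m) (rho : 'rV[R]_m -> R) : C11_on V rho ->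
  exists2 K : R, 0 < K & forall x y, V x -> V y -> `|gradient rho x - gradient rho y| <= K * `|x - y|.
Proof.
move=> [_ Hl].
have : \forall K \near +oo, forall i : 'I_m, forall x y, V x -> V y ->
    `|partial i rho x - partial i rho y| <= K * `|x - y|.
  apply: (@filter_forall _ _ _ (pinfty_nbhs R)) => i; have := Hl i.
  rewrite /lipschitz_on; apply: (@filterS _ (pinfty_nbhs R)) => K HK x y Vx Vy; exact: (HK (x, y)).
move=> H; have : \forall K \near +oo, 0 < K /\ forall i : 'I_m, forall x y, V x -> V y ->
    `|partial i rho x - partial i rho y| <= K * `|x - y|.
  by apply: (@filterI _ (pinfty_nbhs R)) => //; exact: nbhs_pinfty_gt.
move=> /filter_ex[K [K0 HK]]; exists K => // x y Vx Vy.
by apply: sup_le_coord => [|i]; [rewrite mulr_ge0// ltW|rewrite !mxE; exact: HK].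
Qed.

(* The points whose nearest boundary point lies in the null set F: the image of a cylinder over F
   under the Lipschitz map that flows out of the hypersurface along its normals. *)
Lemma cube_null_normal_flow (m : nat) (rho : 'rV[R]_m -> R) (V S F : set 'rV[R]_m) (T : R) :
  C11_on V rho -> F `<=` V -> F `<=` S -> compact F -> hypersurface_null S F -> 0 < T ->
  cube_null [set y | exists2 b, F b & exists2 t, 0 <= t <= T & y = b - t *: gradient rho b].
Proof.
move=> rC FV FS Fc FN T0.
have [K K0 HK] := lipschitz_gradient rC.
pose img (O : set 'rV[R]_m) := [set y | exists2 b, (F b /\ O b) &
  exists2 t, 0 <= t <= T & y = b - t *: gradient rho b].
have loc p : F p -> exists2 d : R, 0 < d & cube_null (img [set x | `|x - p| < d]).
  move=> Fp; have [U [k [W [g [Uo Up [Wo gC UW SU] Fnull]]]]] := FN p Fp.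
  have [dU dU0 HU] := nbhs_supP (open_nbhs_nbhs (conj Uo Up)).
  have [r r0 Hr] := C1_strict_diff Wo gC (UW p Up) ltr01.
  pose d := Num.min (Num.min dU r) 1.
  have d0 : 0 < d by rewrite !lt_min dU0 r0 ltr01.
  have ddU : d <= dU by rewrite !ge_min lexx.
  have dr : d <= r by rewrite !ge_min lexx orbT.
  have d1 : d <= 1 by rewrite ge_min lexx orbT.
  exists d => //.
  pose A := [set th : 'rV[R]_m | [set col' k x | x in F `&` U] (col' k th) /\ 0 <= th 0 k <= T].
  have A0 : cube_null A by exact: cube_null_cylinder.
  pose G := gradient g (col' k p).
  pose Lg := 1 + euclid_norm G * m.-1%:R.
  have Lg1 : 1 <= Lg by rewrite lerDl mulr_ge0// en_ge0.
  have Lg0 : 0 < Lg by apply: lt_le_trans Lg1.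
  pose Gm := `|gradient rho p| + K.
  have Gm0 : 0 < Gm by rewrite ltr_wpDl.
  have colk (x y : 'rV[R]_m) : `|col' k x - col' k y| <= `|x - y|.
    apply: sup_le_coord => // i; rewrite !mxE.
    by have := ler_coord_sup (x - y) (lift k i); rewrite !mxE.
  have m0 : (0 < m)%N by exact: leq_ltn_trans (leq0n k) (ltn_ord k).
  (* The variation of [b - t *: gradient rho b] comes from [b] (a graph point, constant [Lg]), from
     [t] (the gradient is at most [Gm], thanks to [d <= 1]) and from the gradient over a time at
     most [T]. *)
  apply: (@cube_null_lipschitz _ m A _ (Lg + Gm + T * (K * Lg)) 1
    (fun th y => exists b, [/\ F b, `|b - p| < d, col' k b = col' k th & y = b - th 0 k *: gradient rho b])) => //.
  - exact: addr_gt0 (addr_gt0 Lg0 Gm0) (mulr_gt0 T0 (mulr_gt0 K0 Lg0)).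
  - move=> y [b [Fb bd] [t tT ->]].
    pose th : 'rV[R]_m := \row_i (if i == k then t else b 0 i).
    have thk : th 0 k = t by rewrite mxE eqxx.
    have cth : col' k b = col' k th.
      by apply/rowP => i; rewrite !mxE eq_sym (negbTE (neq_lift _ _)).
    exists th; last by exists b; rewrite thk.
    split; last by rewrite thk.
    exists b; last exact: cth.
    by split => //; apply: HU; exact: lt_le_trans bd ddU.
  - move=> th th' y y' [_ tT] [_ tT'] [b [Fb bp bth ->]] [b' [Fb' bp' bth' ->]] _.
    have gb x : F x -> `|x - p| < d -> x 0 k = g (col' k x).
      move=> Fx xp; have Ux : U x by apply: HU; exact: lt_le_trans xp ddU.
      have : (S `&` U) x by split => //; exact: FS.
      by rewrite SU => -[].
    have cc : `|col' k b - col' k b'| <= `|th - th'| by rewrite bth bth' colk.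
    have bb : `|b - b'| <= Lg * `|th - th'|.
      apply: sup_le_coord; first by rewrite mulr_ge0// ltW.
      move=> i; have [j ->|->] := unliftP k i.
        apply: (@le_trans _ _ `|th - th'|); last by rewrite ler_peMl.
        by apply: le_trans cc; have := ler_coord_sup (col' k b - col' k b') j; rewrite !mxE.
      rewrite !mxE gb// (gb b')//.
      have h1 : `|col' k b - col' k p| < r by apply: le_lt_trans (colk _ _) _; exact: lt_le_trans bp dr.
      have h2 : `|col' k b' - col' k p| < r by apply: le_lt_trans (colk _ _) _; exact: lt_le_trans bp' dr.
      have := Hr _ _ h2 h1; rewrite mul1r -/G => h.
      have h3 : `|dot G (col' k b - col' k b')| <= euclid_norm G * m.-1%:R * `|col' k b - col' k b'|.
        apply: le_trans (cauchy_schwarz_abs _ _) _.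
        by rewrite -mulrA ler_wpM2l ?en_ge0// en_le_sup.
      rewrite -(subrK (dot G (col' k b - col' k b')) (_ - _)).
      apply: le_trans (ler_normD _ _) _; apply: le_trans (lerD h h3) _.
      rewrite -[X in X + _ <= _]mul1r -mulrDl -/Lg.
      by rewrite ler_wpM2l ?(ltW Lg0).
    have tt : `|th 0 k - th' 0 k| <= `|th - th'|.
      by have := ler_coord_sup (th - th') k; rewrite !mxE.
    have Vb := FV _ Fb; have Vb' := FV _ Fb'; have Vp := FV _ Fp.
    have gG : `|gradient rho b| <= Gm.
      rewrite -(subrK (gradient rho p) (gradient rho b)) addrC.
      apply: le_trans (ler_normD _ _) _; rewrite lerD2l.
      apply: le_trans (HK _ _ Vb Vp) _; rewrite ger_pMr//.
      by apply: le_trans (ltW bp) d1.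
    have -> : b - th 0 k *: gradient rho b - (b' - th' 0 k *: gradient rho b') =
       (b - b') - (th 0 k - th' 0 k) *: gradient rho b - th' 0 k *: (gradient rho b - gradient rho b').
      by apply/rowP => i; rewrite !mxE; ring.
    apply: le_trans (ler_normB _ _) _; rewrite mulrDl; apply: lerD.
      apply: le_trans (ler_normB _ _) _; rewrite mulrDl; apply: lerD => //.
      by rewrite normrZ mulrC ler_pM.
    move: tT' => /andP[t0 tT']; rewrite normrZ ger0_norm// -mulrA ler_pM//.
    apply: le_trans (HK _ _ Vb Vb') _; rewrite -mulrA ler_wpM2l ?(ltW K0)//.
(* [choice] asks for a radius at every point; off [F] the value 0 is a dummy. *)
have loc' p : exists d : R, F p -> 0 < d /\ cube_null (img [set x | `|x - p| < d]).
  have [Fp|nFp] := pselect (F p); last by exists 0.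
  by have [d d0 Hd] := loc p Fp; exists d.
have [d Hd] := choice loc'.
move: Fc; rewrite compact_cover => /(_ _ F (fun p => [set x | `|x - p| < d p])).
case.
- move=> p Fp.
  have -> : [set x | `|x - p| < d p] = (fun x => `|x - p|) @^-1` [set t | t < d p] by [].
  apply: open_comp; last exact: open_lt.
  move=> x _; apply: (@lip_continuous _ _ _ 1) => a b; rewrite mul1r.
  by apply: le_trans (ler_dist_dist _ _) _; rewrite opprB addrA subrK.
- by move=> p Fp; exists p => //=; rewrite subrr normr0; case: (Hd p Fp).
move=> D DF Dcov.
pose B p := if pselect (F p) is left _ then img [set x | `|x - p| < d p] else set0.
apply: (@cube_null_sub _ _ _ (\big[setU/set0]_(p <- enum_fset D) B p)); last first.
  apply: cube_null_bigcup_seq => p; rewrite /B; case: pselect => [Fp|_]; last exact: cube_null0.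
  by case: (Hd p Fp).
move=> y [b Fb [t tT yE]]; have [p pD bp] := Dcov b Fb.
rewrite -bigcup_seq; exists p => //; rewrite /B.
case: pselect => [Fp|nFp]; first by exists b => //; exists t.
by exfalso; apply: nFp; have := DF _ pD; rewrite inE.
Qed.

End NormalFlow.

(** * Jensen's lemma on contact points *)

Section ContactPoints.
Context {R : realType}.

(* Jensen's lemma for semiconvex functions: on the set of points where G is touched from above by
   the affine functions of slope p, |p| small, the slope is a Lipschitz function of the point, and
   these slopes fill a cube; hence the contact points cannot all lie in a null set. *)
Lemma contact_point_outside_null (m : nat) (K Z : set 'rV[R]_m) (G : 'rV[R]_m -> R) (x0 : 'rV[R]_m)
    (eta C : R) :
  (0 < m)%N -> compact K -> {in K, continuous G} -> K x0 -> 0 < eta -> 0 < C ->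
  (forall x, K x -> G x0 - eta <= G x -> nbhs x K) ->
  (forall x, K x -> exists xi, forall x', K x' ->
     G x + dot xi (x' - x) - C * `|x' - x| ^+ 2 <= G x') ->
  cube_null Z ->
  exists x p, [/\ K x, ~ Z x, G x0 - eta <= G x &
    forall x', K x' -> G x' <= G x + dot p (x' - x)].
Proof.
move=> m0 Kc Gc Kx0 eta0 C0 Kint Gconv Z0.
have [M M0 HM] : exists2 M : R, 0 < M & forall x, K x -> `|x - x0| <= M.
  have Kb : bounded_set K by exact: compact_bounded.
  have [B [_ HB]] := Kb.
  exists (`|B| + 1 + `|x0|); first by rewrite ltr_wpDr// ltr_wpDl.
  move=> x Kx; apply: le_trans (ler_normB _ _) _; rewrite lerD2r.
  by apply: (HB (`|B| + 1)) => //; rewrite (le_lt_trans (ler_norm B))// ltrDl.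
have mm0 : 0 < m%:R * m%:R * M :> R by rewrite !mulr_gt0// ltr0n.
(* Keeps the linear perturbation below [eta / 2] on [K]; the factors [m%:R] compare the Euclidean
   and sup norms of both arguments. *)
pose pmax := eta / 2 / (m%:R * m%:R * M).
have pmax0 : 0 < pmax by rewrite !divr_gt0.
have contact p : `|p| <= pmax -> exists x, [/\ K x, G x0 - eta <= G x &
    forall x', K x' -> G x' <= G x + dot p (x' - x)].
  move=> pp.
  have Hc : {in K, continuous (fun x => G x - dot x p)}.
    move=> x xK; apply: (@cvgB _ _ _ (nbhs x) _ G (fun x => dot x p) (G x) (dot x p)).
      exact: Gc.
    exact: continuous_dotl.
  have [x /set_mem Kx Hx] := compact_EVT_max (ex_intro _ _ Kx0) Kc (continuous_in_subspaceT Hc).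
  have Hx' x' : K x' -> G x' - dot x' p <= G x - dot x p by move=> Kx'; apply: Hx; rewrite inE.
  exists x; split => //.
    have dp y : K y -> `|dot p (y - x0)| <= eta / 2.
      move=> Ky; apply: le_trans (cauchy_schwarz_abs _ _) _.
      apply: (@le_trans _ _ ((m%:R * pmax) * (m%:R * M))).
        apply: ler_pM; rewrite ?en_ge0//; apply: le_trans (en_le_sup _) _; rewrite ler_wpM2l//.
        exact: HM.
      rewrite (_ : _ * _ = pmax * (m%:R * m%:R * M)); last by ring.
      by rewrite /pmax divfK// gt_eqF.
    have := Hx' x0 Kx0; have := dp x Kx; rewrite ler_norml dotDr dotNr (dotC p) (dotC p x0).
    by move=> /andP[h1 h2] h3; move: h1 h3 eta0; clear; lra.
  move=> x' Kx'; have := Hx' x' Kx'; rewrite dotDr dotNr (dotC p) (dotC p x); clear; lra.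
apply: contrapT => Hno.
pose K1 := [set x | K x /\ G x0 - eta <= G x].
have K1c : compact K1.
  have -> : K1 = K `&` [set x | K x -> G x0 - eta <= G x].
    by apply/seteqP; split => x [h1 h2]; split => //; exact: h2.
  have Kcl : closed K by apply: compact_closed => //; exact: norm_hausdorff.
  apply: (subclosed_compact _ Kc); last by move=> x [].
  have -> : K `&` [set x | K x -> G x0 - eta <= G x] = K `&` G @^-1` [set t | G x0 - eta <= t].
    by apply/seteqP; split => x [h1 h2]; split => //; exact: h2.
  move=> x xcl.
  have Kx : K x by apply: Kcl => B /xcl[y [[Ky _] By]]; exists y.
  split => //=.
  rewrite leNgt; apply/negP => Gx.
  have /continuous_supP/(_ (G x0 - eta - G x)) : {for x, continuous G} by apply: Gc; rewrite inE.
  rewrite subr_gt0 => /(_ Gx)[d d0 Hd].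
  have [y [[Ky Gy] xy]] := xcl _ (nbhs_sup d0 (fun y h => h)).
  have := Hd y xy; rewrite ltr_norml => /andP[_]; rewrite /= in Gy; move: Gy; clear; lra.
(* Points at the levels where contact occurs are interior to [K]; compactness gives them a common
   margin. *)
have [r r0 Hr] : exists2 r : R, 0 < r & forall x v, K1 x -> `|v| < r -> K (x + v).
  by apply: (@compact_tube _ _ _ K1 id K K1c) => [x|x [Kx Gx]]; [exact: cvg_id|exact: Kint].
pose rel (x p : 'rV[R]_m) := K1 x /\ forall x', K x' -> G x' <= G x + dot p (x' - x).
(* The supporting paraboloid and the touching hyperplane enclose [G] near [x], so their slopes
   agree, as a test along [- (p - xi)] shows. *)
have slope x p : rel x p -> forall v, `|v| < r -> G x + dot p v - C * `|v| ^+ 2 <= G (x + v).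
  move=> [K1x Hp].
  have [xi Hxi] := Gconv x K1x.1.
  have low v : `|v| < r -> G x + dot xi v - C * `|v| ^+ 2 <= G (x + v).
    by move=> vr; have := Hxi _ (Hr _ _ K1x vr); rewrite [x + v - x]addrAC subrr add0r.
  have up v : `|v| < r -> G (x + v) <= G x + dot p v.
    by move=> vr; have := Hp _ (Hr _ _ K1x vr); rewrite [x + v - x]addrAC subrr add0r.
  suff -> : p = xi by [].
  apply/eqP; rewrite -subr_eq0; apply/eqP; apply: dot_eq0; apply/eqP.
  rewrite eq_le dot_ge0 andbT leNgt; apply/negP => q0.
  set q := p - xi in q0.
  have q1 : 0 < `|q| ^+ 2 + 1 by rewrite ltr_wpDl// sqr_ge0.
  have q2 : 0 < `|q| + 1 by rewrite ltr_wpDl.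
  pose s := Num.min (r / (`|q| + 1)) (dot q q / C / (`|q| ^+ 2 + 1)).
  have s0 : 0 < s by rewrite lt_min (divr_gt0 r0 q2) !divr_gt0.
  have s1 : s * (`|q| + 1) <= r by rewrite -ler_pdivlMr// ge_min lexx.
  have s2 : s * (`|q| ^+ 2 + 1) <= dot q q / C by rewrite -ler_pdivlMr// ge_min lexx orbT.
  have sr : `|- (s *: q)| < r.
    by rewrite normrN normrZ gtr0_norm//; apply: lt_le_trans s1; rewrite ltr_pM2l// ltrDl.
  have := le_trans (low _ sr) (up _ sr).
  rewrite normrN normrZ (gtr0_norm s0) exprMn !dotNr !dotZr => h.
  have : s * dot q q <= s * (C * (s * `|q| ^+ 2)).
    by rewrite {1}/q dotDl dotNl; move: h; clear; lra.
  rewrite ler_pM2l// -ler_pdivrMl// mulrC => h2.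
  have := le_trans s2 h2; rewrite mulrDr mulr1 gerDl => h3.
  by move: s0; rewrite ltNge h3.
have lip x x' p p' : rel x p -> rel x' p' -> `|x - x'| < r ->
    `|p - p'| <= 2 * C * `|x - x'|.
  move=> rx rx' xx.
  have [K1x Hp] := rx; have [K1x' Hp'] := rx'.
  (* Compare at [x + v] the paraboloid from [x] with the hyperplane from [x'], and at [x] the
     paraboloid from [x'] with [G x]: this gives [dot (p - p') v <= 2 * C * h ^+ 2]. Then [v] is
     taken of length [h] along the i-th axis. *)
  have key i (h : R) : 0 < h -> h < r -> `|x - x'| <= h -> `|(p - p') 0 i| <= 2 * C * h.
    move=> h0 hr xh.
    have [qi|qi] := eqVneq ((p - p') 0 i) 0.
      by rewrite qi normr0 !mulr_ge0// ltW.
    pose v : 'rV[R]_m := (h * Num.sg ((p - p') 0 i)) *: delta_mx 0 i.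
    have vh : `|v| <= h.
      apply: le_trans (sup_le_en _) _; rewrite enZ en_delta mulr1 normrM normr_sg qi mulr1.
      by rewrite gtr0_norm.
    have vr : `|v| < r by exact: le_lt_trans hr.
    have e1 := slope _ _ rx v vr.
    have e2 := Hp' _ (Hr _ _ K1x vr).
    have e3 := slope _ _ rx' (x - x') xx.
    have -> : `|(p - p') 0 i| = dot (p - p') v / h.
      rewrite /v dotZr dot_delta normrEsg; field; by rewrite gt_eqF.
    rewrite ler_pdivrMr//.
    have e4 : C * `|v| ^+ 2 <= C * h ^+ 2.
      by rewrite ler_wpM2l ?(ltW C0)// ler_pXn2r// nnegrE// ltW.
    have e5 : C * `|x - x'| ^+ 2 <= C * h ^+ 2.
      by rewrite ler_wpM2l ?(ltW C0)// ler_pXn2r// nnegrE// ltW.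
    have e7 : x' + (x - x') = x by rewrite addrC subrK.
    rewrite e7 in e3.
    have e6 : x + v - x' = (x - x') + v by rewrite addrAC.
    rewrite e6 dotDr in e2.
    rewrite dotDl dotNl.
    move: e1 e2 e3 e4 e5; move: (dot p v) (dot p' v) (dot p' _) (G x) (G x') (G (x + v)); clear; move=> *.
    by nra.
  apply: sup_le_coord; first by rewrite !mulr_ge0// ltW.
  move=> i; have [xx0|xx0] := ltP 0 `|x - x'|; first exact: key.
  have {xx0} xE : `|x - x'| = 0 by apply/le_anti; rewrite xx0 normr_ge0.
  rewrite xE mulr0 leNgt; apply/negP => pi0.
  (* At coinciding points [key] holds for all small [h]; this one would bound the difference by half
     of itself. *)
  pose h := Num.min (r / 2) (`|(p - p') 0 i| / (4 * C)).
  have C40 : 0 < 4 * C by rewrite mulr_gt0.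
  have h0 : 0 < h by rewrite lt_min !divr_gt0.
  have hr : h < r by rewrite gt_min ltr_pdivrMr// ltr_pMr// ltr1n.
  have hC : h * (4 * C) <= `|(p - p') 0 i| by rewrite -ler_pdivlMr// ge_min lexx orbT.
  have := key i h h0 hr; rewrite xE => /(_ (ltW h0)) k1.
  have : 0 < h * C by rewrite mulr_gt0.
  by move: k1 hC; clear; lra.
apply: (cube_not_null m0 pmax0).
apply: (@cube_null_lipschitz _ m Z _ (2 * C) r (fun x p => rel x p)) => //.
- by rewrite mulr_gt0.
- move=> p pp; have [x [Kx Gx Hx]] := contact p pp.
  exists x; last by [].
  by apply: contrapT => nZ; apply: Hno; exists x, p.
- by move=> x x' p p' _ _; exact: lip.
Qed.

End ContactPoints.

(** * Riemann sums over a circle *)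

Section RiemannSums.
Context {R : realType}.
Local Notation mu := (@lebesgue_measure R).

Lemma lip1_continuous (f : R -> R) (L : R) : (forall s t, `|f s - f t| <= L * `|s - t|) -> continuous f.
Proof.
move=> H x; apply/(@cvgrPdist_lt _ _ _ (nbhs x)) => e e0.
have L1 : 0 < `|L| + 1 by rewrite ltr_wpDl.
apply/nbhs_ballP; exists (e / (`|L| + 1)) => /=; first by rewrite divr_gt0.
move=> y; rewrite /ball /= ltr_pdivlMr// mulrC => yx; apply: le_lt_trans (H _ _) _.
by apply: le_lt_trans yx; rewrite ler_wpM2r// (le_trans (ler_norm _))// lerDl.
Qed.

Lemma antiderivative (f : R -> R) (a : R) : continuous f ->
  exists F : R -> R, forall x, a < x -> is_derive x 1 F (f x).
Proof.
move=> fc; exists (fun x => \int[mu]_(t in `[a, x]) f t) => x ax.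
have xu : x < x + 1 by rewrite ltrDl.
have fi : mu.-integrable `[a, x + 1] (EFin \o f).
  by apply: continuous_compact_integrable; [exact: segment_compact|exact: continuous_subspaceT].
have [d e] := continuous_FTC1_closed xu fi ax (fc x).
by split; [exact: d|rewrite -derive1E; exact: e].
Qed.

(** The mean value theorem for an antiderivative costs at most [L * h * h] per step. The steps cover
    one period starting at [th], over which the integral equals that over [[0, 2 pi]]. *)
Lemma riemann_sum_circle (f : R -> R) (L : R) (N : nat) (th h : R) : (0 < N)%N -> h = 2 * pi / N%:R ->
  (forall s t, `|f s - f t| <= L * `|s - t|) -> (forall t, f (t + 2 * pi) = f t) ->
  0 <= th ->
  h * \sum_(k < N) f (th + k%:R * h) <= \int[mu]_(t in `[0, 2 * pi]) f t + L * h * (2 * pi).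
Proof.
move=> N0 hE fL f2pi th0.
have pi20 : 0 < 2 * pi :> R by rewrite mulr_gt0// pi_gt0.
have N0' : 0 < N%:R :> R by rewrite ltr0n.
have h0 : 0 < h by rewrite hE divr_gt0.
have hN : N%:R * h = 2 * pi by rewrite hE mulrC divfK// gt_eqF.
have fc : continuous f by exact: lip1_continuous fL.
(* Starting at -1 gives a two-sided derivative at 0. *)
have [F FD] := antiderivative (-1) fc.
have FD0 (x : R) : 0 <= x -> is_derive x 1 F (f x).
  by move=> x0; apply: FD; apply: lt_le_trans x0; rewrite ltrN10.
have Fc (x : R) : 0 <= x -> {for x, continuous F}.
  move=> /FD0 Fx; apply: differentiable_continuous; apply/derivable1_diffP.
  by have [] := Fx.
have int : \int[mu]_(t in `[0, 2 * pi]) f t = F (2 * pi) - F 0.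
  rewrite /Rintegral (@continuous_FTC2 _ f F 0 (2 * pi))//.
  - exact: continuous_subspaceT.
  - split.
    + by move=> x; rewrite in_itv/= => /andP[/ltW/FD0[]].
    + by apply: cvg_at_right_filter; exact: Fc.
    + by apply: cvg_at_left_filter; apply: Fc; exact: ltW.
  - by move=> x; rewrite in_itv/= => /andP[/ltW/FD0 Fx _]; rewrite derive1E derive_val.
have per : F (th + 2 * pi) - F th = F (2 * pi) - F 0.
  pose G (t : R) := F (t + 2 * pi) - F t.
  have GD (t : R) : 0 <= t -> is_derive t 1 G 0.
    move=> t0.
    have t1 : 0 <= t + 2 * pi by rewrite addr_ge0// ltW.
    have F1 := FD0 _ t0; have F2 := FD0 _ t1.
    have sh : is_derive t 1 (fun t : R => t + 2 * pi) 1.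
      by apply: is_derive_eq; rewrite addr0.
    have := @is_derive1_comp _ F (fun t : R => t + 2 * pi) t (f (t + 2 * pi)) 1.
    move=> /(_ F2 sh) F3.
    by rewrite /G; apply: is_derive_eq; rewrite f2pi mulr1 subrr.
  have Gd (x : R) : x \in `]0, th[ -> is_derive x 1 G ((fun=> 0) x).
    by rewrite in_itv/= => /andP[/ltW x0 _]; exact: GD.
  have Gc : {within `[0, th], continuous G}.
    apply: continuous_in_subspaceT => x; rewrite inE/= in_itv/= => /andP[x0 _].
    apply: differentiable_continuous; apply/derivable1_diffP.
    by have [] := GD x x0.
  have [c _] := MVT_segment th0 Gd Gc.
  by rewrite mul0r /G add0r => /eqP; rewrite subr_eq0 => /eqP.
have step k : h * f (th + k%:R * h) <= F (th + k.+1%:R * h) - F (th + k%:R * h) + L * h * h.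
  have k0 : 0 <= th + k%:R * h by rewrite addr_ge0// mulr_ge0// ltW.
  have kk : th + k%:R * h <= th + k.+1%:R * h by rewrite lerD2l ler_wpM2r ?(ltW h0)// ler_nat.
  have Fd (x : R) : x \in `]th + k%:R * h, th + k.+1%:R * h[ -> is_derive x 1 F (f x).
    by rewrite in_itv/= => /andP[kx _]; apply: FD0; exact: le_trans (ltW kx).
  have Fc' : {within `[th + k%:R * h, th + k.+1%:R * h], continuous F}.
    apply: continuous_in_subspaceT => x; rewrite inE/= in_itv/= => /andP[kx _].
    by apply: Fc; exact: le_trans kx.
  have [c] := MVT_segment kk Fd Fc'.
    rewrite in_itv/= => /andP[c1 c2] ->.
    have E : th + k.+1%:R * h - (th + k%:R * h) = h by rewrite -natr1; ring.
    rewrite E mulrC -mulrDl ler_wpM2r ?(ltW h0)//.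
    have := fL (th + k%:R * h) c; rewrite ler_norml => /andP[_ h1].
    have h2 : L * `|th + k%:R * h - c| <= L * h.
      have L0 : 0 <= L.
        have := fL 0 1; rewrite sub0r normrN normr1 mulr1; exact: le_trans.
      rewrite ler_wpM2l// distrC ger0_norm ?subr_ge0// lerBlDl.
      by apply: le_trans c2 _; rewrite -natr1; lra.
    by move: h1 h2; clear; lra.
rewrite mulr_sumr; apply: le_trans (ler_sum _ (fun (k : 'I_N) _ => step k)) _.
rewrite big_split/= sumr_const card_ord.
have -> : \sum_(k < N) (F (th + k.+1%:R * h) - F (th + k%:R * h)) = F (2 * pi) - F 0.
  have := telescope_sumr (fun k => F (th + k%:R * h)) (leq0n N).
  by rewrite big_mkord /= mul0r addr0 hN per.
by rewrite int lerD2l -(mulr_natl (L * h * h)) -hN; rewrite le_eqVlt; apply/orP; left; apply/eqP; ring.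
Qed.

Lemma cos_lip (s t : R) : `|cos s - cos t| <= `|s - t|.
Proof.
wlog st : s t / t <= s.
  move=> H; have [st|/ltW ts] := leP t s; first exact: H.
  by rewrite distrC (distrC s); exact: H.
have D (x : R) : x \in `]t, s[ -> is_derive x 1 cos ((fun x => - sin x) x) by move=> _; exact: is_derive_cos.
have [|c _ ->] := MVT_segment st D; first by apply: continuous_subspaceT; exact: continuous_cos.
by rewrite normrM normrN ler_piMl// ler_norml sin_geN1 sin_le1.
Qed.

Lemma sin_lip (s t : R) : `|sin s - sin t| <= `|s - t|.
Proof.
wlog st : s t / t <= s.
  move=> H; have [st|/ltW ts] := leP t s; first exact: H.
  by rewrite distrC (distrC s); exact: H.
have D (x : R) : x \in `]t, s[ -> is_derive x 1 sin (cos x) by move=> _; exact: is_derive_sin.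
have [|c _ ->] := MVT_segment st D; first by apply: continuous_subspaceT; exact: continuous_sin.
by rewrite normrM ler_piMl// ler_norml cos_geN1 cos_le1.
Qed.

Lemma polar_angle (s t : R) : s ^+ 2 + t ^+ 2 = 1 -> exists2 th, 0 <= th & s = cos th /\ t = sin th.
Proof.
move=> st.
have s1 : -1 <= s <= 1.
  rewrite -ler_norml -(@ler_pXn2r _ 2) ?nnegrE// expr1n real_normK ?num_real// -st lerDl sqr_ge0//.
have s2 : 1 - s ^+ 2 = t ^+ 2 by rewrite -st; ring.
have [t0|t0] := leP 0 t.
  exists (acos s); first exact: acos_ge0.
  by rewrite acosK ?inE// sin_acos// s2 sqrtr_sqr ger0_norm.
(* Not [- acos s]: the Riemann sums start at a nonnegative angle. *)
exists (2 * pi - acos s).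
  rewrite subr_ge0; apply: le_trans (acos_lepi s1) _.
  by rewrite ler_peMl ?pi_ge0// ler1n.
have E : 2 * pi - acos s = - acos s + pi *+ 2 by rewrite addrC mulr_natl.
rewrite E cosD2pi sinD2pi cosN sinN acosK ?inE// sin_acos// s2 sqrtr_sqr ltr0_norm//.
by rewrite opprK.
Qed.

End RiemannSums.

(** * Plurisubharmonicity from discrete circle means *)

Section DiscreteMeans.
Context {R : realType} {n : nat}.
Local Notation Cn := ('rV[R]_(n + n)).

Definition rot (N k : nat) (x : Cn) : Cn :=
  cscl (cos (k%:R * (2 * pi / N%:R))) (sin (k%:R * (2 * pi / N%:R))) x.

(** If a circle mean falls short of [u z] by [gap], the Lipschitz bound makes all N-point means fall
    short by [gap / 2], with the same [N] for every starting point on the circle. This uniformity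
    makes the sum over rotations small on the whole edge of the disc. *)
Lemma plurisubharmonic_discrete (D : set Cn) (u : Cn -> R) : {in D, continuous u} ->
  (forall z w, (forall s t, s ^+ 2 + t ^+ 2 <= 1 -> D (z + cscl s t w)) ->
     exists2 L : R, 0 < L & forall x y : Cn, (exists s t, s ^+ 2 + t ^+ 2 = 1 /\ x = cscl s t w) ->
        (exists s t, s ^+ 2 + t ^+ 2 = 1 /\ y = cscl s t w) -> `|u (z + x) - u (z + y)| <= L * `|x - y|) ->
  (forall z w (N : nat) (eta : R), (0 < N)%N -> 0 < eta ->
     (forall s t, s ^+ 2 + t ^+ 2 <= 1 -> D (z + cscl s t w)) ->
     (forall s t, s ^+ 2 + t ^+ 2 = 1 ->
        \sum_(k < N) u (z + rot N k (cscl s t w)) <= N%:R * (u z - eta)) -> False) ->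
  plurisubharmonic D u.
Proof.
move=> uc ulip H; split.
  move=> z Dz c uzc.
  have /(@cvgrPdist_lt _ _ _ (nbhs z))/(_ (c - u z)) : {for z, continuous u} by apply: uc; rewrite inE.
  rewrite subr_gt0 => /(_ uzc); apply: filterS => x.
  by rewrite distrC ltr_norml => /andP[_]; rewrite ltrD2r.
move=> z w Dw'.
have Dw s t : s ^+ 2 + t ^+ 2 <= 1 -> D (z + cscl s t w).
  by move=> st; have := Dw' (Complex s t); rewrite normc_le1 complex_scaleE; exact.
have pi20 : 0 < 2 * pi :> R by rewrite mulr_gt0// pi_gt0.
have Dc t : D (circle z w t) by apply: Dw; rewrite cos2Dsin2.
have ug := circle_comp_continuous uc Dc.
have ui : lebesgue_measure.-integrable `[0, 2 * pi] (EFin \o (u \o circle z w)).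
  by apply: continuous_compact_integrable; [exact: segment_compact|exact: continuous_subspaceT].
under eq_integral do rewrite complex_scaleE/=.
rewrite -[X in (_ * X)%E](@fineK _ _ _); last exact: (integrable_fin_num _ ui).
rewrite -EFinM lee_fin ler_pdivlMl//.
set I := fine _; rewrite leNgt; apply/negP => Iu.
have [L L0 HL] := ulip z w Dw.
pose f := u \o circle z w.
pose W := 2 * euclid_norm w + 1.
have W0 : 0 < W by rewrite ltr_wpDl// mulr_ge0// en_ge0.
have fL s t : `|f s - f t| <= L * W * `|s - t|.
  rewrite /f /= /circle; apply: le_trans (HL _ _ _ _) _.
  - by exists (cos s), (sin s); rewrite cos2Dsin2.
  - by exists (cos t), (sin t); rewrite cos2Dsin2.
  rewrite -mulrA ler_wpM2l ?(ltW L0)//.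
  have -> : cscl (cos s) (sin s) w - cscl (cos t) (sin t) w =
     (cos s - cos t) *: w + (sin s - sin t) *: mulI w.
    rewrite /cscl; move: (mulI w) => w'; apply/rowP => i; rewrite !mxE; ring.
  apply: le_trans (ler_normD _ _) _; rewrite !normrZ.
  apply: (@le_trans _ _ (`|s - t| * euclid_norm w + `|s - t| * euclid_norm w)).
    apply: lerD; apply: ler_pM => //; rewrite ?cos_lip ?sin_lip ?sup_le_en//.
    by rewrite -(en_mulI w) sup_le_en.
  rewrite -mulrDr mulrC ler_wpM2r// /W; have := en_ge0 w; lra.
have fp t : f (t + 2 * pi) = f t.
  by rewrite /f /= /circle mulr_natl cosD2pi sinD2pi.
pose gap := u z - I / (2 * pi).
have gap0 : 0 < gap by rewrite subr_gt0 ltr_pdivrMr// mulrC.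
have LW : 0 < L * W by rewrite mulr_gt0.
pose N := (Num.trunc (2 * pi * (L * W) / (gap / 2))).+1.
have N0 : 0 < N%:R :> R by rewrite ltr0n.
have NL : L * W * (2 * pi / N%:R) <= gap / 2.
  have : 2 * pi * (L * W) / (gap / 2) < N%:R by exact: truncnS_gt.
  rewrite ltr_pdivrMr ?divr_gt0// => h.
  rewrite (_ : L * W * (2 * pi / N%:R) = 2 * pi * (L * W) / N%:R); last by ring.
  by rewrite ler_pdivrMr// [leRHS]mulrC ltW.
apply: (H z w N (gap / 2)) => //; first by rewrite divr_gt0.
move=> s t st; have [th th0 [-> ->]] := polar_angle st.
have RS := riemann_sum_circle (ltn0Sn _ : (0 < N)%N) erefl fL fp th0.
have -> : \sum_(k < N) u (z + rot N k (cscl (cos th) (sin th) w)) =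
   \sum_(k < N) f (th + k%:R * (2 * pi / N%:R)).
  apply: eq_bigr => k _; rewrite /rot csclM /f /= /circle cosD sinD; congr (u (z + cscl _ _ w)).
    by rewrite mulrC [sin _ * _]mulrC.
  by rewrite [cos _ * sin th]mulrC [sin _ * cos th]mulrC addrC.
have IE : \int[lebesgue_measure]_(t in `[0, 2 * pi]) f t = I by [].
rewrite IE in RS.
have h0 : 0 < 2 * pi / N%:R :> R by rewrite divr_gt0.
rewrite -(ler_pM2l h0); apply: le_trans RS _.
have -> : 2 * pi / N%:R * (N%:R * (u z - gap / 2)) = 2 * pi * u z - gap / 2 * (2 * pi).
  by field; rewrite gt_eqF.
have -> : I = 2 * pi * (u z - gap) by rewrite /gap opprB addrC subrK mulrC divfK// gt_eqF.
have := ler_wpM2r (ltW pi20) NL; clear; lra.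
Qed.

End DiscreteMeans.

(** * Semiconvex functions *)

Section Semiconvexity.
Context {R : realType} {m : nat}.
Implicit Types (K : set 'rV[R]_m) (f g : 'rV[R]_m -> R).

Lemma lip_map_continuous (h : 'rV[R]_m -> 'rV[R]_m) (C : R) : 0 <= C ->
  (forall x y, `|h x - h y| <= C * `|x - y|) -> continuous h.
Proof.
move=> C0 H x; apply/(@cvgrPdist_lt _ _ _ (nbhs x)) => e e0; apply: (@nbhs_sup _ _ _ _ (e / (C + 1))).
  by rewrite divr_gt0// ltr_wpDl.
move=> y; rewrite ltr_pdivlMr ?ltr_wpDl// distrC => h'.
apply: le_lt_trans (H _ _) (le_lt_trans _ h').
by rewrite mulrC ler_wpM2l// lerDl.
Qed.

(** Supporting paraboloids of fixed opening stand for convexity of f + C |x|^2; they make sense on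
    any [K] and add up. *)
Definition semiconvex_on K f (C : R) : Prop :=
  forall x, K x -> exists xi, forall x', K x' -> f x + dot xi (x' - x) - C * `|x' - x| ^+ 2 <= f x'.

Lemma semiconvex_onD K f g C C' : semiconvex_on K f C -> semiconvex_on K g C' ->
  semiconvex_on K (fun x => f x + g x) (C + C').
Proof.
move=> Hf Hg x Kx; have [xi Hxi] := Hf x Kx; have [xi' Hxi'] := Hg x Kx.
exists (xi + xi') => x' Kx'; rewrite dotDl mulrDl.
by move: (Hxi x' Kx') (Hxi' x' Kx'); clear; lra.
Qed.

Lemma semiconvex_on_sum K (f : nat -> 'rV[R]_m -> R) C (N : nat) :
  (forall k, semiconvex_on K (f k) C) ->
  semiconvex_on K (fun x => \sum_(k < N) f k x) (N%:R * C).
Proof.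
move=> Hf; elim: N => [|N IH] x Kx.
  by exists 0 => x' _; rewrite !big_ord0 dot0l !mul0r addr0 subr0.
have [xi Hxi] := semiconvex_onD IH (Hf N) Kx; exists xi => x' Kx'.
by rewrite !big_ord_recr/= -natr1 mulrDl mul1r; exact: Hxi.
Qed.

Lemma linear_form_dot (phi : 'rV[R]_m -> R) : (forall x y, phi (x + y) = phi x + phi y) ->
  (forall a x, phi (a *: x) = a * phi x) -> exists xi, forall x, phi x = dot xi x.
Proof.
move=> phiD phiZ; exists (\row_i phi (delta_mx 0 i)) => x.
have phi0 : phi 0 = 0 by rewrite -(scale0r 0) phiZ mul0r.
rewrite {1}(row_sum_delta x) (big_morph phi phiD phi0); apply: eq_bigr => i _.
by rewrite phiZ mxE mulrC.
Qed.

Section LinearMap.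
Variable A : 'rV[R]_m -> 'rV[R]_m.
Hypotheses (AD : forall x y, A (x + y) = A x + A y) (AZ : forall a x, A (a *: x) = a *: A x)
  (A1 : forall x, euclid_norm (A x) <= euclid_norm x).

Let AB x y : A (x - y) = A x - A y.
Proof. by rewrite AD -scaleN1r AZ scaleN1r. Qed.

Lemma linear_contraction_sup x : `|A x| <= m%:R * `|x|.
Proof. exact: le_trans (sup_le_en _) (le_trans (A1 x) (en_le_sup x)). Qed.

Lemma semiconvex_on_comp K K1 f z C : 0 <= C -> (forall x, K x -> K1 (z + A (x - z))) ->
  semiconvex_on K1 f C -> semiconvex_on K (fun x => f (z + A (x - z))) (C * m%:R ^+ 2).
Proof.
move=> C0 AK Hf x Kx; have [xi Hxi] := Hf _ (AK x Kx).
have [xi' Hxi'] : exists xi', forall y, dot xi (A y) = dot xi' y.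
  by apply: linear_form_dot => *; rewrite ?AD ?AZ dotE.
exists xi' => x' Kx'; have := Hxi _ (AK x' Kx').
have -> : z + A (x' - z) - (z + A (x - z)) = A (x' - x).
  by rewrite opprD addrACA subrr add0r -AB opprB addrA subrK.
rewrite Hxi'; apply: le_trans; rewrite lerD2l lerN2 -mulrA ler_wpM2l// -exprMn.
by rewrite ler_pXn2r ?nnegrE ?mulr_ge0// linear_contraction_sup.
Qed.

(** The second-order expansion of a square is exact, so either sign of [c] is allowed. *)
Lemma semiconvex_on_square K z (c : R) :
  semiconvex_on K (fun x => c * dot (A (x - z)) (A (x - z))) (`|c| * m%:R ^+ 2).
Proof.
move=> x Kx.
have [xi Hxi] : exists xi, forall y, 2 * c * dot (A (x - z)) (A y) = dot xi y.
  by apply: linear_form_dot => *; rewrite ?AD ?AZ ?dotDr ?dotZr; ring.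
exists xi => x' Kx'; rewrite -Hxi.
have -> : A (x' - z) = A (x - z) + A (x' - x) by rewrite -AD; congr (A _); apply/rowP => i; rewrite !mxE; ring.
set p := A (x - z); set q := A (x' - x).
rewrite dotDl !dotDr [dot q p]dotC.
have h : `|c * dot q q| <= `|c| * m%:R ^+ 2 * `|x' - x| ^+ 2.
  rewrite normrM -mulrA ler_wpM2l// -exprMn -en_sq ger0_norm ?sqr_ge0//.
  rewrite ler_pXn2r ?nnegrE ?mulr_ge0 ?en_ge0//; exact: le_trans (A1 _) (en_le_sup _).
move: h; rewrite ler_norml => /andP[h _].
by move: h; clear; lra.
Qed.

Lemma linear_contraction_dot_continuous z : continuous (fun x : 'rV[R]_m => dot (A (x - z)) (A (x - z))).
Proof.
have Ac : continuous (fun x : 'rV[R]_m => A (x - z)).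
  apply: (@lip_map_continuous _ m%:R) => // x y; rewrite -AB opprB addrA subrK.
  exact: linear_contraction_sup.
move=> x.
exact: (@continuous_comp _ _ _ (fun x : 'rV[R]_m => A (x - z)) (fun v => dot v v) x (Ac x) (@continuous_dot_self _ _ _)).
Qed.

End LinearMap.
End Semiconvexity.

(** * Projection onto a complex line and rotations of that line *)

Section ComplexLine.
Context {R : realType} {n : nat}.
Local Notation Cn := ('rV[R]_(n + n)).

Lemma cscl01 (x : Cn) : cscl 0 1 x = mulI x.
Proof. by rewrite /cscl scale1r scale0r add0r. Qed.

Variable w : Cn.
Hypothesis w0 : w != 0.
Implicit Types (x y z : Cn) (s t : R).

(** Orthogonal projection onto the complex line of [w]; the coefficients are the real and imaginary
    parts of the Hermitian product with [w], divided by |w|^2. *)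
Definition cproj y : Cn := cscl (dot y w / dot w w) (dot y (mulI w) / dot w w) w.

Definition cperp y : Cn := y - cproj y.

(** For s^2 + t^2 = 1, the isometry that rotates the complex line of [w] and fixes its orthogonal
    complement: it extends a rotation of the disc to a tube around it. *)
Definition twist s t y : Cn := cscl s t (cproj y) + cperp y.

Let W0 : dot w w != 0. Proof. by rewrite gt_eqF// dot_gt0. Qed.

Lemma cproj_perp y : cproj y + cperp y = y.
Proof. by rewrite addrC subrK. Qed.

Lemma cprojD x y : cproj (x + y) = cproj x + cproj y.
Proof. by rewrite /cproj !dotDl !mulrDl /cscl !scalerDl addrACA. Qed.

Lemma cprojZ a y : cproj (a *: y) = a *: cproj y.
Proof. by rewrite /cproj !dotZl -!mulrA /cscl scalerDr !scalerA. Qed.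

Lemma cperpD x y : cperp (x + y) = cperp x + cperp y.
Proof. by rewrite /cperp cprojD opprD addrACA. Qed.

Lemma cperpZ a y : cperp (a *: y) = a *: cperp y.
Proof. by rewrite /cperp cprojZ scalerBr. Qed.

Lemma twistD s t x y : twist s t (x + y) = twist s t x + twist s t y.
Proof. by rewrite /twist cprojD cperpD csclD addrACA. Qed.

Lemma twistZ s t a y : twist s t (a *: y) = a *: twist s t y.
Proof. by rewrite /twist [RHS]scalerDr cprojZ cperpZ csclZ. Qed.

Lemma twistB s t x y : twist s t (x - y) = twist s t x - twist s t y.
Proof. by rewrite twistD -scaleN1r twistZ scaleN1r. Qed.

Lemma cproj_cscl s t : cproj (cscl s t w) = cscl s t w.
Proof.
rewrite /cproj; congr cscl; rewrite /cscl dotDl !dotZl ?dot_mulI ?dot_mulIl dot_mulI_self.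
  by rewrite oppr0 mulr0 addr0 mulfK.
by rewrite mulr0 add0r mulfK.
Qed.

Lemma cperp_cscl s t : cperp (cscl s t w) = 0.
Proof. by rewrite /cperp cproj_cscl subrr. Qed.

Lemma dot_cperp y s t : dot (cperp y) (cscl s t w) = 0.
Proof.
have h1 : dot (cperp y) w = 0.
  rewrite /cperp /cproj /cscl dotDl dotNl dotDl !dotZl dot_mulIl dot_mulI_self oppr0 mulr0 addr0.
  by rewrite divfK// subrr.
have h2 : dot (cperp y) (mulI w) = 0.
  rewrite /cperp /cproj /cscl dotDl dotNl dotDl !dotZl dot_mulI dot_mulI_self mulr0 add0r.
  by rewrite divfK// subrr.
by rewrite /cscl dotDr !dotZr h1 h2 !mulr0 addr0.
Qed.

Lemma dot_twist s t y : s ^+ 2 + t ^+ 2 = 1 -> dot (twist s t y) (twist s t y) =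
  dot (cproj y) (cproj y) + dot (cperp y) (cperp y).
Proof.
move=> st; rewrite /twist.
have := dot_cscl s t (cproj y); rewrite st mul1r.
have : dot (cperp y) (cscl s t (cproj y)) = 0 by rewrite /cproj csclM dot_cperp.
move: (cscl s t (cproj y)) (cperp y) => p q pc <-.
by rewrite dotDl !dotDr [dot p q]dotC pc addr0 add0r.
Qed.

Lemma dot_cproj_perp y : dot y y = dot (cproj y) (cproj y) + dot (cperp y) (cperp y).
Proof.
rewrite -(@dot_twist 1 0) ?expr1n ?expr0n ?addr0//.
by rewrite /twist /cscl scale1r scale0r addr0 cproj_perp.
Qed.

Lemma en_twist s t y : s ^+ 2 + t ^+ 2 = 1 -> euclid_norm (twist s t y) = euclid_norm y.
Proof. by move=> st; rewrite !en_sqrt dot_twist// -dot_cproj_perp. Qed.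

Lemma en_cproj y : euclid_norm (cproj y) <= euclid_norm y.
Proof. by rewrite !en_sqrt ler_wsqrtr// (dot_cproj_perp y) lerDl dot_ge0. Qed.

Lemma en_cperp y : euclid_norm (cperp y) <= euclid_norm y.
Proof. by rewrite !en_sqrt ler_wsqrtr// (dot_cproj_perp y) lerDr dot_ge0. Qed.

Lemma cproj_unit y : exists s t, cproj y = cscl s t w /\
  s ^+ 2 + t ^+ 2 = dot (cproj y) (cproj y) / dot w w.
Proof.
exists (dot y w / dot w w), (dot y (mulI w) / dot w w); split => //.
by rewrite /cproj dot_cscl mulfK.
Qed.

Lemma twist_cscl s t a b : twist s t (cscl a b w) = cscl a b (cscl s t w).
Proof.
by rewrite /twist cperp_cscl addr0 cproj_cscl !csclM; congr cscl; rewrite mulrC [t * _]mulrC // addrC.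
Qed.

Lemma cproj_self : cproj w = w.
Proof. by have := cproj_cscl 1 0; rewrite cscl1. Qed.

Lemma cproj_mulI : cproj (mulI w) = mulI w.
Proof. by have := cproj_cscl 0 1; rewrite cscl01. Qed.

Lemma cperp_self : cperp w = 0.
Proof. by rewrite /cperp cproj_self subrr. Qed.

Lemma cperp_mulI : cperp (mulI w) = 0.
Proof. by rewrite /cperp cproj_mulI subrr. Qed.

Lemma twist_self s t : twist s t w = cscl s t w.
Proof. by rewrite -[in LHS](cscl1 w) twist_cscl cscl1. Qed.

Lemma twist_mulI s t : twist s t (mulI w) = mulI (cscl s t w).
Proof. by rewrite -[in LHS](cscl01 w) twist_cscl cscl01. Qed.

End ComplexLine.

Lemma continuous_sum_ord (R : realType) (m : nat) (f : nat -> 'rV[R]_m -> R) x (N : nat) :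
  (forall k, {for x, continuous (f k)}) -> continuous_at x (fun y => \sum_(k < N) f k y).
Proof.
move=> fc; elim: N => [|N IH].
  have -> : (fun y => \sum_(k < 0) f k y) = cst 0 by apply/funext => y; rewrite big_ord0.
  exact: cst_continuous.
have -> : (fun y => \sum_(k < N.+1) f k y) = (fun y => \sum_(k < N) f k y + f N y).
  by apply/funext => y; rewrite big_ord_recr.
exact: (@cvgD _ _ _ (nbhs x) _ _ _ _ _ IH (fc N)).
Qed.

Lemma amgm_quadratic (R : realType) (a v k e : R) : 0 < k -> a ^+ 2 <= k * e -> a * v <= k * v ^+ 2 + e / 4.
Proof.
move=> k0 h; rewrite -(ler_pM2l k0).
have := sqr_ge0 (k * v - a / 2).
have -> : (k * v - a / 2) ^+ 2 = k * (k * v ^+ 2) - k * (a * v) + a ^+ 2 / 4 by field.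
by move: h; rewrite [k * (_ + _)]mulrDr mulrA; move: (k * (a * v)) => x; lra.
Qed.

(** * Semiconvex functions that satisfy the four-point inequality off a null set *)

Section SemiconvexPlurisubharmonic.
Context {R : realType} {n : nat}.
Local Notation Cn := ('rV[R]_(n + n)).

Lemma subrDl (U : zmodType) (x y z : U) : z + x - (z + y) = x - y.
Proof. by rewrite [z + x]addrC addrKA. Qed.

Lemma sum4D (f g : Cn -> R) z w : sum4 (fun x => f x + g x) z w = sum4 f z w + sum4 g z w.
Proof. rewrite /sum4; ring. Qed.

Lemma sum4_sum (f : nat -> Cn -> R) N z w :
  sum4 (fun x => \sum_(k < N) f k x) z w = \sum_(k < N) sum4 (f k) z w.
Proof. by rewrite /sum4 !big_split. Qed.

Lemma le_sum4_affine (f : Cn -> R) (p z w : Cn) (K : set Cn) :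
  (forall x, K x -> f x <= f z + dot p (x - z)) ->
  K (z + w) -> K (z + mulI w) -> K (z - w) -> K (z - mulI w) -> sum4 f z w <= 4 * f z.
Proof.
move=> H /H h1 /H h2 /H h3 /H h4; rewrite /sum4; move: h1 h2 h3 h4.
rewrite ![z + _ - z]addrC !addKr !dotNr; clear; lra.
Qed.

Lemma sum4_square (A : Cn -> Cn) (c : R) (z x d : Cn) : (forall x y, A (x + y) = A x + A y) ->
  (forall a x, A (a *: x) = a *: A x) ->
  sum4 (fun x => c * dot (A (x - z)) (A (x - z))) x d =
  4 * (c * dot (A (x - z)) (A (x - z))) + 2 * c * (dot (A d) (A d) + dot (A (mulI d)) (A (mulI d))).
Proof.
move=> AD AZ.
have AN (y : Cn) : A (- y) = - A y by rewrite -scaleN1r AZ scaleN1r.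
have E (y : Cn) : A (x + y - z) = A (x - z) + A y by rewrite -AD addrAC.
rewrite /sum4 !E !AN; move: (A (x - z)) (A d) (A (mulI d)) => p q r.
rewrite !(dotDl, dotDr, dotNl, dotNr) [dot q p]dotC [dot r p]dotC; ring.
Qed.

(* If the N-point circle means of [u] at [z] fall short of [u z], the function
   [sum_k u o R_k + eps |P|^2 - Kc |Q|^2] has a touching upper hyperplane at a point [x] whose rotated
   copies avoid [Z]; the four-point means at these copies then contradict concavity along the disc. *)
Lemma semiconvex_plurisubharmonic (D Z : set Cn) (u : Cn -> R) : (0 < n)%N -> open D ->
  {in D, continuous u} ->
  (forall K, compact K -> K `<=` D -> exists2 L : R, 0 < L &
     forall x y, K x -> K y -> `|u x - u y| <= L * `|x - y|) ->
  (forall K, compact K -> K `<=` D -> exists2 C : R, 0 < C & semiconvex_on K u C) ->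
  cube_null Z ->
  (forall y w (eta : R), D y -> ~ Z y -> 0 < eta -> exists2 r0 : R, 0 < r0 &
     forall r, 0 < r -> r < r0 -> 4 * u y - eta * r ^+ 2 <= sum4 u y (r *: w)) ->
  plurisubharmonic D u.
Proof.
move=> n0 Do uc ulip usc Z0 us.
have disc_compact (z w : Cn) : compact [set z + cscl c.1 c.2 w | c in [set c : R * R | c.1 ^+ 2 + c.2 ^+ 2 <= 1]].
  apply: continuous_compact; last by have := @compact_disc R 1; rewrite expr1n.
  apply: continuous_subspaceT => c; apply: cvgD; first exact: cvg_cst.
  by apply: cvgD; apply: cvgZr_tmp; [exact: cvg_fst|exact: cvg_snd].
apply: plurisubharmonic_discrete => //.
  move=> z w Dw.
  have [|L L0 HL] := ulip _ (disc_compact z w); first by move=> _ [c /= c1 <-]; exact: Dw.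
  exists L => // x y [s [t [st ->]]] [s' [t' [st' ->]]].
  have -> : cscl s t w - cscl s' t' w = z + cscl s t w - (z + cscl s' t' w).
    by rewrite subrDl.
  by apply: HL; [exists (s, t)|exists (s', t')] => //=; rewrite ?st ?st'.
move=> z w N eta N0 eta0 Dw Hsum.
have N0' : 0 < N%:R :> R by rewrite ltr0n.
have [w0|w0] := eqVneq w 0.
  have c0 s t : cscl s t (0 : Cn) = 0 by rewrite /cscl mulI0 !scaler0 addr0.
  have := Hsum 1 0; rewrite expr1n expr0n addr0 w0 c0 => /(_ erefl).
  under eq_bigr do rewrite /rot c0 addr0.
  rewrite sumr_const card_ord -[X in X <= _]mulr_natl ler_pM2l//; move: eta0; clear; lra.
have W0 := dot_gt0 w0.
pose disc := [set c : R * R | c.1 ^+ 2 + c.2 ^+ 2 <= 1].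
have [e0 e00 He0] : exists2 e : R, 0 < e & forall c v, disc c -> `|v| < e -> D (z + cscl c.1 c.2 w + v).
  have dc : compact disc by have := @compact_disc R 1; rewrite expr1n.
  have [|c dcc|e e0 He] := @compact_tube R (n + n) _ disc (fun c => z + cscl c.1 c.2 w) D dc.
  - move=> c; apply: cvgD; first exact: cvg_cst.
    by apply: cvgD; apply: cvgZr_tmp; [exact: cvg_fst|exact: cvg_snd].
  - by apply: open_nbhs_nbhs; split => //; exact: Dw.
  - by exists e.
pose sg := e0 / 2; have sg0 : 0 < sg by rewrite divr_gt0.
pose K1 := [set x | exists c v, [/\ disc c, euclid_norm v <= sg & x = z + cscl c.1 c.2 w + v]].
have K1D : K1 `<=` D.
  move=> _ [c [v [dc vs ->]]]; apply: He0 => //; apply: le_lt_trans (sup_le_en _) (le_lt_trans vs _).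
  by rewrite /sg; move: e00; clear; lra.
have K1c : compact K1.
  have dc : compact disc by have := @compact_disc R 1; rewrite expr1n.
  have := compact_setX dc (@compact_en_ball R (n + n) sg).
  move=> /(@continuous_compact _ _ (fun p : (R * R) * Cn => z + cscl p.1.1 p.1.2 w + p.2)) H.
  rewrite (_ : K1 = (fun p : (R * R) * Cn => z + cscl p.1.1 p.1.2 w + p.2) @` (disc `*` [set v : Cn | euclid_norm v <= sg])).
    apply: H; apply: continuous_subspaceT => p; apply: cvgD; last exact: cvg_snd.
    apply: cvgD; first exact: cvg_cst.
    have c1 : continuous (fun p : (R * R) * Cn => p.1) by move=> q; exact: cvg_fst.
    apply: cvgD; apply: cvgZr_tmp.
      by apply: (@cvg_comp _ _ _ (fun p : (R * R) * Cn => p.1) fst _ (nbhs p.1) _ (c1 p)); exact: cvg_fst.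
    by apply: (@cvg_comp _ _ _ (fun p : (R * R) * Cn => p.1) snd _ (nbhs p.1) _ (c1 p)); exact: cvg_snd.
  apply/seteqP; split => [_ [c [v [dcc vs ->]]]|_ [[c v] [dcc vs] <-]]; first by exists (c, v).
  by exists c, v.
have [L L0 HL] := ulip _ K1c K1D.
have [C C0 HC] := usc _ K1c K1D.
pose a k : R := cos (k%:R * (2 * pi / N%:R)); pose b k : R := sin (k%:R * (2 * pi / N%:R)).
have ab k : a k ^+ 2 + b k ^+ 2 = 1 by exact: cos2Dsin2.
pose T k (x : Cn) := z + twist w (a k) (b k) (x - z).
pose P (x : Cn) := dot (cproj w (x - z)) (cproj w (x - z)).
pose Q (x : Cn) := dot (cperp w (x - z)) (cperp w (x - z)).
(* A closed tube around the disc; its boundary consists of an edge, where the first inequality is an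
   equality, and a side, where the second one is. *)
pose K := [set x | P x <= dot w w /\ Q x <= sg ^+ 2].
have KE x : K x -> exists c, [/\ disc c, cproj w (x - z) = cscl c.1 c.2 w & euclid_norm (cperp w (x - z)) <= sg].
  move=> [Px Qx]; have [s [t [E st]]] := cproj_unit w0 (x - z).
  exists (s, t); split => //=; first by rewrite /disc /= st ler_pdivrMr// mul1r.
  by rewrite (en_le _ (ltW sg0)).
have discM k c : disc c -> disc (a k * c.1 - b k * c.2, a k * c.2 + b k * c.1).
  rewrite /disc /= => h; apply: le_trans h; rewrite le_eqVlt; apply/orP; left; apply/eqP.
  by rewrite -[RHS]mul1r -(ab k); ring.
have KT k x : K x -> K1 (T k x).
  move=> /KE[c [dc Ec Ep]]; exists (a k * c.1 - b k * c.2, a k * c.2 + b k * c.1), (cperp w (x - z)).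
  split => //; first exact: discM.
  by rewrite /T /twist Ec csclM addrA.
have Tz k : T k z = z.
  by rewrite /T subrr -(scale0r 0) twistZ scale0r addr0.
have Kz : K z.
  have p0 : cproj w 0 = 0 by rewrite -(scale0r 0) cprojZ !scale0r.
  have q0 : cperp w 0 = 0 by rewrite -(scale0r 0) cperpZ !scale0r.
  by rewrite /K /P /Q /= subrr p0 q0 dot0l sqr_ge0 ltW.
have contr k x : euclid_norm (twist w (a k) (b k) x) <= euclid_norm x.
  by rewrite en_twist.
pose V (x : Cn) := \sum_(k < N) u (T k x).
(* A quarter of the deficit [N%:R * eta], so that the bonus [ep] on the edge does not make up for
   the deficit. *)
pose ep := N%:R * eta / 4.
have ep0 : 0 < ep by rewrite divr_gt0// mulr_gt0.
pose B := euclid_norm w + sg.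
have B0 : 0 < B by rewrite ltr_wpDl ?en_ge0.
(* With the first term the penalty absorbs, up to [N%:R * eta / 4], the Lipschitz error on the edge
   caused by the offset from the disc; the second term keeps [G] low on the side. *)
pose Kc := (N%:R * L) ^+ 2 / (N%:R * eta) + (N%:R * L * B + ep + N%:R * eta) / sg ^+ 2.
have NL0 : 0 < N%:R * L by rewrite mulr_gt0.
have Ne0 : 0 < N%:R * eta by rewrite mulr_gt0.
have Kc1 : (N%:R * L) ^+ 2 <= Kc * (N%:R * eta).
  rewrite -ler_pdivrMr// /Kc lerDl divr_ge0 ?sqr_ge0// ltW// addr_gt0// addr_gt0//.
  by rewrite mulr_gt0.
have Kc2 : N%:R * L * B + ep + N%:R * eta <= Kc * sg ^+ 2.
  by rewrite -ler_pdivrMr ?exprn_gt0// /Kc lerDr divr_ge0 ?sqr_ge0// ltW.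
have Kc0 : 0 < Kc.
  by have := lt_le_trans (exprn_gt0 2 NL0) Kc1; rewrite pmulr_lgt0.
clearbody Kc.
pose G x := V x + (ep / dot w w * P x + - Kc * Q x).
have Gz : G z = N%:R * u z.
  have p0 : P z = 0.
    by rewrite /P subrr -(scale0r 0) cprojZ !scale0r dot0l.
  have q0 : Q z = 0.
    by rewrite /Q subrr -(scale0r 0) cperpZ !scale0r dot0l.
  rewrite /G p0 q0 !mulr0 !addr0 /V.
  under eq_bigr do rewrite Tz.
  by rewrite sumr_const card_ord mulr_natl.
have T_isom k x y : euclid_norm (T k x - T k y) = euclid_norm (x - y).
  have -> : T k x - T k y = twist w (a k) (b k) (x - y).
    by rewrite /T subrDl -twistB opprB addrA subrK.
  by rewrite en_twist.
have Vz x : K x -> V x <= N%:R * (u z + L * B).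
  move=> Kx; rewrite mulr_natl -[X in _ *+ X](card_ord N) -sumr_const; apply: ler_sum => k _.
  rewrite -lerBlDl.
  have := HL _ _ (KT k x Kx) (KT k z Kz); rewrite Tz => h.
  apply: le_trans (ler_norm _) (le_trans h _); rewrite ler_wpM2l ?(ltW L0)//.
  apply: le_trans (sup_le_en _) _; rewrite -{1}(Tz k) T_isom -(cproj_perp w (x - z)).
  apply: le_trans (enD _ _) _; have [Px Qx] := Kx; apply: lerD.
    by rewrite en_sqrt en_sqrt ler_wsqrtr.
  by rewrite (en_le _ (ltW sg0)).
(* Up to the offset, the rotated copies of an edge point are the nodes of one discrete mean, which
   [Hsum] bounds. *)
have Vedge x : K x -> P x = dot w w -> V x <= N%:R * (u z - eta) + N%:R * (L * euclid_norm (cperp w (x - z))).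
  move=> Kx Px; have [c [dc Ec Ep]] := KE x Kx.
  have c1 : c.1 ^+ 2 + c.2 ^+ 2 = 1.
    have := Px; rewrite /P Ec dot_cscl -[RHS]mul1r => /mulIf; apply; exact: lt0r_neq0.
  have := Hsum _ _ c1; set S := \sum_(k < N) _ => HS.
  apply: le_trans (_ : S + N%:R * (L * euclid_norm (cperp w (x - z))) <= _); last by rewrite lerD2r.
  rewrite [X in _ + X]mulr_natl -[X in _ *+ X](card_ord N) -sumr_const /S -big_split/=.
  apply: ler_sum => k _; rewrite -lerBlDl.
  have K1' : K1 (z + rot N k (cscl c.1 c.2 w)).
    exists (a k * c.1 - b k * c.2, a k * c.2 + b k * c.1), 0; split; first exact: discM.
      by rewrite en0 ltW.
    by rewrite /rot csclM addr0.
  apply: le_trans (ler_norm _) (le_trans (HL _ _ (KT k x Kx) K1') _).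
  rewrite ler_wpM2l ?(ltW L0)//; apply: le_trans (sup_le_en _) _.
  by rewrite /T /twist Ec subrDl addrAC subrr add0r.
have Tcont k : continuous (T k).
  apply: (@lip_map_continuous _ _ _ (n + n)%:R) => // x y.
  by apply: le_trans (sup_le_en _) _; rewrite T_isom; exact: en_le_sup.
have Pcont : continuous P.
  exact: (linear_contraction_dot_continuous (@cprojD _ _ w) (@cprojZ _ _ w) (en_cproj w0)).
have Qcont : continuous Q.
  exact: (linear_contraction_dot_continuous (@cperpD _ _ w) (@cperpZ _ _ w) (en_cperp w0)).
have Kcomp : compact K.
  apply: (subclosed_compact _ K1c).
    have -> : K = (P @^-1` [set t | t <= dot w w]) `&` (Q @^-1` [set t | t <= sg ^+ 2]) by [].
    by apply: closedI; apply: closed_comp; [move=> ? _; exact: Pcont|exact: closed_le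
       |move=> ? _; exact: Qcont|exact: closed_le].
  move=> x /KE[c [dc Ec Ep]]; exists c, (cperp w (x - z)); split => //.
  by rewrite -addrA -Ec cproj_perp addrC subrK.
have uTcont k x : K x -> {for x, continuous (fun x => u (T k x))}.
  move=> Kx; apply: (continuous_comp (Tcont k x)); apply: uc; rewrite inE.
  by apply: K1D; exact: KT.
have Gcont : {in K, continuous G}.
  move=> x /set_mem Kx.
  have Vc : {for x, continuous V}.
    by apply: (@continuous_sum_ord _ _ (fun k y => u (T k y))) => k; exact: uTcont.
  have Zc (c : R) (f : Cn -> R) : continuous f -> c * f y @[y --> x] --> c * f x.
    by move=> fc; apply: (@cvgM _ _ (nbhs x) _ (fun=> c) f c (f x)); [exact: cvg_cst|exact: fc].
  apply: (@cvgD _ _ _ (nbhs x) _ V (fun y => ep / dot w w * P y + - Kc * Q y) _ _ Vc).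
  exact: (@cvgD _ _ _ (nbhs x) _ _ _ _ _ (Zc _ _ Pcont) (Zc _ _ Qcont)).
have Kint x : K x -> G z - N%:R * eta / 4 <= G x -> nbhs x K.
  move=> Kx; rewrite Gz => Gx; have [Px Qx] := Kx.
  have Px' : P x < dot w w.
    rewrite lt_neqAle Px andbT; apply/eqP => PW.
    have h := Vedge x Kx PW; move: Gx; rewrite /G PW.
    set v := euclid_norm (cperp w (x - z)) in h.
    have -> : Q x = v ^+ 2 by rewrite en_sq.
    rewrite divfK ?gt_eqF//.
    have := amgm_quadratic v Kc0 Kc1; move: h Ne0; rewrite /ep mulrBr !mulrA mulNr.
    move: (N%:R * L * v) (Kc * v ^+ 2) (N%:R * u z) (N%:R * eta) (V x) => x1 x2 x3 x4 x5.
    by clear; lra.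
  have Qx' : Q x < sg ^+ 2.
    rewrite lt_neqAle Qx andbT; apply/eqP => QW.
    have h := Vz x Kx; move: Gx; rewrite /G QW.
    have h1 : ep / dot w w * P x <= ep.
      by rewrite mulrAC -mulrA ler_piMr ?(ltW ep0)// ler_pdivrMr// mul1r.
    move: h h1 Kc2 Ne0 ep0; rewrite /ep mulrDr mulrA; move: (N%:R * L * B) (N%:R * u z) (N%:R * eta).
    by move=> x1 x2 x3; clear; lra.
  have n1 := cvgr_lt _ (Pcont x) _ Px'; have n2 := cvgr_lt _ (Qcont x) _ Qx'.
  near=> y; split; apply: ltW; near: y; [exact: n1|exact: n2].
have nn0 : (0 < n + n)%N by rewrite addn_gt0 n0.
have [C' C'0 Gsc] : exists2 C' : R, 0 < C' & semiconvex_on K G C'.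
  pose m2 : R := (n + n)%:R ^+ 2.
  exists (N%:R * (C * m2) + (`|ep / dot w w| * m2 + `|- Kc| * m2)).
    have m20 : 0 < m2 by rewrite exprn_gt0// ltr0n.
    rewrite ltr_wpDr//; first by rewrite addr_ge0// mulr_ge0// ltW.
    by rewrite mulr_gt0// mulr_gt0.
  apply: semiconvex_onD; last apply: semiconvex_onD.
  - apply: (@semiconvex_on_sum _ _ K (fun k y => u (T k y))) => k.
    apply: (@semiconvex_on_comp _ _ _ (@twistD _ _ w (a k) (b k)) (@twistZ _ _ w (a k) (b k)) (contr k) K K1) => //.
      exact: ltW.
    exact: KT.
  - exact: (semiconvex_on_square (@cprojD _ _ w) (@cprojZ _ _ w) (en_cproj w0)).
  - exact: (semiconvex_on_square (@cperpD _ _ w) (@cperpZ _ _ w) (en_cperp w0)).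
(* A contact point off this union has all its rotated copies off [Z]. *)
pose Z' := \big[setU/set0]_(k <- iota 0 N) (T k @^-1` Z).
have Z'0 : cube_null Z'.
  apply: cube_null_bigcup_seq => k.
  apply: (@cube_null_lipschitz _ _ Z _ (n + n)%:R 1 (fun x y => x = T k y)) => //.
  - by rewrite ltr0n.
  - by move=> y Zy; exists (T k y).
  - move=> _ _ y y' _ _ -> -> _; apply: le_trans (sup_le_en _) _.
    by rewrite -(T_isom k); exact: en_le_sup.
have ne4 : 0 < N%:R * eta / 4 by rewrite divr_gt0.
have [x [p [Kx Zx Gx Htouch]]] := contact_point_outside_null nn0 Kcomp Gcont Kz ne4 C'0 Kint Gsc Z'0.
have nZ k : (k < N)%N -> ~ Z (T k x).
  move=> kN ZT; apply: Zx; rewrite /Z' -bigcup_seq; exists k => //=.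
  by rewrite mem_iota.
(* The losses [ep / N%:R * r ^+ 2] at the [N] copies add up to [ep * r ^+ 2], less than the gain
   [4 * ep * r ^+ 2] from the [P] term of [G]. *)
have [r0 r00 Hr0] : exists2 r0 : R, 0 < r0 & forall k r, (k < N)%N -> 0 < r -> r < r0 ->
    4 * u (T k x) - ep / N%:R * r ^+ 2 <= sum4 u (T k x) (r *: cscl (a k) (b k) w).
  suff H M : (M <= N)%N -> exists2 r0 : R, 0 < r0 & forall k r, (k < M)%N -> 0 < r -> r < r0 ->
      4 * u (T k x) - ep / N%:R * r ^+ 2 <= sum4 u (T k x) (r *: cscl (a k) (b k) w) by exact: H.
  elim: M => [_|M IH MN]; first by exists 1.
  have [r1 r10 H1] := IH (ltnW MN).
  have eN0 : 0 < ep / N%:R by rewrite divr_gt0.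
  have [r2 r20 H2] := us _ (cscl (a M) (b M) w) _ (K1D _ (KT M x Kx)) (nZ _ MN) eN0.
  exists (Num.min r1 r2) => [|k r kM r3]; first by rewrite lt_min r10.
  rewrite lt_min => /andP[rr1 rr2]; move: kM; rewrite ltnS leq_eqVlt => /orP[/eqP ->|kM].
    exact: H2.
  exact: H1.
have [d d0 Hd] := nbhs_enP (Kint x Kx Gx).
have ew := en_gt0 w0.
pose r := Num.min (r0 / 2) (d / 2 / euclid_norm w).
have r_gt0 : 0 < r by rewrite lt_min !divr_gt0.
have rr0 : r < r0.
  have : r <= r0 / 2 by rewrite ge_min lexx.
  by move: r00; clear; lra.
have rd : euclid_norm (r *: w) < d.
  rewrite enZ gtr0_norm//; apply: le_lt_trans (_ : d / 2 / euclid_norm w * euclid_norm w < d).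
    by rewrite ler_wpM2r ?en_ge0// ge_min lexx orbT.
  by rewrite divfK ?gt_eqF// ltr_pdivrMr// ltr_pMr// ltr1n.
clearbody r.
have upper : sum4 G x (r *: w) <= 4 * G x.
  have sh v : euclid_norm v < d -> K (x + v) by move=> vd; apply: Hd; rewrite addrC addKr.
  by apply: (le_sum4_affine Htouch); apply: sh; rewrite ?enN ?en_mulI.
have VE : sum4 V x (r *: w) = \sum_(k < N) sum4 u (T k x) (r *: cscl (a k) (b k) w).
  rewrite (sum4_sum (fun k y => u (T k y))); apply: eq_bigr => k _.
  have TD y : T k (x + y) = T k x + twist w (a k) (b k) y.
    by rewrite /T -[RHS]addrA -twistD; congr (z + twist w _ _ _); rewrite addrAC.
  have t1 : twist w (a k) (b k) (r *: w) = r *: cscl (a k) (b k) w by rewrite twistZ twist_self.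
  have t2 : twist w (a k) (b k) (mulI (r *: w)) = mulI (r *: cscl (a k) (b k) w).
    by rewrite !mulIZ twistZ twist_mulI.
  have tN y : twist w (a k) (b k) (- y) = - twist w (a k) (b k) y.
    by rewrite -sub0r twistB -(scale0r 0) twistZ !scale0r sub0r.
  by rewrite /sum4 !TD !tN t1 t2.
have PE : sum4 (fun x => ep / dot w w * P x) x (r *: w) = 4 * (ep / dot w w * P x) + 4 * ep * r ^+ 2.
  rewrite (sum4_square _ _ _ _ (@cprojD _ _ w) (@cprojZ _ _ w)); congr (_ + _).
  rewrite mulIZ !cprojZ (cproj_self w0) (cproj_mulI w0) !dotZl !dotZr dot_mulI.
  by field; rewrite gt_eqF.
have QE : sum4 (fun x => - Kc * Q x) x (r *: w) = 4 * (- Kc * Q x).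
  rewrite (sum4_square _ _ _ _ (@cperpD _ _ w) (@cperpZ _ _ w)).
  by rewrite mulIZ !cperpZ (cperp_self w0) (cperp_mulI w0) !scaler0 dot0l addr0 mulr0 addr0.
have GE : sum4 G x (r *: w) = sum4 V x (r *: w) + (4 * (ep / dot w w * P x) + 4 * ep * r ^+ 2 + 4 * (- Kc * Q x)).
  by rewrite /G !sum4D PE QE.
have lower : 4 * V x - ep * r ^+ 2 <= sum4 V x (r *: w).
  rewrite VE.
  have -> : 4 * V x - ep * r ^+ 2 = \sum_(k < N) (4 * u (T k x) - ep / N%:R * r ^+ 2).
    rewrite big_split/= -mulr_sumr sumr_const card_ord -mulr_natl; congr (_ + _).
    by field; rewrite gt_eqF.
  by apply: ler_sum => k _; apply: Hr0.
have er : 0 < ep * r ^+ 2 by rewrite mulr_gt0// exprn_gt0.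
move: upper lower er; rewrite GE /G; clear; lra.
Unshelve. all: by end_near.
Qed.

End SemiconvexPlurisubharmonic.

Lemma closure_minimal (T : topologicalType) (A C : set T) : closed C -> A `<=` C -> closure A `<=` C.
Proof. by move=> Cc AC; rewrite closureE => x; apply; split. Qed.

(** * Regularity of minus the logarithm of the distance *)

Section LogDistance.
Context {R : realType} {m : nat}.
Implicit Types (A K : set 'rV[R]_m).

Lemma ln_lip (c s t : R) : 0 < c -> c <= s -> c <= t -> `|ln s - ln t| <= c^-1 * `|s - t|.
Proof.
move=> c0.
suff H (x y : R) : c <= x -> c <= y -> ln x - ln y <= c^-1 * `|x - y|.
  by move=> cs ct; rewrite ler_norml H// lerNl opprB distrC H.
move=> cx cy; have x0 := lt_le_trans c0 cx; have y0 := lt_le_trans c0 cy.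
rewrite -ln_div ?posrE//.
have -> : x / y = 1 + (x - y) / y by rewrite mulrBl divff ?gt_eqF// addrC subrK.
apply: le_trans (le_ln1Dx _) _.
  by rewrite mulrBl divff ?gt_eqF// ltrBrDl subrr divr_gt0.
rewrite mulrC; apply: (@le_trans _ _ (y^-1 * `|x - y|)).
  by rewrite ler_wpM2l ?ler_norm// invr_ge0 ltW.
by rewrite ler_wpM2r// lef_pV2 ?posrE.
Qed.

Lemma cdist_compact_lower A K : open A -> ~` A !=set0 -> compact K -> K `<=` A ->
  exists2 c : R, 0 < c & forall x, K x -> c <= cdist A x.
Proof.
move=> Ao A0 Kc KA; have [K0|K0] := pselect (K !=set0); last first.
  by exists 1 => // x Kx; exfalso; apply: K0; exists x.
have [x0 /set_mem Kx0 H] := EVT_min_rV K0 Kc (continuous_subspaceT (continuous_cdist Ao A0)).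
by exists (cdist A x0) => [|x Kx]; [apply: cdist_gt0 => //; exact: KA|apply: H; rewrite inE].
Qed.

Lemma ln_cdist_continuous A : open A -> ~` A !=set0 -> {in A, continuous (fun x => - ln (cdist A x))}.
Proof.
move=> Ao A0 x /set_mem Ax.
have lc : {for x, continuous (@ln R \o cdist A)}.
  apply: continuous_comp; first exact: continuous_cdist.
  by apply: continuous_ln; exact: cdist_gt0.
exact: (@cvgN _ _ _ (nbhs x) _ (@ln R \o cdist A) _ lc).
Qed.

Lemma ln_cdist_lipschitz A K : open A -> ~` A !=set0 -> compact K -> K `<=` A ->
  exists2 L : R, 0 < L & forall x y, K x -> K y ->
    `|- ln (cdist A x) - - ln (cdist A y)| <= L * `|x - y|.
Proof.
move=> Ao A0 Kc KA; have [c c0 Hc] := cdist_compact_lower Ao A0 Kc KA.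
exists (c^-1 * m.+1%:R) => [|x y Kx Ky]; first by rewrite mulr_gt0// invr_gt0.
rewrite -opprD normrN; apply: le_trans (ln_lip c0 (Hc x Kx) (Hc y Ky)) _.
rewrite -mulrA ler_wpM2l ?invr_ge0 ?(ltW c0)//.
apply: le_trans (cdist_lip _ _ Ao A0) (le_trans (en_le_sup _) _).
by rewrite ler_wpM2r// ler_nat.
Qed.

(** The coefficient 1 / (2 d^2) of the supporting paraboloids is bounded on [K] because the distance
    d is bounded below there; [m.+1%:R ^+ 2] passes to the sup norm. *)
Lemma ln_cdist_semiconvex A K : open A -> ~` A !=set0 -> compact K -> K `<=` A ->
  exists2 C : R, 0 < C & semiconvex_on K (fun x => - ln (cdist A x)) C.
Proof.
move=> Ao A0 Kc KA; have [c c0 Hc] := cdist_compact_lower Ao A0 Kc KA.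
have c2 : 0 < 2 * c ^+ 2 by rewrite mulr_gt0// exprn_gt0.
exists (m.+1%:R ^+ 2 / (2 * c ^+ 2)) => [|x Kx]; first by rewrite divr_gt0// exprn_gt0.
have [b Ab xb] := cdist_attained x Ao A0.
exists (- (cdist A x ^- 2 *: (x - b))) => y Ky.
have := ln_cdist_paraboloid Ao A0 (KA _ Kx) (KA _ Ky) Ab xb; apply: le_trans.
rewrite dotNl; apply: lerB => //.
have d2 : 2 * c ^+ 2 <= 2 * cdist A x ^+ 2.
  by rewrite ler_pM2l// ler_pXn2r ?nnegrE ?(ltW c0)// ?Hc// (le_trans (ltW c0))// Hc.
rewrite [leRHS]mulrAC -exprMn; apply: ler_pM; rewrite ?invr_ge0 ?(le_trans (ltW c2) d2) ?sqr_ge0//.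
  rewrite ler_pXn2r ?nnegrE ?en_ge0 ?mulr_ge0//.
  by apply: le_trans (en_le_sup _) _; rewrite ler_wpM2r// ler_nat.
by rewrite lef_pV2 ?posrE//; exact: lt_le_trans c2 d2.
Qed.

(** Points of the segment from [b] to [y] other than [b] lie in the open ball around [y] of radius
    [cdist A y], hence in [A]. *)
Lemma nearest_point_closure A y b : A y -> ~ A b -> cdist A y = euclid_norm (y - b) -> closure A b.
Proof.
move=> Ay Ab yb B /nbhs_enP[e e0 HB].
have yb0 : y - b != 0 by rewrite subr_eq0; apply: contra_notN Ab => /eqP <-.
have d0 := en_gt0 yb0; set d := euclid_norm (y - b) in yb d0.
pose t := Num.min 1 (e / 2 / d).
have t0 : 0 < t by rewrite lt_min ltr01 !divr_gt0.
have t1 : t <= 1 by rewrite ge_min lexx.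
have td : t * d < e.
  have : t * d <= e / 2 by rewrite -ler_pdivlMr// ge_min lexx orbT.
  by move: e0; clear; lra.
exists (b + t *: (y - b)); split.
  apply: (@cdist_ball _ _ _ y); rewrite yb.
  have -> : b + t *: (y - b) - y = - ((1 - t) *: (y - b)).
    by apply/rowP => i; rewrite !mxE; ring.
  by rewrite enN enZ ger0_norm ?subr_ge0// -/d gtr_pMl// ltrBlDr ltrDl.
by apply: HB; rewrite addrC addKr enZ gtr0_norm.
Qed.

End LogDistance.

Lemma ln_cdist_exhaustion (R : realType) (n : nat) (A : set 'rV[R]_(n + n)) :
  open A -> ~` A !=set0 -> bounded_set A -> exhaustion A (fun x => - ln (cdist A x)).
Proof.
move=> Ao A0 [M [Mr HM]] c /=; set L := [set z | _].
have LC : closure L `<=` [set x | expR (- c) <= cdist A x].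
  have cl : closed [set x | expR (- c) <= cdist A x].
    have -> : [set x | expR (- c) <= cdist A x] = cdist A @^-1` [set t | expR (- c) <= t] by [].
    by apply: closed_comp; [move=> x _; exact: continuous_cdist|exact: closed_ge].
  apply: (closure_minimal cl) => y [Ay yc] /=; apply: ltW.
  have dy := cdist_gt0 Ao A0 Ay.
  by rewrite -[ltRHS]lnK ?posrE// ltr_expR ltrNl.
have LA : closure L `<=` A.
  move=> x /LC /= cx; apply: contrapT => Ax.
  have := le_trans cx (cdist_le x Ax); rewrite subrr en0.
  by rewrite leNgt expR_gt0.
split => //; rewrite precompactE; apply: bounded_closed_compact; last exact: closed_closure.
by exists M; split => // N MN x /LA; exact: HM.
Qed.

(** * Pseudoconvexity from the four-point inequality off a null set *)

Lemma pseudoconvex_off_null (R : realType) (n : nat) (A Z : set 'rV[R]_(n + n)) : (0 < n)%N ->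
  open A -> ~` A !=set0 -> bounded_set A -> cube_null Z ->
  (forall y w (eta : R), A y -> ~ Z y -> 0 < eta -> exists2 r0 : R, 0 < r0 &
     forall r, 0 < r -> r < r0 ->
       - (4 * ln (cdist A y)) - eta * r ^+ 2 <= sum4 (fun x => - ln (cdist A x)) y (r *: w)) ->
  pseudoconvex A.
Proof.
move=> n0 Ao A0 Ab Z0 H; split => //; exists (fun x => - ln (cdist A x)); split.
- exact: ln_cdist_continuous.
- apply: (@semiconvex_plurisubharmonic _ _ A Z) => //.
  + exact: ln_cdist_continuous.
  + by move=> K Kc KA; exact: ln_cdist_lipschitz.
  + by move=> K Kc KA; exact: ln_cdist_semiconvex.
  + by move=> y w eta Ay Zy eta0; rewrite mulrN; exact: H.
- exact: ln_cdist_exhaustion.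
Qed.

Lemma bounded_setC_nonempty (R : realType) (m : nat) (A : set 'rV[R]_m) : (0 < m)%N ->
  bounded_set A -> ~` A !=set0.
Proof.
case: m A => // m A _ [M [Mr HM]].
exists (const_mx (`|M| + 2)) => /= Ax.
have := HM (`|M| + 1) _ _ Ax; rewrite (le_lt_trans (ler_norm M)) ?ltrDl// => /(_ isT).
have := ler_coord_sup (const_mx (`|M| + 2) : 'rV[R]_m.+1) ord0; rewrite mxE.
have := ler_norm (`|M| + 2); rewrite /=; clear; lra.
Qed.

Theorem theorem1p1 (R : realType) (n : nat) (hn : (0 < n)%N)
    (rho : 'rV[R]_(n + n) -> R) (Omega V F : set 'rV[R]_(n + n)) (c0 : R)
    (rho_cont : continuous rho)
    (Omega_def : Omega = [set z | rho z < 0])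
    (Omega_domain : domain Omega)
    (Omega_bounded : bounded_set Omega)
    (zero_boundary : [set z | rho z = 0] = boundary Omega)
    (V_open : open V)
    (V_nbhd : [set z | rho z = 0] `<=` V)
    (rho_C11 : C11_on V rho)
    (c0_gt0 : 0 < c0)
    (rho_grad : forall z, V z -> c0 <= euclid_norm (gradient rho z))
    (F_closed : closed F)
    (F_sub : F `<=` boundary Omega)
    (smooth_off_F : forall zeta, (boundary Omega `\` F) zeta ->
       C2_hypersurface_at (boundary Omega) zeta)
    (locally_pseudoconvex_off_F : forall zeta, (boundary Omega `\` F) zeta ->
       exists r : R, 0 < r /\ pseudoconvex (euclid_ball zeta r `&` Omega))
    (F_null : hypersurface_null (boundary Omega) F) :
  pseudoconvex Omega.
Proof.
have [opO _ _] := Omega_domain.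
have nn0 : (0 < n + n)%N by rewrite addn_gt0 hn.
have OmegaC := bounded_setC_nonempty nn0 Omega_bounded.
have rho_C1 : C1_on V rho by case: rho_C11.
have FV : F `<=` V by move=> x /F_sub; rewrite -zero_boundary; exact: V_nbhd.
have gradV x : V x -> gradient rho x != 0.
  move=> /rho_grad; apply: contraTneq => ->; by rewrite en0 -ltNge.
have [M M0 HM] : exists2 M : R, 0 < M & forall x, closure Omega x -> `|x| <= M.
  have [M [Mr HM]] := Omega_bounded; exists (`|M| + 1); first by rewrite ltr_wpDl.
  have cl : closed [set x : 'rV[R]_(n + n) | `|x| <= `|M| + 1].
    have -> : [set x : 'rV[R]_(n + n) | `|x| <= `|M| + 1] = Num.norm @^-1` [set t | t <= `|M| + 1] by [].
    by apply: closed_comp; [move=> x _; exact: norm_continuous|exact: closed_le].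
  apply: (closure_minimal cl) => y Oy /=.
  by apply: HM Oy; rewrite (le_lt_trans (ler_norm M))// ltrDl.
have F_compact : compact F.
  apply: bounded_closed_compact => //; exists M; split; first exact: num_real.
  by move=> N MN x /F_sub[/HM xM _]; exact: le_trans xM (ltW MN).
(* Bounds the flow time: the gradient has length at least [c0], and points of the closure are at
   most [(n + n)%:R * (M + M)] apart. *)
pose T := (n + n)%:R * (M + M) / c0.
have T0 : 0 < T by rewrite divr_gt0// mulr_gt0 ?ltr0n ?addr_gt0.
have nearest y b : Omega y -> ~ Omega b -> cdist Omega y = euclid_norm (y - b) -> boundary Omega b.
  by move=> Oy Ob yb; split; [exact: nearest_point_closure yb|move=> /interior_subset].
apply: (@pseudoconvex_off_null _ _ Omega _ hn opO OmegaC Omega_bounded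
  (cube_null_normal_flow rho_C11 FV F_sub F_compact F_null T0)).
move=> y w eta Oy Zy eta0.
have [b Ob yb] := cdist_attained y opO OmegaC.
have bb := nearest _ _ Oy Ob yb.
have rb : rho b = 0 by have := bb; rewrite -zero_boundary.
have Vb : V b by apply: V_nbhd.
have Fb : ~ F b.
  move=> Fb; apply: Zy; exists b => //.
  have [d d0 Hd] := C1_strict_diff V_open rho_C1 Vb ltr01.
  have yb0 : y != b by apply: contra_notN Ob => /eqP <-.
  have [a a0 ga] : exists2 a, a < 0 & gradient rho b = a *: (y - b).
    apply: (@interior_ball_normal _ _ rho y b (gradient rho b) 1) => //; last exact: gradV.
      move=> e e0; have [d' d'0 Hd'] := C1_strict_diff V_open rho_C1 Vb e0.
      exists d' => // v vd; have := Hd' b (b + v).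
      by rewrite subrr normr0 addrC addKr rb subr0; apply.
    move=> x xy _; have : Omega x by apply: (@cdist_ball _ _ _ y); rewrite yb.
    by rewrite Omega_def.
  have a1 : 0 < - a^-1 by rewrite oppr_gt0 invr_lt0.
  (* Since [gradient rho b = a *: (y - b)] with [a < 0], the normal from [b] reaches [y] at time - 1
     / a, so [y] would belong to the null set. *)
  exists (- a^-1); last first.
    by rewrite ga scalerA mulNr mulVf ?lt_eqF// scaleN1r opprK addrC subrK.
  rewrite ltW//= ler_pdivlMr//; apply: (@le_trans _ _ (euclid_norm (y - b))).
    apply: (@le_trans _ _ (- a^-1 * euclid_norm (gradient rho b))).
      by rewrite ler_wpM2l ?(ltW a1)// rho_grad.
    by rewrite ga enZ ltr0_norm// mulrA mulrNN mulVf ?lt_eqF// mul1r.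
  apply: le_trans (en_le_sup _) _; rewrite ler_wpM2l//.
  apply: le_trans (ler_normB _ _) _; apply: lerD; apply: HM; last by case: bb.
  exact: subset_closure.
have bF : (boundary Omega `\` F) b by [].
have [f [g [N [nu [k [d LD]]]]]] := C2_hypersurface_local_defining rho_cont V_open rho_C1 Vb rb
  (gradV b Vb) zero_boundary (smooth_off_F b bF).
have [r [r0 psc]] := locally_pseudoconvex_off_F b bF.
rewrite Omega_def in Oy yb psc *.
apply: (ln_cdist_sum4 w rho_cont LD rb Oy yb _ eta0) => X gX gIX.
exact: levi_form_ge0 rho_cont LD rb r0 psc gX gIX.
Qed.
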